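(* Let $y$ be a solution of Painlevé's first equation $y''=6y^2+z$, let $D\subset\mathbb C$ be an open disk in which $y$ is meromorphic, and let $\tilde z\in\partial D$ be a singular point of $y$. Then $\tilde z$ is a second order pole of $y$.
   Context: A singular point $\tilde z\in\partial D$ of $y$ is a boundary point of $D$ such that $y$ does not extend analytically to a neighborhood of $\tilde z$. *)

(* Defs.v *)
From Stdlib Require Export Reals.
From Coquelicot Require Export Coquelicot.
Open Scope C_scope.

(* The Euclidean disk. Coquelicot's [ball] on [C] is a square (sup norm of the
   two coordinates), hence the explicit modulus. *)
Definition disk (c : C) (r : R) (z : C) : Prop := (Cmod (z - c) < r)%R.

Definition boundary (D : C -> Prop) (z : C) : Prop :=
  forall e : R, (0 < e)%R ->
    (exists w, disk z e w /\ D w) /\ (exists w, disk z e w /\ ~ D w).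

Definition analytic_at (f : C -> C) (w : C) : Prop :=
  exists (a : nat -> C) (r : R), (0 < r)%R /\
    forall z, disk w r z ->
      @is_pseries C_AbsRing C_NormedModule a (z - w) (f z).

Definition analytic_on (U : C -> Prop) (f : C -> C) : Prop :=
  forall w, U w -> analytic_at f w.

(* The value [f w] of the total function [f] at the pole itself is irrelevant. *)
Definition pole_of_order (n : nat) (f : C -> C) (w : C) : Prop :=
  exists (g : C -> C) (r : R), (0 < r)%R /\
    analytic_at g w /\ g w <> 0 /\
    forall z, disk w r z -> z <> w -> f z = g z / (z - w) ^ n.

Definition meromorphic_on (D : C -> Prop) (f : C -> C) : Prop :=
  forall w, D w ->
    analytic_at f w \/ exists n : nat, (1 <= n)%nat /\ pole_of_order n f w.

(* The equation y'' = 6 y^2 + z at all points of [D] other than the poles.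
   Near such a point [y] is complex differentiable, so that the total operator
   [C_derive] is the derivative there. *)
Definition painleve1_solution_on (D : C -> Prop) (y : C -> C) : Prop :=
  forall z, D z -> analytic_at y z ->
    @is_derive C_AbsRing C_NormedModule (C_derive y) z (6 * y z ^ 2 + z).

(* [g] continues the restriction of [y] to [D] to the disk of radius [e]
   about [z]. The values of [y] outside [D] play no role. *)
Definition continues (D : C -> Prop) (y : C -> C) (z : C) (e : R)
    (g : C -> C) : Prop :=
  forall w, D w -> disk z e w -> g w = y w.

Definition extends_analytically (D : C -> Prop) (y : C -> C) (z : C) : Prop :=
  exists (e : R) (g : C -> C), (0 < e)%R /\
    analytic_on (disk z e) g /\ continues D y z e g.

Definition singular_point (D : C -> Prop) (y : C -> C) (z : C) : Prop :=
  boundary D z /\ ~ extends_analytically D y z.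

(* [z] need not belong to [D]: it is a pole of the continuation of [y]. *)
Definition extends_with_pole_of_order (n : nat) (D : C -> Prop) (y : C -> C)
    (z : C) : Prop :=
  exists (e : R) (g : C -> C), (0 < e)%R /\
    pole_of_order n g z /\ continues D y z e g.

(* Main.v *)
(* With [W = y'^2 - 4 y^3 - 2 z y] one has [W' = - 2 y], which is too large near poles. Adding
   [y' / y] repairs this near poles but breaks down near zeros of [y]. The corrected energy
   [V = W + y' conj(y) / (1 + |y|^2)] is not holomorphic, but it is differentiable along every
   segment and satisfies [|V'| <= K (1 + |V|)] there, with [K] depending only on a bound for [|z|].
   So by Gronwall [V] stays bounded along a segment of the disk ending at the singular point, the
   isolated poles on it being avoided by short detours.

   Take a regular point [z1] of the segment close to the singular point. If [|y z1| <= 1], then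
   [y' z1] is bounded as well. Otherwise write [y = 1 / u^2]; then [u] and the second coordinate [v]
   given by [y' = - 2 / u^3 - z u / 2 - u^2 / 2 + v u^3] are bounded at [z1] and solve a polynomial
   system. In both cases the local solution is analytic in a disk whose radius does not depend on
   [z1], hence at the singular point. There [u] must vanish, with [u' = 1], which gives the double
   pole. *)

Require Import Defs.
From Stdlib Require Import Lra Lia Arith ClassicalEpsilon FunctionalExtensionality.

(** * Complex power series *)

(** The factor [conj(y) / (1 + |y|^2)] behaves like [1 / y] where [y] is large, which keeps the
    cancellation of [- 2 y] against the derivative of [y' / y] at a double pole, and it vanishes
    together with [y]. The price is a derivative that exists only along real paths and contains
    [|y'|^2 / (1 + |y|^2)^2]; the definition of [V] itself bounds this term by a multiple of
    [1 + |V|]. Two further obstacles shape the proof. The existence theorem must supply its radius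
    before the initial point is known, so power series carry explicit geometric bounds and existence
    is proved by majorants on coefficients. And the solution built at [z1] agrees with [y] only
    close to [z1]; the agreement has to be carried through the disk across poles of [y], hence it is
    stated in product form [y B = A]. The function [u] vanishes at the singular point because
    otherwise [1 / u^2] would continue [y] analytically there; the case of small [y z1] is excluded
    in the same way. *)

Fixpoint csum (u : nat -> C) (n : nat) : C :=
  match n with O => 0 | S k => csum u k + u k end.

Definition cv (u : nat -> C) (l : C) : Prop :=
  forall eps : R, (0 < eps)%R ->
    exists N : nat, forall n, (N <= n)%nat -> (Cmod (u n - l) < eps)%R.

Lemma Cmod_sub_sym (a b : C) : Cmod (a - b) = Cmod (b - a).
Proof. rewrite <- Cmod_opp. f_equal. ring. Qed.

Lemma Cmod_sub_triangle (a b c : C) : (Cmod (a - c) <= Cmod (a - b) + Cmod (b - c))%R.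
Proof. replace (a - c) with ((a - b) + (b - c)) by ring. apply Cmod_triangle. Qed.

Lemma Cmod_triangle_sub (a b : C) : (Cmod (a - b) <= Cmod a + Cmod b)%R.
Proof. unfold Cminus. eapply Rle_trans; [apply Cmod_triangle|]. rewrite Cmod_opp. lra. Qed.

Lemma Cmod_le_sub (a b : C) : (Cmod a <= Cmod (a - b) + Cmod b)%R.
Proof. replace a with ((a - b) + b) at 1 by ring. apply Cmod_triangle. Qed.

Lemma csum_ext (u v : nat -> C) (n : nat) :
  (forall i, (i < n)%nat -> u i = v i) -> csum u n = csum v n.
Proof.
  induction n as [|n IH]; simpl; intros H; [reflexivity|].
  rewrite IH by (intros; apply H; lia). rewrite H by lia. reflexivity.
Qed.

Lemma csum_plus (u v : nat -> C) (n : nat) :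
  csum (fun i => u i + v i) n = csum u n + csum v n.
Proof. induction n as [|n IH]; simpl; [ring|]. rewrite IH. ring. Qed.

Lemma csum_scal (c : C) (u : nat -> C) (n : nat) :
  csum (fun i => c * u i) n = c * csum u n.
Proof. induction n as [|n IH]; simpl; [ring|]. rewrite IH. ring. Qed.

Lemma csum_shift (u : nat -> C) (n : nat) :
  csum u (S n) = u O + csum (fun i => u (S i)) n.
Proof.
  induction n as [|n IH]; [simpl; ring|].
  change (csum u (S (S n))) with (csum u (S n) + u (S n)). rewrite IH. simpl. ring.
Qed.

Lemma Cmod_csum_const (u : nat -> C) (b : R) (n : nat) :
  (forall i, (i < n)%nat -> (Cmod (u i) <= b)%R) -> (Cmod (csum u n) <= INR n * b)%R.
Proof.
  induction n as [|n IH]; intros H; [simpl; rewrite Cmod_0; lra|].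
  rewrite S_INR. simpl csum. eapply Rle_trans; [apply Cmod_triangle|].
  assert (H1 := H n (Nat.lt_succ_diag_r n)).
  assert (IH' := IH (fun i Hi => H i (Nat.lt_lt_succ_r _ _ Hi))). lra.
Qed.

Lemma Cmod_csum_geom (u : nat -> C) (M q : R) (n : nat) :
  (0 <= q < 1)%R -> (forall i, (Cmod (u i) <= M * q ^ i)%R) ->
  (Cmod (csum u n) <= M / (1 - q) * (1 - q ^ n))%R.
Proof.
  intros Hq H. induction n as [|n IH]; simpl.
  - rewrite Cmod_0. lra.
  - eapply Rle_trans; [apply Cmod_triangle|]. specialize (H n).
    apply Rle_trans with (M / (1 - q) * (1 - q ^ n) + M * q ^ n)%R; [lra|].
    apply Req_le. field. lra.
Qed.

Lemma cv_unique (u : nat -> C) (l l' : C) : cv u l -> cv u l' -> l = l'.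
Proof.
  intros H H'. destruct (Rle_lt_dec (Cmod (l - l')) 0) as [h|h].
  - assert (h2 : Cmod (l - l') = 0%R) by (apply Rle_antisym; [assumption|apply Cmod_ge_0]).
    apply Cmod_eq_0 in h2. replace l with ((l - l') + l') by ring. rewrite h2. ring.
  - destruct (H (Cmod (l - l') / 2)%R) as [N HN]; [lra|].
    destruct (H' (Cmod (l - l') / 2)%R) as [N' HN']; [lra|].
    specialize (HN (N + N')%nat ltac:(lia)). specialize (HN' (N + N')%nat ltac:(lia)).
    assert (h3 := Cmod_sub_triangle l (u (N + N')%nat) l').
    rewrite (Cmod_sub_sym l (u _)) in h3. lra.
Qed.

Lemma cv_ext (u v : nat -> C) (l : C) : (forall n, u n = v n) -> cv u l -> cv v l.
Proof.
  intros E H eps He. destruct (H eps He) as [N HN]. exists N. intros n Hn.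
  rewrite <- E. auto.
Qed.

Lemma cv_const (l : C) : cv (fun _ => l) l.
Proof.
  intros eps He. exists O. intros. replace (l - l) with (RtoC 0) by ring. rewrite Cmod_0. lra.
Qed.

Lemma cv_plus (u v : nat -> C) (l m : C) :
  cv u l -> cv v m -> cv (fun n => u n + v n) (l + m).
Proof.
  intros Hu Hv eps He. destruct (Hu (eps / 2)%R) as [N HN]; [lra|].
  destruct (Hv (eps / 2)%R) as [N' HN']; [lra|].
  exists (N + N')%nat. intros n Hn.
  replace (u n + v n - (l + m)) with ((u n - l) + (v n - m)) by ring.
  eapply Rle_lt_trans; [apply Cmod_triangle|].
  specialize (HN n ltac:(lia)). specialize (HN' n ltac:(lia)). lra.
Qed.

Lemma cv_scal (c : C) (u : nat -> C) (l : C) : cv u l -> cv (fun n => c * u n) (c * l).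
Proof.
  intros Hu eps He. assert (h := Cmod_ge_0 c).
  destruct (Hu (eps / (Cmod c + 1))%R) as [N HN]; [apply Rdiv_lt_0_compat; lra|].
  exists N. intros n Hn. specialize (HN n Hn).
  replace (c * u n - c * l) with (c * (u n - l)) by ring. rewrite Cmod_mult.
  apply (Rmult_lt_compat_l (Cmod c + 1)) in HN; [|lra].
  replace ((Cmod c + 1) * (eps / (Cmod c + 1)))%R with eps in HN by (field; lra).
  assert (h' := Cmod_ge_0 (u n - l)). nra.
Qed.

Lemma cv_succ (u : nat -> C) (l : C) : cv (fun n => u (S n)) l -> cv u l.
Proof.
  intros H eps He. destruct (H eps He) as [N HN]. exists (S N). intros n Hn.
  destruct n; [lia|]. apply HN. lia.
Qed.

Lemma cv_bound (u : nat -> C) (l : C) (B : R) :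
  (forall n, (Cmod (u n) <= B)%R) -> cv u l -> (Cmod l <= B)%R.
Proof.
  intros HB H. apply Rnot_lt_le. intros h.
  destruct (H (Cmod l - B)%R) as [N HN]; [lra|].
  specialize (HN N (le_n N)). specialize (HB N).
  assert (h2 := Cmod_le_sub l (u N)). rewrite Cmod_sub_sym in h2. lra.
Qed.

(** The linear factor is absorbed by passing from [q] to the midpoint [p] of [q] and 1: induction
    gives [(n + 1) (p - q) q^n <= p^n]. Remainders with such a factor come from Cauchy products and
    termwise derivatives. *)
Lemma pow_linear_small (q B eps : R) : (0 <= q < 1)%R -> (0 <= B)%R -> (0 < eps)%R ->
  exists N : nat, forall n, (N <= n)%nat -> (B * (INR n + 1) * q ^ n < eps)%R.
Proof.
  intros Hq HB He.
  set (p := ((1 + q) / 2)%R).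
  assert (Hp : (0 < p < 1)%R) by (unfold p; lra).
  assert (Hlin : forall n, ((INR n + 1) * (p - q) * q ^ n <= p ^ n)%R).
  { intros n. assert (Hpq : (0 < p - q)%R) by (unfold p; lra).
    apply Rle_trans with (((INR n + 1) * (p - q)) * q ^ n)%R; [lra|].
    induction n as [|n IH]; [simpl; unfold p; lra|].
    rewrite S_INR. simpl.
    assert (h : (0 <= q ^ n)%R) by (apply pow_le; lra).
    assert (h2 : (q ^ n <= p ^ n)%R) by (apply pow_incr; lra).
    assert (h3 := Rmult_le_compat_l q _ _ ltac:(lra) IH).
    assert (h4 := Rmult_le_compat_l (p - q) _ _ ltac:(lra) h2).
    assert (h5 : (0 <= (p - q) * q ^ n)%R) by (apply Rmult_le_pos; lra).
    nra. }
  set (B' := (B / (p - q) + 1)%R).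
  assert (Hpq : (0 < p - q)%R) by (unfold p; lra).
  assert (HB' : (0 < B')%R).
  { unfold B'. assert (0 <= B / (p - q))%R; [|lra]. apply Rmult_le_pos; [lra|].
    left; apply Rinv_0_lt_compat; lra. }
  destruct (pow_lt_1_zero p ltac:(rewrite Rabs_right; lra) (eps / B')%R) as [N HN];
    [apply Rdiv_lt_0_compat; lra|].
  exists N. intros n Hn. specialize (HN n Hn). specialize (Hlin n).
  rewrite Rabs_right in HN by (apply Rle_ge, pow_le; lra).
  apply (Rmult_lt_compat_l B') in HN; [|lra].
  replace (B' * (eps / B'))%R with eps in HN by (field; lra).
  apply Rle_lt_trans with (B' * p ^ n)%R; [|assumption].
  apply Rle_trans with (B' * ((INR n + 1) * (p - q) * q ^ n))%R;
    [|apply Rmult_le_compat_l; lra].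
  replace (B' * ((INR n + 1) * (p - q) * q ^ n))%R
    with ((B + (p - q)) * ((INR n + 1) * q ^ n))%R by (unfold B'; field; lra).
  assert (h : (0 <= (INR n + 1) * q ^ n)%R)
    by (apply Rmult_le_pos; [assert (h := pos_INR n); lra | apply pow_le; lra]).
  nra.
Qed.

Lemma cv_of_remainder (u : nat -> C) (l : C) (B q : R) :
  (0 <= q < 1)%R -> (forall n, (Cmod (u n - l) <= B * (INR n + 1) * q ^ n)%R) -> cv u l.
Proof.
  intros Hq H eps He.
  assert (HB : (0 <= B)%R).
  { specialize (H O). simpl in H. assert (h := Cmod_ge_0 (u O - l)). lra. }
  destruct (pow_linear_small q B eps Hq HB He) as [N HN].
  exists N. intros n Hn. eapply Rle_lt_trans; [apply H|]. auto.
Qed.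

Lemma sum_n_csum (u : nat -> C) (n : nat) :
  @sum_n C_NormedModule u n = csum u (S n).
Proof.
  induction n as [|n IH].
  - rewrite sum_O. simpl. ring.
  - rewrite sum_Sn, IH. reflexivity.
Qed.

Lemma is_series_cv (u : nat -> C) (l : C) :
  @is_series C_AbsRing C_NormedModule u l -> cv (csum u) l.
Proof.
  intros H. apply cv_succ. intros eps He.
  destruct (H (fun x => (Cmod (x - l) < eps)%R)) as [N HN].
  - assert (Hs : (0 < eps / 2)%R) by lra.
    assert (H2 : (0 < sqrt 2)%R) by (apply sqrt_lt_R0; lra).
    (* Balls of [C] are squares; the one of half-side [eps / sqrt 2] lies in the disk of radius
       [eps]. *)
    assert (H3 : (0 < eps / sqrt 2)%R) by (apply Rdiv_lt_0_compat; lra).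
    exists (mkposreal _ H3). intros x Hx.
    apply C_NormedModule_mixin_compat2 in Hx. simpl in Hx.
    replace (sqrt 2 * (eps / sqrt 2))%R with eps in Hx by (field; lra). exact Hx.
  - exists N. intros n Hn. rewrite <- sum_n_csum. auto.
Qed.

Lemma cv_is_series (u : nat -> C) (l : C) :
  cv (csum u) l -> @is_series C_AbsRing C_NormedModule u l.
Proof.
  intros H P [eps HP]. destruct (H eps (cond_pos eps)) as [N HN].
  exists N. intros n Hn. apply HP. apply C_NormedModule_mixin_compat1.
  rewrite sum_n_csum. apply (HN (S n)). lia.
Qed.

Lemma cv_geom_exists (u : nat -> C) (M q : R) :
  (0 <= q < 1)%R -> (forall i, (Cmod (u i) <= M * q ^ i)%R) -> exists l, cv (csum u) l.
Proof.
  intros Hq H.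
  destruct (@ex_series_le C_AbsRing C_CompleteNormedModule u (fun n => M * q ^ n)%R) as [l Hl].
  - intros n. eapply Rle_trans; [|apply (H n)]. apply Rle_refl.
  - apply (ex_series_scal (V := R_NormedModule) M). apply ex_series_geom. rewrite Rabs_right; lra.
  - exists l. apply is_series_cv. exact Hl.
Qed.

(** Choice makes the sum a total function of [a] and [x]; its value carries information only where
    the series converges. *)
Definition PS (a : nat -> C) (x : C) : C :=
  epsilon (inhabits (RtoC 0)) (cv (csum (fun n => a n * x ^ n))).

(** A quantitative stand-in for a radius of convergence of at least [/ K]. *)
Definition geo (M K : R) (a : nat -> C) : Prop :=
  forall n, (Cmod (a n) <= M * K ^ n)%R.

Lemma PS_unique (a : nat -> C) (x l : C) : cv (csum (fun n => a n * x ^ n)) l -> PS a x = l.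
Proof.
  intros H. eapply cv_unique; [|exact H]. unfold PS. apply epsilon_spec. exists l; exact H.
Qed.

Lemma PS_cv (M K : R) (a : nat -> C) (x : C) :
  (0 <= K)%R -> (K * Cmod x < 1)%R -> geo M K a ->
  cv (csum (fun n => a n * x ^ n)) (PS a x).
Proof.
  intros HK Hx Ha. unfold PS. apply epsilon_spec.
  apply (cv_geom_exists _ M (K * Cmod x)%R).
  - split; [apply Rmult_le_pos; [lra|apply Cmod_ge_0]|assumption].
  - intros i. rewrite Cmod_mult, Cmod_pow, Rpow_mult_distr, <- Rmult_assoc.
    apply Rmult_le_compat_r; [apply pow_le, Cmod_ge_0|apply Ha].
Qed.

Lemma PS_ext (a b : nat -> C) (x : C) : (forall n, a n = b n) -> PS a x = PS b x.
Proof. intros H. replace b with a; [reflexivity|]. apply functional_extensionality, H. Qed.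

Lemma geo_pos (M K : R) (a : nat -> C) : geo M K a -> (0 <= M)%R.
Proof. intros H. specialize (H O). simpl in H. assert (h := Cmod_ge_0 (a O)). lra. Qed.

Lemma PS_bound (M K : R) (a : nat -> C) (x : C) :
  (0 <= K)%R -> (K * Cmod x < 1)%R -> geo M K a ->
  (Cmod (PS a x) <= M / (1 - K * Cmod x))%R.
Proof.
  intros HK Hx Ha. assert (hM := geo_pos _ _ _ Ha).
  assert (hq : (0 <= K * Cmod x)%R) by (apply Rmult_le_pos; [lra|apply Cmod_ge_0]).
  assert (hc : (0 <= M / (1 - K * Cmod x))%R).
  { apply Rmult_le_pos; [lra|left; apply Rinv_0_lt_compat; lra]. }
  apply (cv_bound (csum (fun n => a n * x ^ n))); [|exact (PS_cv M K a x HK Hx Ha)].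
  intros n. eapply Rle_trans.
  - apply (Cmod_csum_geom _ M (K * Cmod x)%R); [lra|].
    intros i. rewrite Cmod_mult, Cmod_pow, Rpow_mult_distr, <- Rmult_assoc.
    apply Rmult_le_compat_r; [apply pow_le, Cmod_ge_0|apply Ha].
  - assert (h : (0 <= (K * Cmod x) ^ n)%R) by (apply pow_le; lra). nra.
Qed.

Lemma PS_lin (M K M' K' : R) (a b : nat -> C) (c x : C) :
  (0 <= K)%R -> (0 <= K')%R -> (K * Cmod x < 1)%R -> (K' * Cmod x < 1)%R ->
  geo M K a -> geo M' K' b ->
  PS (fun n => a n + c * b n) x = PS a x + c * PS b x.
Proof.
  intros HK HK' Hx Hx' Ha Hb. apply PS_unique.
  apply cv_ext with
    (fun n => csum (fun i => a i * x ^ i) n + c * csum (fun i => b i * x ^ i) n).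
  - intros n. rewrite <- csum_scal, <- csum_plus. apply csum_ext. intros. ring.
  - apply cv_plus; [|apply cv_scal]; [exact (PS_cv M K a x HK Hx Ha)|exact (PS_cv M' K' b x HK' Hx'
      Hb)].
Qed.

Definition tail_seq (k : nat) (a : nat -> C) : nat -> C := fun n => a (k + n)%nat.

Lemma geo_tail_seq (M K : R) (k : nat) (a : nat -> C) :
  geo M K a -> geo (M * K ^ k) K (tail_seq k a).
Proof. intros H n. unfold tail_seq. rewrite Rmult_assoc, <- pow_add. apply H. Qed.

Lemma PS_S (M K : R) (a : nat -> C) (x : C) :
  (0 <= K)%R -> (K * Cmod x < 1)%R -> geo M K a ->
  PS a x = a O + x * PS (tail_seq 1 a) x.
Proof.
  intros HK Hx Ha. apply PS_unique. apply cv_succ.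
  apply cv_ext with (fun n => a O + x * csum (fun i => tail_seq 1 a i * x ^ i) n).
  - intros n. rewrite csum_shift, <- csum_scal. f_equal; [simpl; ring|].
    apply csum_ext. intros. unfold tail_seq. simpl. ring.
  - apply cv_plus; [apply cv_const|]. apply cv_scal.
    apply (PS_cv (M * K ^ 1)%R K); auto. apply geo_tail_seq; assumption.
Qed.

Lemma PS_tail (M K : R) (a : nat -> C) (x : C) (k : nat) :
  (0 <= K)%R -> (K * Cmod x < 1)%R -> geo M K a ->
  PS a x = csum (fun i => a i * x ^ i) k + x ^ k * PS (tail_seq k a) x.
Proof.
  intros HK Hx Ha. induction k as [|k IH].
  - simpl. replace (PS (tail_seq 0 a) x) with (PS a x); [ring|].
    apply PS_ext. reflexivity.
  - rewrite IH. rewrite (PS_S _ _ (tail_seq k a) x HK Hx (geo_tail_seq M K k a Ha)).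
    replace (PS (tail_seq 1 (tail_seq k a)) x) with (PS (tail_seq (S k) a) x).
    + simpl. unfold tail_seq at 1. rewrite Nat.add_0_r. ring.
    + apply PS_ext. intros n. unfold tail_seq. f_equal. lia.
Qed.

(* Coefficients of the quotient [(PS a x - PS a t) / (x - t)]. *)
Definition quot_coef (t : C) (a : nat -> C) : nat -> C := fun i => PS (tail_seq (S i) a) t.

Lemma geo_quot_coef (M K : R) (a : nat -> C) (t : C) :
  (0 <= K)%R -> (K * Cmod t < 1)%R -> geo M K a ->
  geo (M * (K / (1 - K * Cmod t))) K (quot_coef t a).
Proof.
  intros HK Ht Ha n. unfold quot_coef.
  eapply Rle_trans; [exact (PS_bound _ K _ t HK Ht (geo_tail_seq M K (S n) a Ha))|].
  apply Req_le. simpl. field. lra.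
Qed.

(** This is synthetic division: the coefficients [d] of the quotient satisfy
    [a (S n) = d n - t * d (S n)], and summing this relation against powers of [x] gives the
    factorization. *)
Lemma PS_quot_coef (M K : R) (a : nat -> C) (t x : C) :
  (0 <= K)%R -> (K * Cmod t < 1)%R -> (K * Cmod x < 1)%R -> geo M K a ->
  (x - t) * PS (quot_coef t a) x = PS a x - PS a t.
Proof.
  intros HK Ht Hx Ha.
  assert (Hd := geo_quot_coef M K a t HK Ht Ha).
  assert (Hd1 := geo_tail_seq _ _ 1 _ Hd).
  assert (E : PS (tail_seq 1 a) x = PS (quot_coef t a) x + (- t) * PS (tail_seq 1 (quot_coef t a))
    x).
  { rewrite <- (PS_lin _ K _ K _ _ _ _ HK HK Hx Hx Hd Hd1).
    apply PS_ext.
    intros n. unfold tail_seq at 2. unfold quot_coef. simpl Nat.add.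
    rewrite (PS_S _ _ _ _ HK Ht (geo_tail_seq M K (S n) a Ha)).
    unfold tail_seq at 2. rewrite Nat.add_0_r.
    replace (PS (tail_seq 1 (tail_seq (S n) a)) t) with (PS (tail_seq (S (S n)) a) t).
    - unfold tail_seq at 1. simpl. ring.
    - apply PS_ext. intros m. unfold tail_seq. f_equal. lia. }
  rewrite (PS_S M K a x HK Hx Ha), (PS_S M K a t HK Ht Ha), E.
  rewrite (PS_S _ _ _ x HK Hx Hd). unfold quot_coef at 1 3. ring_simplify.
  change (fun i : nat => PS (tail_seq (S i) a) t) with (quot_coef t a). ring.
Qed.

Lemma geo_iter_quot_coef (M K : R) (a : nat -> C) (t : C) (k : nat) :
  (0 <= K)%R -> (K * Cmod t < 1)%R -> geo M K a ->
  geo (M * (K / (1 - K * Cmod t)) ^ k) K (Nat.iter k (quot_coef t) a).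
Proof.
  intros HK Ht Ha. induction k as [|k IH]; simpl.
  - rewrite Rmult_1_r. exact Ha.
  - replace (M * (K / (1 - K * Cmod t) * (K / (1 - K * Cmod t)) ^ k))%R with
      (M * (K / (1 - K * Cmod t)) ^ k * (K / (1 - K * Cmod t)))%R by ring.
    apply geo_quot_coef; assumption.
Qed.

(** The Taylor coefficients at [t], obtained as iterated divided differences; this avoids
    rearranging a double series with binomial coefficients. *)
Definition recenter (t : C) (a : nat -> C) : nat -> C := fun j => PS (Nat.iter j (quot_coef t) a) t.

Lemma PS_recenter_partial (M K : R) (a : nat -> C) (t x : C) (k : nat) :
  (0 <= K)%R -> (K * Cmod t < 1)%R -> (K * Cmod x < 1)%R -> geo M K a ->
  PS a x = csum (fun j => recenter t a j * (x - t) ^ j) k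
           + (x - t) ^ k * PS (Nat.iter k (quot_coef t) a) x.
Proof.
  intros HK Ht Hx Ha. induction k as [|k IH]; [simpl; ring|].
  rewrite IH. simpl csum.
  assert (E := PS_quot_coef _ _ _ t x HK Ht Hx (geo_iter_quot_coef M K a t k HK Ht Ha)).
  assert (E' : PS (Nat.iter k (quot_coef t) a) x = recenter t a k
    + (x - t) * PS (Nat.iter (S k) (quot_coef t) a) x).
  { simpl Nat.iter. rewrite E. unfold recenter. ring. }
  rewrite E'. simpl Cpow. ring.
Qed.

(** The reciprocal of the new rate is [/ K - Cmod t], the distance from [t] to the circle of radius
    [/ K]. *)
Lemma geo_recenter (M K : R) (a : nat -> C) (t : C) :
  (0 <= K)%R -> (K * Cmod t < 1)%R -> geo M K a ->
  geo (M / (1 - K * Cmod t)) (K / (1 - K * Cmod t)) (recenter t a).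
Proof.
  intros HK Ht Ha n. unfold recenter.
  eapply Rle_trans; [apply (PS_bound _ K _ t HK Ht (geo_iter_quot_coef M K a t n HK Ht Ha))|].
  apply Req_le. unfold Rdiv. ring.
Qed.

(** The remainder after [k] terms is [(x - t) ^ k] times the [k]-th iterated quotient, whose values
    grow at most like the [k]-th power of [K / (1 - K * Cmod t)]; the condition on [x - t] makes the
    product tend to 0. *)
Lemma PS_recenter (M K : R) (a : nat -> C) (t x : C) :
  (0 <= K)%R -> (K * Cmod t < 1)%R -> (K * Cmod x < 1)%R ->
  (K / (1 - K * Cmod t) * Cmod (x - t) < 1)%R -> geo M K a ->
  PS (recenter t a) (x - t) = PS a x.
Proof.
  intros HK Ht Hx Hxt Ha. apply PS_unique.
  assert (hK : (0 <= K / (1 - K * Cmod t))%R).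
  { apply Rmult_le_pos; [lra|left; apply Rinv_0_lt_compat; lra]. }
  apply (cv_of_remainder _ _ (M / (1 - K * Cmod x))%R
           (K / (1 - K * Cmod t) * Cmod (x - t))%R).
  - split; [apply Rmult_le_pos; [lra|apply Cmod_ge_0]|assumption].
  - intros n. rewrite (PS_recenter_partial M K a t x n HK Ht Hx Ha).
    match goal with |- (Cmod (?s - (?s + ?r)) <= _)%R =>
      replace (s - (s + r)) with (- r) by ring end.
    rewrite Cmod_opp, Cmod_mult, Cmod_pow, Rpow_mult_distr.
    assert (h := PS_bound _ K _ x HK Hx (geo_iter_quot_coef M K a t n HK Ht Ha)).
    assert (h1 : (0 <= Cmod (x - t) ^ n)%R) by apply pow_le, Cmod_ge_0.
    assert (h2 : (0 <= (K / (1 - K * Cmod t)) ^ n)%R) by (apply pow_le; lra).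
    assert (hM := geo_pos _ _ _ Ha).
    assert (h4 : (0 <= M / (1 - K * Cmod x))%R)
      by (apply Rmult_le_pos; [lra|left; apply Rinv_0_lt_compat; lra]).
    assert (h3 := pos_INR n).
    apply (Rmult_le_compat_l _ _ _ h1) in h. eapply Rle_trans; [exact h|].
    replace (Cmod (x - t) ^ n * (M * (K / (1 - K * Cmod t)) ^ n / (1 - K * Cmod x)))%R
      with (M / (1 - K * Cmod x) * ((K / (1 - K * Cmod t)) ^ n * Cmod (x - t) ^ n))%R
      by (unfold Rdiv; ring).
    assert (h5 := Rmult_le_pos _ _ h2 h1). assert (h6 := Rmult_le_pos _ _ h4 h5).
    nra.
Qed.

(** * Local expansions with explicit constants *)

Definition expands (f : C -> C) (w : C) (a : nat -> C) (M K r : R) : Prop :=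
  (0 < K)%R /\ (0 < r)%R /\ (K * r < 1)%R /\ geo M K a /\
  forall z, (Cmod (z - w) < r)%R -> f z = PS a (z - w).

(** Equivalent to [analytic_at], but it comes with coefficient bounds, and [K * r < 1] keeps the
    disk strictly inside the disk of convergence. *)
Definition holo (f : C -> C) (w : C) : Prop := exists a M K r, expands f w a M K r.

Lemma expands_shrink (f : C -> C) (w : C) (a : nat -> C) (M K r r' : R) :
  expands f w a M K r -> (0 < r' <= r)%R -> expands f w a M K r'.
Proof.
  intros (HK & Hr & HKr & Ha & Hf) Hr'. repeat split; auto; try lra.
  - nra.
  - intros z Hz. apply Hf. lra.
Qed.

Lemma expands_dom (f : C -> C) (w : C) (a : nat -> C) (M K r : R) (z : C) :
  expands f w a M K r -> (Cmod (z - w) < r)%R -> (K * Cmod (z - w) < 1)%R.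
Proof. intros (HK & Hr & HKr & Ha & Hf) Hz. nra. Qed.

Lemma expands_near (f : C -> C) (w : C) (a : nat -> C) (M K r : R) (z : C) :
  expands f w a M K r -> (Cmod (z - w) < r)%R ->
  exists M' K' r', expands f z (recenter (z - w) a) M' K' r'.
Proof.
  intros He Hz. assert (Hd := expands_dom _ _ _ _ _ _ _ He Hz).
  destruct He as (HK & Hr & HKr & Ha & Hf).
  set (K' := (K / (1 - K * Cmod (z - w)))%R).
  assert (HK' : (0 < K')%R) by (apply Rdiv_lt_0_compat; lra).
  (* The first entry of the minimum stays in the disk where [f] is given by its series; the second
     yields [K' * r' <= / 2]. *)
  exists (M / (1 - K * Cmod (z - w)))%R, K', (Rmin (r - Cmod (z - w)) (/ (2 * K'))).
  assert (Hm : (Rmin (r - Cmod (z - w)) (/ (2 * K')) <= /(2 * K'))%R) by apply Rmin_r.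
  assert (Hm' := Rmin_l (r - Cmod (z - w)) (/ (2 * K'))).
  assert (Hi : (0 < / (2 * K'))%R) by (apply Rinv_0_lt_compat; lra).
  assert (Hh : (K' * / (2 * K') = / 2)%R) by (field; lra).
  repeat split; auto.
  - apply Rmin_glb_lt; lra.
  - apply Rle_lt_trans with (K' * / (2 * K'))%R; [apply Rmult_le_compat_l; lra|lra].
  - apply geo_recenter; auto; lra.
  - intros x Hx.
    assert (Hxw : (Cmod (x - w) < r)%R).
    { assert (h := Cmod_sub_triangle x z w). lra. }
    rewrite Hf by exact Hxw.
    replace (x - z) with ((x - w) - (z - w)) by ring.
    symmetry. apply (PS_recenter M K); auto; try lra.
    + nra.
    + replace (x - w - (z - w)) with (x - z) by ring. fold K'.
      apply Rle_lt_trans with (K' * / (2 * K'))%R; [apply Rmult_le_compat_l; lra|lra].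
Qed.

Lemma expands_holo_near (f : C -> C) (w : C) (a : nat -> C) (M K r : R) (z : C) :
  expands f w a M K r -> (Cmod (z - w) < r)%R -> holo f z.
Proof.
  intros He Hz. destruct (expands_near _ _ _ _ _ _ _ He Hz) as (M' & K' & r' & H).
  exists (recenter (z - w) a), M', K', r'. exact H.
Qed.

Lemma holo_open (f : C -> C) (w : C) :
  holo f w -> exists r, (0 < r)%R /\ forall z, (Cmod (z - w) < r)%R -> holo f z.
Proof.
  intros (a & M & K & r & He). exists r. split; [apply He|].
  intros z Hz. eapply expands_holo_near; eauto.
Qed.

Lemma holo_ext_loc (f g : C -> C) (w : C) (d : R) :
  (0 < d)%R -> (forall z, (Cmod (z - w) < d)%R -> f z = g z) -> holo f w -> holo g w.
Proof.
  intros Hd E (a & M & K & r & He).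
  assert (He' := expands_shrink _ _ _ _ _ _ (Rmin d r) He
    ltac:(split; [apply Rmin_glb_lt; [lra|apply He]|apply Rmin_r])).
  exists a, M, K, (Rmin d r). destruct He' as (HK & Hr & HKr & Ha & Hf).
  repeat split; auto. intros z Hz. rewrite <- E; auto.
  eapply Rlt_le_trans; [exact Hz|apply Rmin_l].
Qed.

Lemma cv_terms_bounded (u : nat -> C) (l : C) :
  cv (csum u) l -> exists B, forall n, (Cmod (u n) <= B)%R.
Proof.
  intros H. destruct (H 1%R) as [N HN]; [lra|].
  assert (Hfin : forall m, exists B, forall n, (n < m)%nat -> (Cmod (u n) <= B)%R).
  { induction m as [|m [B HB]]; [exists 0%R; intros; lia|].
    exists (Rmax B (Cmod (u m))). intros n Hn.
    destruct (Nat.eq_dec n m) as [->|]; [apply Rmax_r|].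
    eapply Rle_trans; [apply HB; lia|apply Rmax_l]. }
  destruct (Hfin N) as [B HB]. exists (Rmax B 2). intros n.
  destruct (le_lt_dec N n) as [h|h].
  - eapply Rle_trans; [|apply Rmax_r].
    replace (u n) with ((csum u (S n) - l) - (csum u n - l)) by (simpl; ring).
    eapply Rle_trans; [apply Cmod_triangle_sub|].
    assert (h1 := HN n h). assert (h2 := HN (S n) ltac:(lia)). lra.
  - eapply Rle_trans; [apply HB, h|apply Rmax_l].
Qed.

Lemma pow_n_Cpow (x : C) (n : nat) : @pow_n C_Ring x n = x ^ n.
Proof. induction n as [|n IH]; simpl; [reflexivity|]. rewrite IH. reflexivity. Qed.

Lemma is_pseries_cv (a : nat -> C) (x l : C) :
  @is_pseries C_AbsRing C_NormedModule a x l <-> cv (csum (fun n => a n * x ^ n)) l.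
Proof.
  assert (E : forall n, @scal C_AbsRing C_NormedModule (@pow_n C_AbsRing x n) (a n)
     = a n * x ^ n).
  { intros n. rewrite Cmult_comm. rewrite <- pow_n_Cpow. reflexivity. }
  split; intros H.
  - apply is_series_cv in H. eapply cv_ext; [|exact H].
    intros n. apply csum_ext. intros i _. apply E.
  - apply cv_is_series. eapply cv_ext; [|exact H].
    intros n. apply csum_ext. intros i _. symmetry. apply E.
Qed.

(** Convergence at one point at distance [r / 2] bounds the terms there, which is a geometric bound
    with rate [2 / r]; the radius [r / 4] then gives the product [/ 2]. *)
Lemma analytic_at_holo (f : C -> C) (w : C) : analytic_at f w <-> holo f w.
Proof.
  split.
  - intros (a & r & Hr & H).
    assert (Hd : disk w r (w + RtoC (r / 2))).
    { unfold disk. replace (w + RtoC (r / 2) - w) with (RtoC (r / 2)) by ring.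
      rewrite Cmod_R, Rabs_right; lra. }
    apply H in Hd. apply is_pseries_cv in Hd.
    destruct (cv_terms_bounded _ _ Hd) as [B HB].
    exists a, B, (2 / r)%R, (r / 4)%R.
    assert (Hi : (0 < 2 / r)%R) by (apply Rdiv_lt_0_compat; lra).
    repeat split; try lra.
    + replace (2 / r * (r / 4))%R with (/ 2)%R by (field; lra). lra.
    + intros n. specialize (HB n). simpl in HB.
      replace (w + RtoC (r / 2) - w) with (RtoC (r / 2)) in HB by ring.
      rewrite Cmod_mult, Cmod_pow, Cmod_R, Rabs_right in HB by lra.
      replace (Cmod (a n)) with (Cmod (a n) * (r / 2) ^ n * (2 / r) ^ n)%R.
      * apply Rmult_le_compat_r; [apply pow_le; lra|exact HB].
      * rewrite Rmult_assoc, <- Rpow_mult_distr.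
        replace (r / 2 * (2 / r))%R with 1%R by (field; lra). rewrite pow1. ring.
    + intros z Hz. symmetry. apply PS_unique. apply is_pseries_cv. apply H.
      unfold disk. lra.
  - intros (a & M & K & r & He). exists a, r. split; [apply He|].
    intros z Hz. apply is_pseries_cv.
    assert (Hd := expands_dom _ _ _ _ _ _ _ He Hz).
    destruct He as (HK & Hr & HKr & Ha & Hf). rewrite Hf by exact Hz.
    apply (PS_cv M K); auto. lra.
Qed.

(** * Cauchy products *)

Definition conv (a b : nat -> C) : nat -> C :=
  fun n => csum (fun i => a i * b (n - i)%nat) (S n).

(* Written without the coefficients of the product beyond [k], so that the remainder is visibly
   of the order of [(k + 1) (K |x|)^k]. *)
Lemma PS_conv_partial (M M' K : R) (a b : nat -> C) (x : C) (k : nat) :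
  (0 <= K)%R -> (K * Cmod x < 1)%R -> geo M K a -> geo M' K b ->
  PS a x * PS b x = csum (fun n => conv a b n * x ^ n) k
    + x ^ k * (PS (tail_seq k a) x * PS b x + csum (fun i => a i * PS (tail_seq (k - i) b) x) k).
Proof.
  intros HK Hx Ha Hb. induction k as [|k IH].
  - simpl. replace (PS (tail_seq 0 a) x) with (PS a x); [ring|]. apply PS_ext; reflexivity.
  - assert (Etl : forall c Mc n, geo Mc K c -> PS (tail_seq n c) x = c n + x * PS (tail_seq (S n)
      c) x).
    { intros c Mc n Hc. rewrite (PS_S _ _ (tail_seq n c) x HK Hx (geo_tail_seq Mc K n c Hc)).
      unfold tail_seq at 1. rewrite Nat.add_0_r. do 2 f_equal. apply PS_ext.
      intros m. unfold tail_seq. f_equal. lia. }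
    rewrite IH, (Etl a M k Ha).
    assert (E1 : csum (fun i => a i * PS (tail_seq (k - i) b) x) k =
       csum (fun i => a i * b (k - i)%nat) k
       + x * csum (fun i => a i * PS (tail_seq (S k - i) b) x) k).
    { rewrite <- csum_scal, <- csum_plus. apply csum_ext. intros i Hi.
      rewrite (Etl b M' (k - i)%nat Hb). replace (S (k - i)) with (S k - i)%nat by lia. ring. }
    rewrite E1.
    assert (E2 : PS b x = b O + x * PS (tail_seq 1 b) x) by (apply (PS_S M' K); auto).
    change (csum (fun n => conv a b n * x ^ n) (S k)) with
      (csum (fun n => conv a b n * x ^ n) k + conv a b k * x ^ k).
    replace (conv a b k) with (csum (fun i => a i * b (k - i)%nat) k + a k * b O)
      by (unfold conv; simpl; rewrite Nat.sub_diag; reflexivity).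
    change (csum (fun i => a i * PS (tail_seq (S k - i) b) x) (S k)) with
      (csum (fun i => a i * PS (tail_seq (S k - i) b) x) k + a k * PS (tail_seq (S k - k) b) x).
    replace (S k - k)%nat with 1%nat by lia.
    simpl Cpow. rewrite (Cmult_plus_distr_r (a k) _ (PS b x)).
    rewrite E2 at 1. ring.
Qed.

Lemma cv_conv (M M' K : R) (a b : nat -> C) (x : C) :
  (0 <= K)%R -> (K * Cmod x < 1)%R -> geo M K a -> geo M' K b ->
  cv (csum (fun n => conv a b n * x ^ n)) (PS a x * PS b x).
Proof.
  intros HK Hx Ha Hb.
  assert (hq : (0 <= K * Cmod x)%R) by (apply Rmult_le_pos; [lra|apply Cmod_ge_0]).
  set (q := (K * Cmod x)%R) in *.
  assert (hM := geo_pos _ _ _ Ha). assert (hM' := geo_pos _ _ _ Hb).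
  assert (hi : (1 <= / (1 - q))%R) by (rewrite <- Rinv_1 at 1; apply Rinv_le_contravar; lra).
  apply (cv_of_remainder _ _ (M * M' * (/ (1 - q) * / (1 - q)))%R q); [lra|].
  intros n. rewrite (PS_conv_partial M M' K a b x n HK Hx Ha Hb).
  match goal with |- (Cmod (?s - (?s + ?r)) <= _)%R =>
    replace (s - (s + r)) with (- r) by ring end.
  rewrite Cmod_opp, Cmod_mult, Cmod_pow.
  set (B := (M * M' * K ^ n * (/ (1 - q) * / (1 - q)))%R).
  assert (hKn : (0 <= K ^ n)%R) by (apply pow_le; lra).
  assert (h1 : (Cmod (PS (tail_seq n a) x * PS b x) <= B)%R).
  { rewrite Cmod_mult.
    apply Rle_trans with ((M * K ^ n / (1 - q)) * (M' / (1 - q)))%R.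
    - apply Rmult_le_compat; try apply Cmod_ge_0.
      + apply (PS_bound _ K); auto. apply geo_tail_seq, Ha.
      + apply (PS_bound _ K); auto.
    - apply Req_le. unfold B, Rdiv. ring. }
  assert (h2 : (Cmod (csum (fun i => a i * PS (tail_seq (n - i) b) x)%C n) <= INR n * B)%R).
  { apply Cmod_csum_const. intros i Hi. rewrite Cmod_mult.
    apply Rle_trans with ((M * K ^ i) * (M' * K ^ (n - i) / (1 - q)))%R.
    - apply Rmult_le_compat; try apply Cmod_ge_0; [apply Ha|].
      apply (PS_bound _ K); auto. apply geo_tail_seq, Hb.
    - unfold B. replace (K ^ n)%R with (K ^ i * K ^ (n - i))%R
        by (rewrite <- pow_add; f_equal; lia).
      apply Rle_trans with (M * M' * (K ^ i * K ^ (n - i)) * (1 * / (1 - q)))%R;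
        [apply Req_le; unfold Rdiv; ring|].
      apply Rmult_le_compat_l.
      + repeat apply Rmult_le_pos; auto; apply pow_le; lra.
      + apply Rmult_le_compat_r; lra. }
  assert (h3 : (0 <= Cmod x ^ n)%R) by apply pow_le, Cmod_ge_0.
  assert (h4 := Cmod_triangle (PS (tail_seq n a) x * PS b x)
                  (csum (fun i => a i * PS (tail_seq (n - i) b) x) n)).
  apply Rle_trans with (Cmod x ^ n * (B + INR n * B))%R;
    [apply Rmult_le_compat_l; lra|].
  apply Req_le. unfold B, q. rewrite Rpow_mult_distr. ring.
Qed.

Lemma PS_conv (M M' K : R) (a b : nat -> C) (x : C) :
  (0 <= K)%R -> (K * Cmod x < 1)%R -> geo M K a -> geo M' K b ->
  PS (conv a b) x = PS a x * PS b x.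
Proof. intros HK Hx Ha Hb. apply PS_unique. apply (cv_conv M M' K); auto. Qed.

Lemma geo_weaken (M K M' K' : R) (a : nat -> C) :
  (0 <= K <= K')%R -> (M <= M')%R -> geo M K a -> geo M' K' a.
Proof.
  intros HK HM Ha n. assert (hM := geo_pos _ _ _ Ha).
  eapply Rle_trans; [apply Ha|].
  apply Rmult_le_compat; auto; [apply pow_le; lra|apply pow_incr; lra].
Qed.

Lemma INR_S_le_pow2 (n : nat) : (INR (S n) <= 2 ^ n)%R.
Proof.
  induction n as [|n IH]; [simpl; lra|].
  rewrite S_INR. simpl pow. assert (h : (1 <= 2 ^ n)%R) by (apply pow_R1_Rle; lra). lra.
Qed.

(** The [n + 1] summands are absorbed into the rate by [n + 1 <= 2 ^ n], which is why [K]
    doubles. *)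
Lemma geo_conv (M M' K : R) (a b : nat -> C) :
  (0 <= K)%R -> geo M K a -> geo M' K b -> geo (M * M') (2 * K) (conv a b).
Proof.
  intros HK Ha Hb n. unfold conv.
  assert (hM := geo_pos _ _ _ Ha). assert (hM' := geo_pos _ _ _ Hb).
  assert (hKn : (0 <= K ^ n)%R) by (apply pow_le; lra).
  eapply Rle_trans; [apply (Cmod_csum_const _ (M * M' * K ^ n)%R)|].
  - intros i Hi. rewrite Cmod_mult.
    apply Rle_trans with ((M * K ^ i) * (M' * K ^ (n - i)))%R.
    + apply Rmult_le_compat; try apply Cmod_ge_0; auto.
    + apply Req_le. replace (K ^ n)%R with (K ^ i * K ^ (n - i))%R; [ring|].
      rewrite <- pow_add. f_equal. lia.
  - rewrite Rpow_mult_distr.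
    replace (M * M' * (2 ^ n * K ^ n))%R with (2 ^ n * (M * M' * K ^ n))%R by ring.
    apply Rmult_le_compat_r; [repeat apply Rmult_le_pos; auto|apply INR_S_le_pow2].
Qed.

(** * Analytic functions *)

Lemma PS_fin (a : nat -> C) (N : nat) (x : C) :
  (forall n, (N <= n)%nat -> a n = 0) -> PS a x = csum (fun n => a n * x ^ n) N.
Proof.
  intros H. apply PS_unique. intros eps He. exists N. intros n Hn.
  replace (csum (fun n => a n * x ^ n) n) with (csum (fun n => a n * x ^ n) N).
  - unfold Cminus. rewrite Cplus_opp_r, Cmod_0. exact He.
  - induction Hn as [|n Hn IH]; [reflexivity|]. simpl. rewrite <- IH, H by exact Hn. ring.
Qed.

Definition affine_coef (c d : C) : nat -> C := fun n => match n with O => c | 1%nat => d | _ => 0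
  end.

Lemma geo_affine_coef (c d : C) : geo (Cmod c + Cmod d) 1 (affine_coef c d).
Proof.
  intros n. rewrite pow1. assert (hc := Cmod_ge_0 c). assert (hd := Cmod_ge_0 d).
  destruct n as [|[|n]]; simpl; try rewrite Cmod_0; lra.
Qed.

Lemma PS_affine (c d x : C) : PS (affine_coef c d) x = c + d * x.
Proof.
  rewrite (PS_fin _ 2); [simpl; ring|]. intros [|[|n]] Hn; try lia. reflexivity.
Qed.

Lemma holo_affine (c d w : C) : holo (fun z => c + d * z) w.
Proof.
  exists (affine_coef (c + d * w) d), (Cmod (c + d * w) + Cmod d)%R, 1%R, (/ 2)%R.
  repeat split; try lra; [apply geo_affine_coef|]. intros z _. rewrite PS_affine. ring.
Qed.

Lemma holo_const (c w : C) : holo (fun _ => c) w.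
Proof.
  apply (holo_ext_loc (fun z => c + 0 * z) _ _ 1); [lra| |apply holo_affine]. intros; ring.
Qed.

Lemma holo_sub_id (p w : C) : holo (fun z => z - p) w.
Proof.
  apply (holo_ext_loc (fun z => - p + 1 * z) _ _ 1); [lra| |apply holo_affine]. intros; ring.
Qed.

Lemma expands_weaken (f : C -> C) (w : C) (a : nat -> C) (M K r K' r' : R) :
  expands f w a M K r -> (K <= K')%R -> (0 < r' <= r)%R -> (K' * r' < 1)%R ->
  expands f w a M K' r'.
Proof.
  intros (HK & Hr & HKr & Ha & Hf) HK' Hr' H. repeat split; auto; try lra.
  - apply (geo_weaken M K); auto; lra.
  - intros z Hz. apply Hf. lra.
Qed.

(** The margin [4 * K * r <= 1] leaves room for the doubling of the rate in [geo_conv]. *)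
Lemma holo_common (f g : C -> C) (w : C) : holo f w -> holo g w ->
  exists a b M M' K r, (4 * K * r <= 1)%R /\ expands f w a M K r /\ expands g w b M' K r.
Proof.
  intros (a & M & K & r & Hf) (b & M' & K' & r' & Hg).
  set (L := Rmax K K'). set (s := Rmin (Rmin r r') (/ (4 * L))).
  assert (HL : (0 < L)%R) by (eapply Rlt_le_trans; [apply (proj1 Hf)|apply Rmax_l]).
  assert (H4 : (0 < / (4 * L))%R) by (apply Rinv_0_lt_compat; lra).
  assert (Hs : (0 < s)%R).
  { apply Rmin_glb_lt; [apply Rmin_glb_lt|]; [apply Hf|apply Hg|exact H4]. }
  assert (Hs1 : (s <= Rmin r r')%R) by apply Rmin_l.
  assert (Hs2 : (s <= / (4 * L))%R) by apply Rmin_r.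
  assert (H1 := Rmin_l r r'). assert (H2 := Rmin_r r r').
  assert (Hq : (4 * L * s <= 1)%R).
  { apply Rle_trans with (4 * L * / (4 * L))%R;
      [apply Rmult_le_compat_l; lra|apply Req_le; field; lra]. }
  exists a, b, M, M', L, s. split; [exact Hq|].
  split; eapply expands_weaken; try eassumption; try (split; lra); try lra;
    [apply Rmax_l|apply Rmax_r].
Qed.

Lemma holo_plus (f g : C -> C) (w : C) : holo f w -> holo g w -> holo (fun z => f z + g z) w.
Proof.
  intros Hf Hg. destruct (holo_common f g w Hf Hg) as (a & b & M & M' & K & r & Hq & Ha & Hb).
  exists (fun n => a n + 1 * b n), (M + M')%R, K, r.
  pose proof (fun z => expands_dom _ _ _ _ _ _ z Ha) as Hd.
  destruct Ha as (HK & Hr & HKr & Ha & Ef). destruct Hb as (_ & _ & _ & Hb & Eg).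
  repeat split; auto.
  - intros n. eapply Rle_trans; [apply Cmod_triangle|]. rewrite Cmult_1_l.
    rewrite Rmult_plus_distr_r. apply Rplus_le_compat; auto.
  - intros z Hz. specialize (Hd z Hz).
    rewrite (PS_lin M K M' K); auto; try lra. rewrite Ef, Eg by exact Hz. ring.
Qed.

Lemma holo_mult (f g : C -> C) (w : C) : holo f w -> holo g w -> holo (fun z => f z * g z) w.
Proof.
  intros Hf Hg. destruct (holo_common f g w Hf Hg) as (a & b & M & M' & K & r & Hq & Ha & Hb).
  exists (conv a b), (M * M')%R, (2 * K)%R, r.
  pose proof (fun z => expands_dom _ _ _ _ _ _ z Ha) as Hd.
  destruct Ha as (HK & Hr & HKr & Ha & Ef). destruct Hb as (_ & _ & _ & Hb & Eg).
  repeat split; auto; try lra.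
  - apply geo_conv; auto. lra.
  - intros z Hz. specialize (Hd z Hz).
    rewrite (PS_conv M M' K); auto; try lra. rewrite Ef, Eg by exact Hz. ring.
Qed.

Lemma holo_pow (f : C -> C) (n : nat) (w : C) : holo f w -> holo (fun z => f z ^ n) w.
Proof.
  intros Hf. induction n as [|n IH]; simpl; [apply holo_const|]. apply holo_mult; assumption.
Qed.

(* Course-of-values recursion: [F u n] may only use the values of [u] below [n], and [d] is a
   dummy for the others. *)
Fixpoint hist {T : Type} (d : T) (F : (nat -> T) -> nat -> T) (n : nat) : nat -> T :=
  match n with
  | O => fun _ => d
  | S m => fun k => if (k =? m)%nat then F (hist d F m) m else hist d F m k
  end.

Definition hseq {T : Type} (d : T) (F : (nat -> T) -> nat -> T) (n : nat) : T :=
  hist d F (S n) n.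

Lemma hist_hseq {T : Type} (d : T) (F : (nat -> T) -> nat -> T) (n k : nat) :
  (k < n)%nat -> hist d F n k = hseq d F k.
Proof.
  induction n as [|n IH]; intros H; [lia|].
  destruct (Nat.eq_dec k n) as [->|h]; [reflexivity|].
  simpl. apply Nat.eqb_neq in h as h'. rewrite h'. apply IH. lia.
Qed.

Lemma hseq_eq {T : Type} (d : T) (F : (nat -> T) -> nat -> T) (n : nat) :
  (forall u v k, (forall i, (i < k)%nat -> u i = v i) -> F u k = F v k) ->
  hseq d F n = F (hseq d F) n.
Proof.
  intros H. unfold hseq at 1. simpl. rewrite Nat.eqb_refl. apply H.
  intros. apply hist_hseq. assumption.
Qed.

Definition inv_coef (a b : nat -> C) (n : nat) : C :=
  match n with
  | O => / a O
  | _ => - / a O * csum (fun i => b i * a (n - i)%nat) n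
  end.

Lemma reciprocal_coef (M K : R) (a : nat -> C) : (0 < K)%R -> geo M K a -> a O <> 0 ->
  exists b M' K', (K <= K')%R /\ geo M' K' b /\
    conv b a O = 1 /\ forall n, conv b a (S n) = 0.
Proof.
  intros HK Ha Ha0. set (b := hseq (RtoC 0) (inv_coef a)).
  assert (Hb : forall n, b n = inv_coef a b n).
  { intros n. apply hseq_eq. intros u v [|k] H; [reflexivity|]. unfold inv_coef. f_equal.
    apply csum_ext. intros i Hi. rewrite H by exact Hi. reflexivity. }
  set (m := Cmod (/ a O)). assert (Hm : (0 <= m)%R) by apply Cmod_ge_0.
  assert (HM := geo_pos _ _ _ Ha).
  (* Chosen so that a partial sum of size [L ^ j * K ^ (n - j)] plus one more term, at most [m * M]
     times as large, is of size [L ^ (j + 1) * K ^ (n - j - 1)]. *)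
  set (L := (K * (1 + m * M))%R).
  assert (HmM : (0 <= m * M)%R) by (apply Rmult_le_pos; assumption).
  assert (HL : (K <= L)%R) by (unfold L; nra).
  exists b, m, L. split; [exact HL|]. split; [|split].
  - intros n. induction n as [n IH] using lt_wf_ind. rewrite Hb. destruct n as [|n].
    { simpl. fold m. lra. }
    unfold inv_coef. rewrite Cmod_mult, Cmod_opp. fold m.
    apply Rmult_le_compat_l; [exact Hm|].
    (* All partial sums of the convolution are bounded by an inner induction; the last one,
       [j = S n], is the bound required for [b (S n)]. *)
    assert (Hj : forall j, (j <= S n)%nat ->
      (Cmod (csum (fun i => b i * a (S n - i)%nat)%C j) <= L ^ j * K ^ (S n - j))%R).
    { induction j as [|j IHj]; intros Hj.
      - simpl csum. rewrite Cmod_0. apply Rmult_le_pos; apply pow_le; lra.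
      - change (csum (fun i => b i * a (S n - i)%nat) (S j)) with
          (csum (fun i => b i * a (S n - i)%nat) j + b j * a (S n - j)%nat).
        eapply Rle_trans; [apply Cmod_triangle|].
        specialize (IHj ltac:(lia)). rewrite Cmod_mult.
        assert (h : (Cmod (b j) * Cmod (a (S n - j)%nat) <=
                     (m * L ^ j) * (M * K ^ (S n - j)))%R).
        { apply Rmult_le_compat; try apply Cmod_ge_0; [apply IH; lia|apply Ha]. }
        apply Rle_trans with (L ^ j * K ^ (S n - j) + (m * L ^ j) * (M * K ^ (S n - j)))%R;
          [lra|].
        apply Req_le. replace (S n - j)%nat with (S (S n - S j)) by lia.
        simpl. unfold L at 3. ring. }
    specialize (Hj (S n) (le_n _)). rewrite Nat.sub_diag in Hj. rewrite Rmult_1_r in Hj.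
    exact Hj.
  - unfold conv. simpl. rewrite Hb. simpl. field. exact Ha0.
  - intros n. unfold conv.
    change (csum (fun i => b i * a (S n - i)%nat) (S n) + b (S n) * a (S n - S n)%nat = 0).
    rewrite (Hb (S n)), Nat.sub_diag. unfold inv_coef. field. exact Ha0.
Qed.

Lemma holo_inv (f : C -> C) (w : C) : holo f w -> f w <> 0 -> holo (fun z => / f z) w.
Proof.
  intros (a & M & K & r & He) H0. assert (Hd := fun z => expands_dom _ _ _ _ _ _ z He).
  destruct He as (HK & Hr & HKr & Ha & Ef).
  assert (Ha0 : a O <> 0).
  { rewrite Ef in H0.
    - replace (w - w) with (RtoC 0) in H0 by ring.
      rewrite (PS_S M K) in H0; auto; try lra; [|rewrite Cmod_0; lra].
      intros h. apply H0. rewrite h. ring.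
    - replace (w - w) with (RtoC 0) by ring. rewrite Cmod_0. exact Hr. }
  destruct (reciprocal_coef M K a HK Ha Ha0) as (b & M' & L & HKL & Hb & Hc0 & HcS).
  assert (Hi : (0 < / (2 * L))%R) by (apply Rinv_0_lt_compat; lra).
  exists b, M', L, (Rmin r (/ (2 * L))).
  assert (Hm1 := Rmin_l r (/ (2 * L))). assert (Hm2 := Rmin_r r (/ (2 * L))).
  assert (HLs : (L * Rmin r (/ (2 * L)) <= / 2)%R).
  { apply Rle_trans with (L * / (2 * L))%R; [apply Rmult_le_compat_l; lra|].
    apply Req_le. field. lra. }
  repeat split; auto; try lra.
  - apply Rmin_glb_lt; lra.
  - intros z Hz. rewrite Ef by lra.
    assert (Hz' : (L * Cmod (z - w) < 1)%R) by nra.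
    assert (E : PS b (z - w) * PS a (z - w) = 1).
    { rewrite <- (PS_conv M' M L); auto; try lra.
      - rewrite (PS_fin _ 1); [simpl; rewrite Hc0; ring|].
        intros [|n] Hn; [lia|apply HcS].
      - apply (geo_weaken M K); auto; lra. }
    assert (Hn : PS a (z - w) <> 0).
    { intros h. rewrite h, Cmult_0_r in E. apply RtoC_inj in E. lra. }
    replace (PS b (z - w)) with (PS b (z - w) * PS a (z - w) / PS a (z - w)) by (field; auto).
    rewrite E. field. auto.
Qed.

(** Complex differentiability in the Euclidean modulus and without division, so that [x = z] needs
    no exception; [is_derive_cdiff] relates it to the library notion. *)
Definition cdiff (f : C -> C) (z l : C) : Prop :=
  forall eps : R, (0 < eps)%R -> exists d : R, (0 < d)%R /\
    forall x, (Cmod (x - z) < d)%R ->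
      (Cmod (f x - f z - (x - z) * l) <= eps * Cmod (x - z))%R.

Lemma expands_cdiff (f : C -> C) (w : C) (a : nat -> C) (M K r : R) :
  expands f w a M K r -> cdiff f w (a 1%nat).
Proof.
  intros He eps Heps. assert (Hd := fun z => expands_dom _ _ _ _ _ _ z He).
  destruct He as (HK & Hr & HKr & Ha & Ef).
  assert (HM := geo_pos _ _ _ Ha).
  set (B := (M * K ^ 2 / (1 - K * r))%R).
  assert (HB : (0 <= B)%R).
  { unfold B. apply Rmult_le_pos; [apply Rmult_le_pos; [exact HM|apply pow_le; lra]|].
    left. apply Rinv_0_lt_compat. lra. }
  exists (Rmin r (eps / (B + 1))).
  assert (He' : (0 < eps / (B + 1))%R) by (apply Rdiv_lt_0_compat; lra).
  split; [apply Rmin_glb_lt; assumption|]. intros x Hx.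
  assert (Hx1 := Rmin_l r (eps / (B + 1))). assert (Hx2 := Rmin_r r (eps / (B + 1))).
  assert (Hxr : (Cmod (x - w) < r)%R) by lra. specialize (Hd x Hxr).
  assert (Ew : f w = a O).
  { rewrite Ef; replace (w - w) with (RtoC 0) by ring; [|rewrite Cmod_0; exact Hr].
    rewrite (PS_S M K); auto; [ring|lra|rewrite Cmod_0; lra]. }
  rewrite Ew, Ef by exact Hxr. rewrite (PS_tail M K a (x - w) 2); auto; [|lra].
  simpl csum.
  match goal with |- (Cmod ?e <= _)%R =>
    replace e with ((x - w) * ((x - w) * PS (tail_seq 2 a) (x - w))) by ring end.
  rewrite !Cmod_mult, Rmult_comm. assert (h0 := Cmod_ge_0 (x - w)).
  apply Rmult_le_compat_r; [exact h0|].
  assert (h1 : (Cmod (PS (tail_seq 2 a) (x - w)) <= B)%R).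
  { eapply Rle_trans; [apply (PS_bound _ K _ _ ltac:(lra) Hd (geo_tail_seq M K 2 a Ha))|].
    unfold B. apply Rmult_le_compat_l; [apply Rmult_le_pos; [exact HM|apply pow_le; lra]|].
    apply Rinv_le_contravar; [lra|]. nra. }
  apply Rle_trans with (eps / (B + 1) * (B + 1))%R; [|apply Req_le; field; lra].
  apply Rmult_le_compat; try apply Cmod_ge_0; lra.
Qed.

Definition deriv_coef (a : nat -> C) : nat -> C := fun n => RtoC (INR (S n)) * a (S n).

(* By Abel summation: the [i]-th term of the series of [quot_coef t a] at [t] is the [i]-th tail of
   the series of the derivative with its integer factors removed. *)
Lemma PS_deriv_coef (M K : R) (a : nat -> C) (t : C) :
  (0 < K)%R -> (K * Cmod t < 1)%R -> geo M K a -> PS (deriv_coef a) t = recenter t a 1.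
Proof.
  intros HK Ht Ha. apply PS_unique. change (recenter t a 1) with (PS (quot_coef t a) t).
  assert (HK' : (0 <= K)%R) by lra.
  assert (HM := geo_pos _ _ _ Ha).
  assert (hq : (0 <= K * Cmod t)%R) by (apply Rmult_le_pos; [lra|apply Cmod_ge_0]).
  set (T := fun i : nat => t ^ i * PS (tail_seq (S i) a) t).
  assert (Hsum : forall k, csum (fun i => quot_coef t a i * t ^ i) k =
     csum (fun n => deriv_coef a n * t ^ n) k + RtoC (INR k) * T k).
  { assert (HT : forall k, T k = a (S k) * t ^ k + T (S k)).
    { intros k. unfold T. rewrite (PS_S _ _ (tail_seq (S k) a) t HK' Ht (geo_tail_seq M K (S k) a
        Ha)).
      replace (PS (tail_seq 1 (tail_seq (S k) a)) t) with (PS (tail_seq (S (S k)) a) t).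
      - unfold tail_seq at 1. rewrite Nat.add_0_r. simpl. ring.
      - apply PS_ext. intros n. unfold tail_seq. f_equal. lia. }
    induction k as [|k IH]; [simpl; ring|].
    change (csum (fun i => quot_coef t a i * t ^ i) (S k)) with
      (csum (fun i => quot_coef t a i * t ^ i) k + quot_coef t a k * t ^ k).
    change (csum (fun n => deriv_coef a n * t ^ n) (S k)) with
      (csum (fun n => deriv_coef a n * t ^ n) k + deriv_coef a k * t ^ k).
    rewrite IH. replace (quot_coef t a k * t ^ k) with (T k) by (unfold T, quot_coef; ring).
    rewrite (HT k). unfold deriv_coef. rewrite S_INR, RtoC_plus. ring. }
  assert (HBT : forall k, (Cmod (RtoC (INR k) * T k) <=
      M * K / (1 - K * Cmod t) * (INR k + 1) * (K * Cmod t) ^ k)%R).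
  { intros k. unfold T. rewrite !Cmod_mult, Cmod_R, Cmod_pow.
    rewrite (Rabs_right (INR k)) by (apply Rle_ge, pos_INR).
    assert (h := PS_bound _ K _ t HK' Ht (geo_tail_seq M K (S k) a Ha)).
    assert (h1 : (0 <= Cmod t ^ k)%R) by apply pow_le, Cmod_ge_0.
    assert (h2 := pos_INR k).
    apply Rle_trans with (INR k * (Cmod t ^ k * (M * K ^ S k / (1 - K * Cmod t))))%R.
    - apply Rmult_le_compat_l; [exact h2|]. apply Rmult_le_compat_l; assumption.
    - rewrite Rpow_mult_distr. simpl pow.
      set (X := (M * K / (1 - K * Cmod t) * (K ^ k * Cmod t ^ k))%R).
      assert (hX : (0 <= X)%R).
      { unfold X. apply Rmult_le_pos; [apply Rmult_le_pos; [nra|]|].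
        - left. apply Rinv_0_lt_compat. lra.
        - apply Rmult_le_pos; [apply pow_le; lra|exact h1]. }
      apply Rle_trans with (INR k * X)%R; [apply Req_le; unfold X, Rdiv; ring|].
      apply Rle_trans with ((INR k + 1) * X)%R; [nra|].
      apply Req_le; unfold X, Rdiv; ring. }
  assert (Hdv := PS_cv _ K (quot_coef t a) t HK' Ht (geo_quot_coef M K a t HK' Ht Ha)).
  assert (H0 : cv (fun k => RtoC (INR k) * T k) 0).
  { apply (cv_of_remainder _ _ (M * K / (1 - K * Cmod t))%R (K * Cmod t)%R); [lra|].
    intros n. replace (RtoC (INR n) * T n - 0) with (RtoC (INR n) * T n) by ring. apply HBT. }
  assert (H := cv_plus _ _ _ _ Hdv (cv_scal (-(1)) _ _ H0)).
  replace (PS (quot_coef t a) t + - (1) * 0) with (PS (quot_coef t a) t) in H by ring.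
  eapply cv_ext; [|exact H]. intros n. simpl. rewrite Hsum. ring.
Qed.

(** The derivative at [z] is the coefficient of index 1 of the expansion recentered there, and this
    coefficient is the value of the termwise derivative. *)
Lemma expands_cdiff_near (f : C -> C) (w : C) (a : nat -> C) (M K r : R) (z : C) :
  expands f w a M K r -> (Cmod (z - w) < r)%R -> cdiff f z (PS (deriv_coef a) (z - w)).
Proof.
  intros He Hz. destruct (expands_near _ _ _ _ _ _ _ He Hz) as (M' & K' & r' & H).
  rewrite (PS_deriv_coef M K).
  - eapply expands_cdiff; exact H.
  - apply He.
  - apply (expands_dom _ _ _ _ _ _ _ He Hz).
  - apply He.
Qed.

Lemma holo_cdiff (f : C -> C) (w : C) : holo f w -> exists l, cdiff f w l.
Proof. intros (a & M & K & r & He). exists (a 1%nat). eapply expands_cdiff; eauto. Qed.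

Lemma cdiff_continuous (f : C -> C) (z l : C) : cdiff f z l ->
  forall eps, (0 < eps)%R -> exists d, (0 < d)%R /\
    forall x, (Cmod (x - z) < d)%R -> (Cmod (f x - f z) < eps)%R.
Proof.
  intros H eps Heps. destruct (H 1%R Rlt_0_1) as (d & Hd & H1).
  assert (hl := Cmod_ge_0 l).
  assert (He : (0 < eps / (Cmod l + 1))%R) by (apply Rdiv_lt_0_compat; lra).
  exists (Rmin d (eps / (Cmod l + 1))). split; [apply Rmin_glb_lt; lra|].
  intros x Hx. assert (h1 := Rmin_l d (eps / (Cmod l + 1))).
  assert (h2 := Rmin_r d (eps / (Cmod l + 1))).
  specialize (H1 x ltac:(lra)).
  assert (h3 := Cmod_le_sub (f x - f z) ((x - z) * l)). rewrite Cmod_mult in h3.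
  assert (h4 : (Cmod (x - z) * (Cmod l + 1) < eps / (Cmod l + 1) * (Cmod l + 1))%R)
    by (apply Rmult_lt_compat_r; lra).
  replace (eps / (Cmod l + 1) * (Cmod l + 1))%R with eps in h4 by (field; lra). lra.
Qed.

Lemma holo_continuous (f : C -> C) (w : C) : holo f w ->
  forall eps, (0 < eps)%R -> exists d, (0 < d)%R /\
    forall x, (Cmod (x - w) < d)%R -> (Cmod (f x - f w) < eps)%R.
Proof. intros H. destruct (holo_cdiff f w H) as [l Hl]. exact (cdiff_continuous f w l Hl). Qed.

Lemma holo_neq_near (f : C -> C) (w : C) : holo f w -> f w <> 0 ->
  exists d, (0 < d)%R /\ forall x, (Cmod (x - w) < d)%R -> f x <> 0.
Proof.
  intros H H0. apply Cmod_gt_0 in H0 as H1.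
  destruct (holo_continuous f w H _ H1) as (d & Hd & Hc). exists d. split; [exact Hd|].
  intros x Hx h. specialize (Hc x Hx). rewrite h in Hc.
  replace (0 - f w) with (- f w) in Hc by ring. rewrite Cmod_opp in Hc. lra.
Qed.

Lemma Cmult_integral (a b : C) : a * b = 0 -> a = 0 \/ b = 0.
Proof.
  intros H. destruct (Ceq_dec a 0) as [|h]; [left; assumption|right].
  replace b with (/ a * (a * b)) by (field; exact h). rewrite H. ring.
Qed.

Lemma identity_theorem (f : C -> C) (w : C) : holo f w ->
  (forall d, (0 < d)%R -> exists z, (0 < Cmod (z - w) < d)%R /\ f z = 0) ->
  exists d, (0 < d)%R /\ forall z, (Cmod (z - w) < d)%R -> f z = 0.
Proof.
  intros (a & M & K & r & He) Hz. assert (Hd := fun z => expands_dom _ _ _ _ _ _ z He).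
  destruct He as (HK & Hr & HKr & Ha & Ef).
  assert (Ha0 : forall n, a n = 0).
  { intros n. induction n as [n IH] using lt_wf_ind.
    destruct (Ceq_dec (a n) 0) as [|h]; [assumption|exfalso].
    (* At the first nonzero coefficient, [f] is [(z - w) ^ n] times this tail, which is nonzero at
       [w] and hence nearby. That contradicts the accumulation of zeros. *)
    assert (He2 : expands (fun x => PS (tail_seq n a) (x - w)) w (tail_seq n a) (M * K ^ n) K r).
    { repeat split; auto. apply geo_tail_seq, Ha. }
    assert (Hn : PS (tail_seq n a) (w - w) <> 0).
    { replace (w - w) with (RtoC 0) by ring.
      rewrite (PS_S _ K _ _ ltac:(lra) ltac:(rewrite Cmod_0; lra) (geo_tail_seq M K n a Ha)).
      unfold tail_seq at 1. rewrite Nat.add_0_r, Cmult_0_l, Cplus_0_r. exact h. }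
    destruct (holo_neq_near (fun x => PS (tail_seq n a) (x - w)) w) as (d & Hd0 & Hne);
      [eexists _, _, _, _; exact He2|exact Hn|].
    destruct (Hz (Rmin d r)) as (z & Hzd & Hfz); [apply Rmin_glb_lt; assumption|].
    assert (h1 := Rmin_l d r). assert (h2 := Rmin_r d r).
    apply (Hne z); [lra|].
    rewrite Ef in Hfz by lra. rewrite (PS_tail M K a _ n) in Hfz; [|lra|apply Hd; lra|exact Ha].
    replace (csum (fun i => a i * (z - w) ^ i) n) with (RtoC 0) in Hfz.
    - rewrite Cplus_0_l in Hfz. apply Cmult_integral in Hfz as [Hp|Hp]; [|exact Hp].
      exfalso. revert Hp. apply Cpow_nz. apply Cmod_gt_0. lra.
    - assert (E : forall m, (m <= n)%nat -> csum (fun i => a i * (z - w) ^ i) m = 0).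
      { induction m as [|m IHm]; intros Hm; [reflexivity|]. simpl.
        rewrite IHm, IH by lia. ring. }
      symmetry. apply E. lia. }
  exists r. split; [exact Hr|]. intros z Hzr. rewrite Ef by exact Hzr.
  rewrite (PS_fin a 0); [reflexivity|]. intros; apply Ha0.
Qed.

(** * Polynomial differential systems *)

Fixpoint rsum (u : nat -> R) (n : nat) : R :=
  match n with O => 0%R | S k => (rsum u k + u k)%R end.

Lemma Cmod_csum (u : nat -> C) (v : nat -> R) (n : nat) :
  (forall i, (i < n)%nat -> (Cmod (u i) <= v i)%R) -> (Cmod (csum u n) <= rsum v n)%R.
Proof.
  induction n as [|n IH]; intros H; simpl; [rewrite Cmod_0; lra|].
  eapply Rle_trans; [apply Cmod_triangle|].
  apply Rplus_le_compat; [apply IH; intros; apply H; lia|apply H; lia].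
Qed.

Lemma rsum_lin (c : R) (u v : nat -> R) (n : nat) :
  rsum (fun i => c * (u i + v i))%R n = (c * (rsum u n + rsum v n))%R.
Proof. induction n as [|n IH]; simpl; [ring|]. rewrite IH. ring. Qed.

Lemma rsum_shift (u : nat -> R) (n : nat) :
  rsum u (S n) = (u O + rsum (fun i => u (S i)) n)%R.
Proof. induction n as [|n IH]; simpl in *; [ring|]. rewrite IH. ring. Qed.

Lemma rsum_rev (u : nat -> R) (n : nat) :
  rsum (fun i => u (n - i)%nat) (S n) = rsum u (S n).
Proof.
  induction n as [|n IH]; [reflexivity|].
  rewrite rsum_shift. change (rsum (fun i => u (S n - S i)%nat) (S n)) with
    (rsum (fun i => u (n - i)%nat) (S n)). rewrite IH, Nat.sub_0_r. simpl. ring.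
Qed.

Definition weight (n : nat) : R := (/ (INR n + 1) ^ 2)%R.

Lemma weight_pos (n : nat) : (0 < weight n)%R.
Proof. apply Rinv_0_lt_compat, pow_lt. assert (h := pos_INR n). lra. Qed.

Lemma rsum_weight (n : nat) : (rsum weight n <= 2)%R.
Proof.
  (* The bound is strengthened so that the induction telescopes. *)
  assert (H : (rsum weight n <= 2 - 2 / (INR n + 1))%R).
  { induction n as [|n IH]; [simpl; lra|]. simpl rsum. rewrite S_INR. unfold weight at 2.
    assert (h := pos_INR n).
    assert (E : (/ (INR n + 1) ^ 2 <= 2 / (INR n + 1) - 2 / (INR n + 1 + 1))%R).
    { replace (2 / (INR n + 1) - 2 / (INR n + 1 + 1))%R with
        (/ ((INR n + 1) * ((INR n + 1 + 1) / 2)))%R by (field; lra).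
      apply Rinv_le_contravar; [apply Rmult_lt_0_compat; lra|]. simpl. nra. }
    lra. }
  assert (h := pos_INR n).
  assert (0 <= 2 / (INR n + 1))%R by (apply Rlt_le, Rdiv_lt_0_compat; lra). lra.
Qed.

(** With [x = i + 1] and [y = n - i + 1], write [/ (x^2 y^2)] as [(/ x^2 + / y^2) / (x^2 + y^2)] and
    use [(x + y - 1)^2 <= 2 (x^2 + y^2)]. *)
Lemma weight_mult (i n : nat) : (i <= n)%nat ->
  (weight i * weight (n - i) <= 2 * weight n * (weight i + weight (n - i)))%R.
Proof.
  intros Hi. unfold weight. replace n with (i + (n - i))%nat at 2 by lia.
  generalize (n - i)%nat as j. intros j. rewrite plus_INR.
  assert (hi := pos_INR i). assert (hj := pos_INR j).
  set (x := (INR i + 1)%R). set (y := (INR j + 1)%R).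
  replace (INR i + INR j + 1)%R with (x + y - 1)%R by (unfold x, y; ring).
  assert (hx : (1 <= x)%R) by (unfold x; lra). assert (hy : (1 <= y)%R) by (unfold y; lra).
  clearbody x y.
  replace (/ x ^ 2 * / y ^ 2)%R with (1 * / (x ^ 2 * y ^ 2))%R by (field; lra).
  replace (2 * / (x + y - 1) ^ 2 * (/ x ^ 2 + / y ^ 2))%R with
    ((2 * (x ^ 2 + y ^ 2) / (x + y - 1) ^ 2) * / (x ^ 2 * y ^ 2))%R by (field; lra).
  apply Rmult_le_compat_r.
  - apply Rlt_le, Rinv_0_lt_compat. apply Rmult_lt_0_compat; apply pow_lt; lra.
  - apply (Rmult_le_reg_r ((x + y - 1) ^ 2)); [apply pow_lt; lra|].
    replace (2 * (x ^ 2 + y ^ 2) / (x + y - 1) ^ 2 * (x + y - 1) ^ 2)%R with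
      (2 * (x ^ 2 + y ^ 2))%R by (field; lra).
    assert (h1 : ((x + y - 1) ^ 2 <= (x + y) ^ 2)%R) by (apply pow_incr; lra).
    assert (h2 := pow2_ge_0 (x - y)). lra.
Qed.

(* The weights make such bounds stable under the Cauchy product. *)
Definition wbound (L : R) (N : nat) (A : R) (a : nat -> C) : Prop :=
  forall k, (k <= N)%nat -> (Cmod (a k) <= A * L ^ k * weight k)%R.

Lemma wbound_pos (L : R) (N : nat) (A : R) (a : nat -> C) : wbound L N A a -> (0 <= A)%R.
Proof.
  intros H. specialize (H O ltac:(lia)). unfold weight in H. simpl in H.
  assert (h := Cmod_ge_0 (a O)).
  replace (A * 1 * / ((0 + 1) * ((0 + 1) * 1)))%R with A in H by field. lra.
Qed.

(** The rate [L] is unchanged, in contrast to [geo_conv]. The 8 is the 2 of [weight_mult] times the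
    two weight sums, each at most 2. *)
Lemma wbound_conv (L : R) (N : nat) (A B : R) (a b : nat -> C) : (0 < L)%R ->
  wbound L N A a -> wbound L N B b -> wbound L N (8 * A * B) (conv a b).
Proof.
  intros HL Ha Hb k Hk. assert (HA := wbound_pos _ _ _ _ Ha). assert (HB := wbound_pos _ _ _ _ Hb).
  unfold conv.
  assert (HLk : (0 < L ^ k)%R) by (apply pow_lt; lra).
  set (c := (A * B * L ^ k * (2 * weight k))%R).
  assert (Hwk := weight_pos k).
  assert (HAB : (0 <= A * B * L ^ k)%R) by (apply Rmult_le_pos; [apply Rmult_le_pos|]; lra).
  assert (Hc : (0 <= c)%R) by (apply Rmult_le_pos; lra).
  eapply Rle_trans; [apply (Cmod_csum _ (fun i => c * (weight i + weight (k - i)))%R)|].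
  - intros i Hi. rewrite Cmod_mult.
    apply Rle_trans with ((A * L ^ i * weight i) * (B * L ^ (k - i) * weight (k - i)))%R.
    + apply Rmult_le_compat; try apply Cmod_ge_0; [apply Ha|apply Hb]; lia.
    + assert (EL : (L ^ k = L ^ i * L ^ (k - i))%R) by (rewrite <- pow_add; f_equal; lia).
      apply Rle_trans with (A * B * L ^ k * (weight i * weight (k - i)))%R;
        [rewrite EL; apply Req_le; ring|].
      unfold c. rewrite (Rmult_assoc (A * B * L ^ k)).
      apply Rmult_le_compat_l; [exact HAB|]. apply weight_mult. lia.
  - rewrite rsum_lin, (rsum_rev weight). assert (h := rsum_weight (S k)).
    apply Rle_trans with (c * (2 + 2))%R; [apply Rmult_le_compat_l; lra|].
    apply Req_le. unfold c. ring.
Qed.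

Lemma RtoC_neq (x : R) : x <> 0%R -> RtoC x <> 0.
Proof. intros H h. apply H, RtoC_inj, h. Qed.

(** * Polynomial right-hand sides and the method of majorants *)

Inductive expr : Type :=
  | ECst (c : C) | EZ | EU | EV
  | EAdd (e1 e2 : expr) | EMul (e1 e2 : expr).

Fixpoint eval (z u v : C) (e : expr) : C :=
  match e with
  | ECst c => c | EZ => z | EU => u | EV => v
  | EAdd e1 e2 => eval z u v e1 + eval z u v e2
  | EMul e1 e2 => eval z u v e1 * eval z u v e2
  end.

(** The same syntax is evaluated on numbers by [eval] and on power series here, so one existence
    theorem serves both the equation for [y] and the system at a pole. *)
Fixpoint eval_coef (z u v : nat -> C) (e : expr) : nat -> C :=
  match e with
  | ECst c => affine_coef c 0 | EZ => z | EU => u | EV => v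
  | EAdd e1 e2 => fun n => eval_coef z u v e1 n + 1 * eval_coef z u v e2 n
  | EMul e1 e2 => conv (eval_coef z u v e1) (eval_coef z u v e2)
  end.

(** What matters is the order of the quantifiers: [B] is fixed before [L] and the sequences, so [L]
    can afterwards be taken large compared with [B]. *)
Lemma wbound_eval_coef (e : expr) (A : R) : (0 <= A)%R ->
  exists B, (0 <= B)%R /\ forall L N z u v, (0 < L)%R ->
    wbound L N A z -> wbound L N A u -> wbound L N A v -> wbound L N B (eval_coef z u v e).
Proof.
  intros HA. induction e as [c| | | |e1 [B1 [H1 IH1]] e2 [B2 [H2 IH2]]
                                  |e1 [B1 [H1 IH1]] e2 [B2 [H2 IH2]]];
    try (exists A; split; [exact HA|]; simpl; auto; fail).
  - exists (Cmod c). split; [apply Cmod_ge_0|]. intros L N z u v HL _ _ _ [|k] Hk.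
    + unfold weight. simpl. apply Req_le. field.
    + replace (eval_coef z u v (ECst c) (S k)) with (RtoC 0) by (destruct k; reflexivity).
      rewrite Cmod_0. apply Rmult_le_pos; [|left; apply weight_pos].
      apply Rmult_le_pos; [apply Cmod_ge_0|apply pow_le; lra].
  - exists (B1 + B2)%R. split; [lra|]. intros L N z u v HL Hz Hu Hv k Hk. simpl.
    eapply Rle_trans; [apply Cmod_triangle|]. rewrite Cmult_1_l.
    specialize (IH1 L N z u v HL Hz Hu Hv k Hk). specialize (IH2 L N z u v HL Hz Hu Hv k Hk).
    lra.
  - exists (8 * B1 * B2)%R. split; [repeat apply Rmult_le_pos; lra|].
    intros L N z u v HL Hz Hu Hv. simpl. apply wbound_conv; auto.
Qed.

(** Coefficient [n] depends only on coefficients up to [n], which makes the recursion for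
    coefficient [S n] well founded. *)
Lemma eval_coef_ext (e : expr) (z u v u' v' : nat -> C) (n : nat) :
  (forall i, (i <= n)%nat -> u i = u' i) -> (forall i, (i <= n)%nat -> v i = v' i) ->
  eval_coef z u v e n = eval_coef z u' v' e n.
Proof.
  revert n. induction e as [c| | | |e1 IH1 e2 IH2|e1 IH1 e2 IH2]; intros n Hu Hv; simpl; auto.
  - rewrite IH1, IH2; auto.
  - unfold conv. apply csum_ext. intros i Hi. rewrite IH1, IH2; auto; intros; [apply Hu|apply Hv|
      apply Hu|apply Hv]; lia.
Qed.

Lemma PS_eval_coef (e : expr) (A L : R) (z u v : nat -> C) (x : C) :
  (0 < L)%R -> (L * Cmod x < 1)%R ->
  (forall N, wbound L N A z) -> (forall N, wbound L N A u) -> (forall N, wbound L N A v) ->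
  PS (eval_coef z u v e) x = eval (PS z x) (PS u x) (PS v x) e.
Proof.
  intros HL Hx Hz Hu Hv. assert (HA := wbound_pos _ _ _ _ (Hz O)).
  assert (Hgeo : forall e', exists M, geo M L (eval_coef z u v e')).
  { intros e'. destruct (wbound_eval_coef e' A HA) as (B & HB & H). exists B. intros n.
    eapply Rle_trans; [apply (H L n z u v HL (Hz n) (Hu n) (Hv n) n (le_n n))|].
    assert (h : (0 <= B * L ^ n)%R) by (apply Rmult_le_pos; [lra|apply pow_le; lra]).
    rewrite <- (Rmult_1_r (B * L ^ n)) at 2. apply Rmult_le_compat_l; [exact h|].
    unfold weight. rewrite <- Rinv_1. assert (hn := pos_INR n).
    apply Rinv_le_contravar; [lra|]. simpl. nra. }
  assert (HL' : (0 <= L)%R) by lra.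
  induction e as [c| | | |e1 IH1 e2 IH2|e1 IH1 e2 IH2]; simpl; auto.
  - rewrite PS_affine. ring.
  - destruct (Hgeo e1) as [M1 H1]. destruct (Hgeo e2) as [M2 H2].
    rewrite (PS_lin M1 L M2 L), IH1, IH2; auto. ring.
  - destruct (Hgeo e1) as [M1 H1]. destruct (Hgeo e2) as [M2 H2].
    rewrite (PS_conv M1 M2 L), IH1, IH2; auto.
Qed.

(** Comparison of coefficients in [u' = P] and [v' = Q]; the independent variable is expanded about
    [z1] as [affine_coef z1 1]. *)
Definition ode_step (P Q : expr) (z1 u1 v1 : C) (s : nat -> C * C) (k : nat) : C * C :=
  match k with
  | O => (u1, v1)
  | S n => (eval_coef (affine_coef z1 1) (fun i => fst (s i)) (fun i => snd (s i)) P n / RtoC (INR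
    (S n)),
            eval_coef (affine_coef z1 1) (fun i => fst (s i)) (fun i => snd (s i)) Q n / RtoC (INR
              (S n)))
  end.

Lemma ode_coef (P Q : expr) (z1 u1 v1 : C) : exists u v : nat -> C,
  u O = u1 /\ v O = v1 /\
  (forall n, u (S n) = eval_coef (affine_coef z1 1) u v P n / RtoC (INR (S n))) /\
  (forall n, v (S n) = eval_coef (affine_coef z1 1) u v Q n / RtoC (INR (S n))).
Proof.
  set (s := hseq (RtoC 0, RtoC 0) (ode_step P Q z1 u1 v1)).
  assert (Hs : forall n, s n = ode_step P Q z1 u1 v1 s n).
  { intros n. apply hseq_eq. intros a b [|k] H; [reflexivity|].
    unfold ode_step. f_equal; f_equal; apply eval_coef_ext;
      intros i Hi; rewrite H by lia; reflexivity. }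
  exists (fun i => fst (s i)), (fun i => snd (s i)).
  split; [rewrite Hs; reflexivity|]. split; [rewrite Hs; reflexivity|].
  split; intros n; rewrite (Hs (S n)); reflexivity.
Qed.

(** By induction all coefficients satisfy a weighted bound with constants [A] and [L] depending on
    [P], [Q] and [R0] only. The radius [/ (2 * L)] is therefore the same for all initial data
    bounded by [R0]. *)
Theorem polynomial_ode (P Q : expr) (R0 : R) : (0 <= R0)%R ->
  exists rho, (0 < rho)%R /\ forall z1 u1 v1,
    (Cmod z1 <= R0)%R -> (Cmod u1 <= R0)%R -> (Cmod v1 <= R0)%R ->
    exists u v : C -> C, u z1 = u1 /\ v z1 = v1 /\
      forall z, (Cmod (z - z1) < rho)%R ->
        holo u z /\ holo v z /\ cdiff u z (eval z (u z) (v z) P) /\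
        cdiff v z (eval z (u z) (v z) Q).
Proof.
  intros HR. set (A := (4 * (R0 + 1))%R).
  assert (HA : (0 <= A)%R) by (unfold A; lra).
  destruct (wbound_eval_coef P A HA) as (BP & HBP & HP).
  destruct (wbound_eval_coef Q A HA) as (BQ & HBQ & HQ).
  set (L := (BP + BQ + 1)%R). assert (HL : (1 <= L)%R) by (unfold L; lra).
  exists (/ (2 * L))%R. split; [apply Rinv_0_lt_compat; lra|].
  intros z1 u1 v1 Hz1 Hu1 Hv1.
  destruct (ode_coef P Q z1 u1 v1) as (u & v & Hu0 & Hv0 & Hu & Hv).
  assert (Hwt0 : weight 0 = 1%R) by (unfold weight; simpl; field).
  assert (Hwz : forall N, wbound L N A (affine_coef z1 1)).
  { intros N [|[|k]] _; simpl affine_coef.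
    - rewrite Hwt0. simpl. unfold A. lra.
    - rewrite Cmod_1. unfold weight. simpl.
      replace (/ ((1 + 1) * ((1 + 1) * 1)))%R with (/ 4)%R by field.
      unfold A. nra.
    - rewrite Cmod_0. apply Rmult_le_pos; [|left; apply weight_pos].
      apply Rmult_le_pos; [exact HA|apply pow_le; lra]. }
  (* The inductive step closes because [4 * B <= A * L], the division by [S n] being only used as
     division by at least 1. *)
  assert (Hstep : forall n B c d, (0 <= B)%R -> (B <= BP + BQ)%R ->
     (Cmod c <= B * L ^ n * weight n)%R -> d = c / RtoC (INR (S n)) ->
     (Cmod d <= A * L ^ S n * weight (S n))%R).
  { intros n B c d HB HBs Hc ->. assert (hn := pos_INR n).
    rewrite Cmod_div by (apply RtoC_neq; rewrite S_INR; lra).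
    rewrite Cmod_R, Rabs_right by (apply Rle_ge, pos_INR).
    assert (HLn : (0 < L ^ n)%R) by (apply pow_lt; lra).
    assert (hw := weight_pos n). assert (hw' := weight_pos (S n)).
    assert (Hww : (weight n <= 4 * weight (S n))%R).
    { unfold weight. rewrite S_INR.
      replace (4 * / (INR n + 1 + 1) ^ 2)%R with (/ ((INR n + 1 + 1) / 2) ^ 2)%R by (field; lra).
      apply Rinv_le_contravar; [apply pow_lt; lra|]. apply pow_incr. lra. }
    apply Rle_trans with (Cmod c).
    { unfold Rdiv. rewrite <- (Rmult_1_r (Cmod c)) at 2.
      apply Rmult_le_compat_l; [apply Cmod_ge_0|]. rewrite <- Rinv_1.
      apply Rinv_le_contravar; [lra|]. rewrite S_INR. lra. }
    eapply Rle_trans; [exact Hc|].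
    apply Rle_trans with (B * L ^ n * (4 * weight (S n)))%R;
      [apply Rmult_le_compat_l; [apply Rmult_le_pos; lra|exact Hww]|].
    apply Rle_trans with ((4 * B) * (L ^ n * weight (S n)))%R; [apply Req_le; ring|].
    apply Rle_trans with ((A * L) * (L ^ n * weight (S n)))%R; [|apply Req_le; simpl; ring].
    apply Rmult_le_compat_r; [apply Rmult_le_pos; lra|]. unfold A, L. nra. }
  assert (Hw : forall N, wbound L N A u /\ wbound L N A v).
  { induction N as [|N [IHu IHv]].
    - split; intros k Hk; replace k with O by lia; rewrite Hwt0; simpl; unfold A;
        [rewrite Hu0|rewrite Hv0]; lra.
    - assert (HL0 : (0 < L)%R) by lra.
      assert (h1 := HP L N _ u v HL0 (Hwz N) IHu IHv N (le_n N)).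
      assert (h2 := HQ L N _ u v HL0 (Hwz N) IHu IHv N (le_n N)).
      split; intros k Hk; (destruct (Nat.eq_dec k (S N)) as [->|h]; [|try (apply IHu; lia); apply
        IHv; lia]).
      + eapply (Hstep N BP); [lra|lra|exact h1|apply Hu].
      + eapply (Hstep N BQ); [lra|lra|exact h2|apply Hv]. }
  assert (Hg : forall a, (forall N, wbound L N A a) -> geo A L a).
  { intros a Ha n. eapply Rle_trans; [apply (Ha n n (le_n n))|].
    assert (h : (0 <= A * L ^ n)%R) by (apply Rmult_le_pos; [lra|apply pow_le; lra]).
    rewrite <- (Rmult_1_r (A * L ^ n)) at 2. apply Rmult_le_compat_l; [exact h|].
    unfold weight. rewrite <- Rinv_1. assert (hn := pos_INR n).
    apply Rinv_le_contravar; [lra|]. simpl. nra. }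
  assert (Hex : forall a, geo A L a -> expands (fun z => PS a (z - z1)) z1 a A L (/ (2 * L))).
  { intros a Ha. repeat split; auto; try lra.
    - apply Rinv_0_lt_compat; lra.
    - replace (L * / (2 * L))%R with (/ 2)%R by (field; lra). lra. }
  assert (Hgu := Hg u (fun N => proj1 (Hw N))). assert (Hgv := Hg v (fun N => proj2 (Hw N))).
  assert (Hat0 : forall a, geo A L a -> PS a (z1 - z1) = a O).
  { intros a Ha. replace (z1 - z1) with (RtoC 0) by ring.
    rewrite (PS_S A L); auto; [ring|lra|rewrite Cmod_0; lra]. }
  exists (fun z => PS u (z - z1)), (fun z => PS v (z - z1)).
  split; [rewrite Hat0; auto|]. split; [rewrite Hat0; auto|].
  intros z Hz.
  assert (HLz : (L * Cmod (z - z1) < 1)%R) by (eapply expands_dom; [apply (Hex u Hgu)|exact Hz]).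
  assert (Hdr : forall a e, (forall n, a (S n) = eval_coef (affine_coef z1 1) u v e n / RtoC (INR
    (S n))) ->
     PS (deriv_coef a) (z - z1) = eval z (PS u (z - z1)) (PS v (z - z1)) e).
  { intros a e Ha. rewrite (PS_ext (deriv_coef a) (eval_coef (affine_coef z1 1) u v e)).
    - rewrite (PS_eval_coef e A L); auto; try lra; try (intros N; apply (Hw N)).
      rewrite PS_affine. f_equal. ring.
    - intros n. unfold deriv_coef. rewrite Ha. field. apply RtoC_neq. rewrite S_INR.
      assert (hn := pos_INR n). lra. }
  repeat split.
  - eapply expands_holo_near; [apply (Hex u Hgu)|exact Hz].
  - eapply expands_holo_near; [apply (Hex v Hgv)|exact Hz].
  - rewrite <- (Hdr u P Hu). apply (expands_cdiff_near _ _ _ _ _ _ _ (Hex u Hgu) Hz).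
  - rewrite <- (Hdr v Q Hv). apply (expands_cdiff_near _ _ _ _ _ _ _ (Hex v Hgv) Hz).
Qed.

(** * Derivatives along segments and Gronwall *)

Lemma is_derive_cdiff (f : C -> C) (z l : C) :
  @is_derive C_AbsRing C_NormedModule f z l <-> cdiff f z l.
Proof.
  split.
  - intros [_ H] eps Heps.
    specialize (H z (fun P HP => HP) (mkposreal eps Heps)).
    destruct H as [d Hd]. exists d. split; [apply cond_pos|].
    intros x Hx. apply Hd. exact Hx.
  - intros H. split; [apply is_linear_scal_l|].
    intros x Hx. apply (is_filter_lim_locally_unique (K := C_AbsRing) (V := AbsRing_NormedModule
      C_AbsRing)) in Hx. subst x.
    intros eps. destruct (H eps (cond_pos eps)) as (d & Hd & Hc).
    exists (mkposreal d Hd). intros x Hx. apply Hc. exact Hx.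
Qed.

Lemma cdiff_C_derive (f : C -> C) (z l : C) : cdiff f z l -> C_derive f z = l.
Proof. intros H. apply is_C_derive_unique. apply is_derive_cdiff, H. Qed.

(** Real differentiability of a path, so that conjugation is allowed. *)
Definition pathD (f : R -> C) (t : R) (l : C) : Prop :=
  @is_derive R_AbsRing R_NormedModule (fun s => Re (f s)) t (Re l) /\
  @is_derive R_AbsRing R_NormedModule (fun s => Im (f s)) t (Im l).

Lemma pathD_eq (f : R -> C) (t : R) (l l' : C) : pathD f t l -> l = l' -> pathD f t l'.
Proof. intros H <-. exact H. Qed.

Lemma pathD_const (c : C) (t : R) : pathD (fun _ => c) t 0.
Proof.
  split.
  - exact (is_derive_const (K := R_AbsRing) (V := R_NormedModule) (Re c) t).
  - exact (is_derive_const (K := R_AbsRing) (V := R_NormedModule) (Im c) t).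
Qed.

Lemma pathD_plus (f g : R -> C) (t : R) (l m : C) :
  pathD f t l -> pathD g t m -> pathD (fun s => f s + g s) t (l + m).
Proof.
  intros [H1 H2] [H3 H4]. split.
  - exact (is_derive_plus _ _ _ _ _ H1 H3).
  - exact (is_derive_plus _ _ _ _ _ H2 H4).
Qed.

Lemma pathD_opp (f : R -> C) (t : R) (l : C) :
  pathD f t l -> pathD (fun s => - f s) t (- l).
Proof.
  intros [H1 H2]. split.
  - exact (is_derive_opp _ _ _ H1).
  - exact (is_derive_opp _ _ _ H2).
Qed.

Lemma pathD_minus (f g : R -> C) (t : R) (l m : C) :
  pathD f t l -> pathD g t m -> pathD (fun s => f s - g s) t (l - m).
Proof. intros Hf Hg. apply pathD_plus; [|apply pathD_opp]; assumption. Qed.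

Lemma pathD_conj (f : R -> C) (t : R) (l : C) :
  pathD f t l -> pathD (fun s => Cconj (f s)) t (Cconj l).
Proof.
  intros [H1 H2]. split; [exact H1|]. exact (is_derive_opp _ _ _ H2).
Qed.

Lemma pathD_mult (f g : R -> C) (t : R) (l m : C) :
  pathD f t l -> pathD g t m -> pathD (fun s => f s * g s) t (l * g t + f t * m).
Proof.
  intros [H1 H2] [H3 H4].
  split.
  - assert (h := is_derive_minus _ _ _ _ _
      (is_derive_mult _ _ t _ _ H1 H3 Rmult_comm) (is_derive_mult _ _ t _ _ H2 H4 Rmult_comm)).
    evar_last; [exact h|]. unfold minus, plus, opp, mult; simpl. unfold Re, Im. simpl. ring.
  - assert (h := is_derive_plus _ _ _ _ _
      (is_derive_mult _ _ t _ _ H1 H4 Rmult_comm) (is_derive_mult _ _ t _ _ H2 H3 Rmult_comm)).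
    evar_last; [exact h|]. unfold minus, plus, opp, mult; simpl. unfold Re, Im. simpl. ring.
Qed.

Lemma pathD_inv (f : R -> C) (t : R) (l : C) :
  pathD f t l -> f t <> 0 -> pathD (fun s => / f s) t (- l / (f t * f t)).
Proof.
  intros [H1 H2] H0.
  assert (Hn : ((Re (f t)) ^ 2 + (Im (f t)) ^ 2 <> 0)%R).
  { rewrite <- Cmod2_alt. apply pow_nonzero. intros h. apply H0, Cmod_eq_0, h. }
  assert (hn : is_derive (fun s => Re (f s) ^ 2 + Im (f s) ^ 2)%R t
     (2 * (Re (f t) * Re l + Im (f t) * Im l))%R).
  { assert (h := is_derive_plus _ _ _ _ _ (is_derive_pow _ 2 _ _ H1) (is_derive_pow _ 2 _ _ H2)).
    evar_last; [exact h|]. unfold plus; simpl; ring. }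
  replace (- l / (f t * f t)) with (- l * (/ f t * / f t)) by (field; exact H0).
  split.
  - evar_last; [apply (is_derive_div (fun s => Re (f s)) _ t _ _ H1 hn Hn)|].
    unfold Re, Im in *. simpl. field. intros h. apply Hn. simpl. lra.
  - evar_last; [apply (is_derive_div (fun s => - Im (f s))%R _ t _ _ (is_derive_opp _ _ _ H2) hn
      Hn)|].
    unfold opp, Re, Im in *. simpl. field. intros h. apply Hn. simpl. lra.
Qed.

Lemma pathD_cdiff (f : C -> C) (a e : C) (t : R) (l : C) :
  cdiff f (a + RtoC t * e) l -> pathD (fun s => f (a + RtoC s * e)) t (e * l).
Proof.
  intros H.
  assert (K : forall eps, (0 < eps)%R -> exists d : posreal, forall h, (Rabs h < d)%R ->
     (Cmod (f (a + RtoC (t + h) * e)%C - f (a + RtoC t * e)%C - RtoC h * (e * l)) <= eps * Rabs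
       h)%R).
  { intros eps Heps. assert (he := Cmod_ge_0 e).
    assert (Hp : (0 < eps / (Cmod e + 1))%R) by (apply Rdiv_lt_0_compat; lra).
    destruct (H _ Hp) as (d & Hd & Hc).
    assert (Hd' : (0 < d / (Cmod e + 1))%R) by (apply Rdiv_lt_0_compat; lra).
    exists (mkposreal _ Hd'). intros h Hh. simpl in Hh.
    assert (E : Cmod (a + RtoC (t + h) * e - (a + RtoC t * e)) = (Rabs h * Cmod e)%R).
    { replace (a + RtoC (t + h) * e - (a + RtoC t * e)) with (RtoC h * e)
        by (rewrite RtoC_plus; ring).
      rewrite Cmod_mult, Cmod_R. reflexivity. }
    assert (hh := Rabs_pos h).
    apply (Rmult_lt_compat_r (Cmod e + 1)) in Hh; [|lra].
    replace (d / (Cmod e + 1) * (Cmod e + 1))%R with d in Hh by (field; lra).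
    specialize (Hc (a + RtoC (t + h) * e)). rewrite E in Hc.
    replace (a + RtoC (t + h) * e - (a + RtoC t * e)) with (RtoC h * e) in Hc
      by (rewrite RtoC_plus; ring).
    replace (RtoC h * (e * l)) with (RtoC h * e * l) by ring.
    eapply Rle_trans; [apply Hc; nra|].
    apply Rle_trans with (eps / (Cmod e + 1) * (Rabs h * (Cmod e + 1)))%R;
      [apply Rmult_le_compat_l; nra|]. apply Req_le. field. lra. }
  (* Real and imaginary part are treated together, as real-linear functionals dominated by the
     modulus. *)
  assert (K2 : forall (g : C -> R), (forall x, (Rabs (g x) <= Cmod x)%R) ->
     (forall x y, g (x - y) = (g x - g y)%R) -> (forall h x, g (RtoC h * x) = (h * g x)%R) ->
     is_derive (fun s => g (f (a + RtoC s * e))) t (g (e * l)%C)).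
  { intros g Hg Hsub Hscal. apply is_derive_Reals. intros eps Heps.
    destruct (K (eps / 2)%R ltac:(lra)) as [d Hd]. exists d. intros h Hh0 Hh.
    specialize (Hd h Hh). assert (Hp := Rabs_pos_lt h Hh0).
    apply (Rmult_lt_reg_r (Rabs h)); [exact Hp|]. rewrite <- Rabs_mult.
    replace (((g (f (a + RtoC (t + h) * e)%C) - g (f (a + RtoC t * e)%C)) / h - g (e * l)%C) * h)%R
      with (g (f (a + RtoC (t + h) * e) - f (a + RtoC t * e) - RtoC h * (e * l))%C)
      by (rewrite !Hsub, Hscal; field; exact Hh0).
    eapply Rle_lt_trans; [apply Hg|]. nra. }
  split; apply K2.
  - apply re_le_Cmod.
  - reflexivity.
  - intros h x. unfold Re; simpl. ring.
  - intros x. eapply Rle_trans; [apply Rmax_r|apply Rmax_Cmod].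
  - reflexivity.
  - intros h x. unfold Im; simpl. ring.
Qed.

Lemma pathD_line (a e : C) (t : R) : pathD (fun s => a + RtoC s * e) t e.
Proof.
  eapply pathD_eq; [apply (pathD_cdiff (fun z => z) a e t 1)|ring].
  intros eps Heps. exists 1%R. split; [lra|]. intros x _.
  match goal with |- (Cmod ?u <= _)%R => replace u with (RtoC 0) by ring end.
  rewrite Cmod_0. apply Rmult_le_pos; [lra|apply Cmod_ge_0].
Qed.

Lemma gronwall (S dS : R -> R) (K : R) :
  (forall t, (0 <= t <= 1)%R -> is_derive S t (dS t)) ->
  (forall t, (0 <= t <= 1)%R -> (dS t <= K * S t)%R) ->
  (S 1 <= S 0 * exp K)%R.
Proof.
  intros HS HK.
  set (g := fun t => (S t * exp (- K * t))%R).
  set (dg := fun t => ((dS t - K * S t) * exp (- K * t))%R).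
  assert (Hg : forall t, (0 <= t <= 1)%R -> is_derive g t (dg t)).
  { intros t Ht. unfold g, dg.
    assert (he : is_derive (fun t => exp (- K * t)) t (- K * exp (- K * t))%R)
      by (auto_derive; [exact I|ring]).
    evar_last; [exact (is_derive_mult _ _ t _ _ (HS t Ht) he Rmult_comm)|].
    unfold plus, mult; simpl. ring. }
  destruct (MVT_gen g 0 1 dg) as (x & Hx & E).
  - intros t Ht. rewrite Rmin_left, Rmax_right in Ht by lra. apply Hg. lra.
  - intros t Ht. rewrite Rmin_left, Rmax_right in Ht by lra.
    apply continuity_pt_filterlim.
    apply (ex_derive_continuous (K := R_AbsRing) (V := R_NormedModule)).
    exists (dg t). apply Hg. lra.
  - rewrite Rmin_left, Rmax_right in Hx by lra.
    assert (h : (dg x <= 0)%R).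
    { unfold dg. assert (h1 := exp_pos (- K * x)). assert (h2 := HK x Hx). nra. }
    assert (E2 : (g 1%R <= g 0%R)%R) by lra. unfold g in E2.
    rewrite Rmult_0_r, exp_0, Rmult_1_r, Rmult_1_r in E2.
    apply (Rmult_le_compat_r (exp K)) in E2; [|left; apply exp_pos].
    rewrite Rmult_assoc, <- exp_plus in E2. replace (- K + K)%R with 0%R in E2 by ring.
    rewrite exp_0 in E2. lra.
Qed.

(** The squared modulus is used because the modulus itself may fail to be differentiable at a zero
    of [V]. *)
Lemma is_derive_Cmod2 (V : R -> C) (t : R) (l : C) : pathD V t l ->
  exists d, is_derive (fun s => (Cmod (V s)) ^ 2)%R t d /\ (d <= 2 * Cmod (V t) * Cmod l)%R.
Proof.
  intros [H1 H2]. exists (2 * Re (Cconj (V t) * l))%R. split.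
  - apply (is_derive_ext (fun s => Re (V s) ^ 2 + Im (V s) ^ 2)%R).
    { intros s. symmetry. apply Cmod2_alt. }
    assert (h := is_derive_plus _ _ _ _ _ (is_derive_pow _ 2 _ _ H1) (is_derive_pow _ 2 _ _ H2)).
    evar_last; [exact h|]. unfold plus, Re, Im; simpl; ring.
  - assert (h := re_le_Cmod (Cconj (V t) * l)). rewrite Cmod_mult, Cmod_conj in h.
    assert (h2 := Rle_abs (Re (Cconj (V t) * l))). lra.
Qed.

Lemma path_gronwall (V dV : R -> C) (K : R) : (0 <= K)%R ->
  (forall t, (0 <= t <= 1)%R -> pathD V t (dV t)) ->
  (forall t, (0 <= t <= 1)%R -> (Cmod (dV t) <= K * (1 + Cmod (V t)))%R) ->
  (1 + Cmod (V 1%R) ^ 2 <= (1 + Cmod (V 0%R) ^ 2) * exp (4 * K))%R.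
Proof.
  intros HK HV Hb.
  set (S := fun t => (1 + Cmod (V t) ^ 2)%R).
  apply (gronwall S (Derive S) (4 * K)).
  - intros t Ht. destruct (is_derive_Cmod2 V t _ (HV t Ht)) as (d & Hd & _).
    apply Derive_correct. exists d. unfold S.
    evar_last; [exact (is_derive_plus _ _ _ _ _
      (is_derive_const (K := R_AbsRing) (V := R_NormedModule) 1%R t) Hd)|].
    unfold plus, zero; simpl. ring.
  - intros t Ht. destruct (is_derive_Cmod2 V t _ (HV t Ht)) as (d & Hd & Hle).
    replace (Derive S t) with d.
    + specialize (Hb t Ht). assert (h := Cmod_ge_0 (V t)). unfold S.
      set (v := Cmod (V t)) in *.
      (* With [2 v <= 1 + v^2], the bound [2 v K (1 + v)] is at most [K (1 + 3 v^2)], hence at most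
         [4 K (1 + v^2)]. *)
      apply (Rmult_le_compat_l (2 * v)) in Hb; [|lra].
      assert (h1 : (0 <= K * (1 - v) ^ 2)%R) by (apply Rmult_le_pos; [lra|apply pow2_ge_0]).
      assert (h2 : (0 <= K * v ^ 2)%R) by (apply Rmult_le_pos; [lra|apply pow2_ge_0]).
      change (d <= 4 * K * (1 + v ^ 2))%R. change (d <= 2 * v * Cmod (dV t))%R in Hle.
      lra.
    + symmetry. apply is_derive_unique. unfold S.
      evar_last; [exact (is_derive_plus _ _ _ _ _
        (is_derive_const (K := R_AbsRing) (V := R_NormedModule) 1%R t) Hd)|].
      unfold plus, zero; simpl. ring.
Qed.

(** * The corrected energy *)

Definition inv_one_plus_sq (Y : C) : C := / (1 + Y * Cconj Y).

(* [energy_fn z y y'] is the function [V] of the introduction. *)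
Definition energy_fn (z Y P : C) : C := P * P + P * Cconj Y * inv_one_plus_sq Y - 4 * Y ^ 3 - 2 * z
  * Y.

(* The derivative in the direction [e], where [P ^ 2] has been eliminated in favour of [energy_fn]
   so that the terms of order [Y ^ 3] cancel. *)
Definition energy_fn_deriv (e z Y P : C) : C :=
  e * (Y * (2 * inv_one_plus_sq Y - 4 * inv_one_plus_sq Y ^ 2) + z * Cconj Y * inv_one_plus_sq Y
       - energy_fn z Y P * (Cconj Y * inv_one_plus_sq Y) ^ 2 + P * (Cconj Y * inv_one_plus_sq Y) ^ 3
       - 2 * z * Y * (Cconj Y * inv_one_plus_sq Y) ^ 2)
  + P * Cconj (e * P) * inv_one_plus_sq Y ^ 2.

Lemma Cmod_one_plus_sq (Y : C) : Cmod (1 + Y * Cconj Y) = (1 + Cmod Y ^ 2)%R.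
Proof.
  rewrite <- Cmod2_conj, <- RtoC_plus, Cmod_R. apply Rabs_right.
  assert (h := pow2_ge_0 (Cmod Y)). lra.
Qed.

Lemma one_plus_sq_neq (Y : C) : 1 + Y * Cconj Y <> 0.
Proof.
  apply Cmod_gt_0. rewrite Cmod_one_plus_sq. assert (h := pow2_ge_0 (Cmod Y)). lra.
Qed.

Lemma Cmod_inv_one_plus_sq (Y : C) : Cmod (inv_one_plus_sq Y) = (/ (1 + Cmod Y ^ 2))%R.
Proof. unfold inv_one_plus_sq. rewrite Cmod_inv by apply one_plus_sq_neq. f_equal.
apply Cmod_one_plus_sq. Qed.

Lemma energy_fn_path (e : C) (zz YY PP : R -> C) (t : R) :
  pathD zz t e -> pathD YY t (e * PP t) -> pathD PP t (e * (6 * YY t ^ 2 + zz t)) ->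
  pathD (fun s => energy_fn (zz s) (YY s) (PP s)) t (energy_fn_deriv e (zz t) (YY t) (PP t)).
Proof.
  intros Hz HY HP. unfold energy_fn, inv_one_plus_sq.
  assert (HQ := pathD_plus _ _ _ _ _ (pathD_const 1 t)
     (pathD_mult _ _ _ _ _ HY (pathD_conj _ _ _ HY))).
  assert (HI := pathD_inv _ _ _ HQ (one_plus_sq_neq (YY t))).
  assert (H1 := pathD_mult _ _ _ _ _ HP HP).
  assert (H2 := pathD_mult _ _ _ _ _ (pathD_mult _ _ _ _ _ HP (pathD_conj _ _ _ HY)) HI).
  assert (HY2 := pathD_mult _ _ _ _ _ HY (pathD_mult _ _ _ _ _ HY (pathD_mult _ _ _ _ _ HY
    (pathD_const 1 t)))).
  assert (H3 := pathD_mult _ _ _ _ _ (pathD_const 4 t) HY2).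
  assert (H4 := pathD_mult _ _ _ _ _ (pathD_mult _ _ _ _ _ (pathD_const 2 t) Hz) HY).
  eapply pathD_eq;
    [exact (pathD_minus _ _ _ _ _ (pathD_minus _ _ _ _ _ (pathD_plus _ _ _ _ _ H1 H2) H3) H4)|].
  assert (Hne := one_plus_sq_neq (YY t)).
  unfold energy_fn_deriv, energy_fn, inv_one_plus_sq. rewrite !Cmult_conj. revert Hne.
  generalize (YY t) (PP t) (zz t). intros Y P z.
  (* The identity is rational in the variables and their conjugates taken as independent
     unknowns. *)
  generalize (Cconj Y) (Cconj P) (Cconj e). intros Yc Pc ec Hne.
  field. exact Hne.
Qed.

Lemma Cmod_sq (x : C) : Cmod (x * x) = (Cmod x ^ 2)%R.
Proof. rewrite Cmod_mult. ring. Qed.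

Lemma Cmod_n (n : R) : (0 <= n)%R -> Cmod (RtoC n) = n.
Proof. intros H. rewrite Cmod_R. apply Rabs_right. lra. Qed.

(** The definition of the energy solved for [P * P]. The right side is only linear in [Cmod P], so
    this quadratic inequality controls [P] by the energy, [Y] and [z]. *)
Lemma energy_fn_momentum_bound (z Y P : C) :
  (Cmod P ^ 2 <= Cmod (energy_fn z Y P) + Cmod P * (Cmod Y * / (1 + Cmod Y ^ 2))
     + 4 * Cmod Y ^ 3 + 2 * Cmod z * Cmod Y)%R.
Proof.
  rewrite <- Cmod_sq.
  replace (P * P) with (energy_fn z Y P - P * Cconj Y * inv_one_plus_sq Y + 4 * Y ^ 3 + 2 * z * Y)
    by (unfold energy_fn; ring).
  eapply Rle_trans; [apply Cmod_triangle|]. apply Rplus_le_compat;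
    [|rewrite !Cmod_mult, Cmod_n by lra; lra].
  eapply Rle_trans; [apply Cmod_triangle|]. apply Rplus_le_compat;
    [|rewrite !Cmod_mult, Cmod_pow, Cmod_n by lra; lra].
  eapply Rle_trans; [apply Cmod_triangle_sub|]. apply Rplus_le_compat_l.
  rewrite !Cmod_mult, Cmod_conj, Cmod_inv_one_plus_sq. apply Req_le. ring.
Qed.

Lemma energy_fn_deriv_bound (Z0 : R) (e z Y P : C) : (Cmod z <= Z0)%R ->
  (Cmod (energy_fn_deriv e z Y P) <= Cmod e * (25 + 11 * Z0) * (1 + Cmod (energy_fn z Y P)))%R.
Proof.
  intros Hz. assert (HM := energy_fn_momentum_bound z Y P).
  set (V := energy_fn z Y P) in *. set (v := Cmod V) in *.
  set (y := Cmod Y) in *. set (p := Cmod P) in *. set (i := (/ (1 + y ^ 2))%R) in *.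
  assert (hy : (0 <= y)%R) by apply Cmod_ge_0. assert (hp : (0 <= p)%R) by apply Cmod_ge_0.
  assert (hv : (0 <= v)%R) by apply Cmod_ge_0. assert (he := Cmod_ge_0 e).
  assert (hz := Cmod_ge_0 z).
  assert (hy2 := pow2_ge_0 y).
  assert (hi : (0 < i)%R) by (apply Rinv_0_lt_compat; lra).
  assert (hi1 : (i * (1 + y ^ 2) = 1)%R) by (unfold i; field; lra).
  assert (iy2 : (0 <= i * y ^ 2 <= 1)%R) by (split; [apply Rmult_le_pos; lra|lra]).
  assert (ile1 : (i <= 1)%R) by lra.
  assert (iy : (0 <= i * y <= 1)%R).
  { split; [apply Rmult_le_pos; lra|]. assert (h := pow2_ge_0 (1 - y)). nra. }
  (* The momentum enters the derivative only through [q]. Multiplying the momentum bound by [i ^ 2]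
     tames its cubic term, since [i ^ 2 * y ^ 3 <= 1], and leaves a quadratic inequality for [q]. *)
  set (q := (p * i)%R).
  assert (hq : (0 <= q)%R) by (apply Rmult_le_pos; lra).
  assert (iy3 : (0 <= i ^ 2 * y ^ 3 <= 1)%R).
  { replace (i ^ 2 * y ^ 3)%R with ((i * y ^ 2) * (i * y))%R by ring. nra. }
  assert (hq2 : (q ^ 2 <= 2 * v + 9 + 4 * Z0)%R).
  { assert (h : (q ^ 2 <= v + q + 4 + 2 * Z0)%R).
    { replace (q ^ 2)%R with (p ^ 2 * i ^ 2)%R by (unfold q; ring).
      assert (hi2 : (0 <= i ^ 2 <= 1)%R) by (simpl; nra).
      apply Rle_trans with
        ((v + p * (y * i) + 4 * y ^ 3 + 2 * Cmod z * y) * i ^ 2)%R;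
        [apply Rmult_le_compat_r; lra|].
      replace ((v + p * (y * i) + 4 * y ^ 3 + 2 * Cmod z * y) * i ^ 2)%R with
        (v * i ^ 2 + q * (i * (i * y)) + 4 * (i ^ 2 * y ^ 3) + 2 * Cmod z * (i * (i * y)))%R
        by (unfold q; ring).
      assert (h1 : (0 <= i * (i * y) <= 1)%R) by nra.
      assert (h2 : (v * i ^ 2 <= v * 1)%R) by (apply Rmult_le_compat_l; lra).
      assert (h3 : (q * (i * (i * y)) <= q * 1)%R) by (apply Rmult_le_compat_l; lra).
      assert (h4 : (2 * Cmod z * (i * (i * y)) <= 2 * Z0 * 1)%R)
        by (apply Rmult_le_compat; lra).
      lra. }
    assert (h0 := pow2_ge_0 (1 - q)). lra. }
  assert (hq1 : (2 * q <= 1 + q ^ 2)%R) by (assert (h := pow2_ge_0 (1 - q)); lra).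
  assert (mi : Cmod (inv_one_plus_sq Y) = i) by apply Cmod_inv_one_plus_sq.
  assert (mc : Cmod (Cconj Y * inv_one_plus_sq Y) = (i * y)%R)
    by (rewrite Cmod_mult, Cmod_conj, mi; unfold y; ring).
  assert (T1 : (Cmod (Y * (2 * inv_one_plus_sq Y - 4 * inv_one_plus_sq Y ^ 2)) <= 6)%R).
  { rewrite Cmod_mult. assert (h := Cmod_triangle_sub (2 * inv_one_plus_sq Y) (4 * inv_one_plus_sq
      Y ^ 2)).
    rewrite !Cmod_mult, Cmod_pow, !Cmod_n, mi in h by lra. fold y.
    apply Rle_trans with (y * (2 * i + 4 * i ^ 2))%R; [apply Rmult_le_compat_l; lra|].
    replace (y * (2 * i + 4 * i ^ 2))%R with (2 * (i * y) + 4 * (i * (i * y)))%R by ring. nra. }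
  assert (T2 : (Cmod (z * Cconj Y * inv_one_plus_sq Y) <= Z0)%R).
  { rewrite <- Cmult_assoc, Cmod_mult, mc.
    apply Rle_trans with (Z0 * 1)%R; [apply Rmult_le_compat; lra|lra]. }
  assert (iyn : (0 <= (i * y) ^ 2 <= 1)%R) by (simpl; nra).
  assert (T3 : (Cmod (V * (Cconj Y * inv_one_plus_sq Y) ^ 2) <= v)%R).
  { rewrite Cmod_mult, Cmod_pow, mc. fold v.
    apply Rle_trans with (v * 1)%R; [apply Rmult_le_compat_l; lra|lra]. }
  assert (T4 : (Cmod (P * (Cconj Y * inv_one_plus_sq Y) ^ 3) <= q)%R).
  { rewrite Cmod_mult, Cmod_pow, mc. fold p.
    replace (p * (i * y) ^ 3)%R with (q * (i ^ 2 * y ^ 3))%R by (unfold q; ring).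
    apply Rle_trans with (q * 1)%R; [apply Rmult_le_compat_l; lra|lra]. }
  assert (T5 : (Cmod (2 * z * Y * (Cconj Y * inv_one_plus_sq Y) ^ 2) <= 2 * Z0)%R).
  { rewrite !Cmod_mult, Cmod_pow, mc, Cmod_n by lra. fold y.
    replace (2 * Cmod z * y * (i * y) ^ 2)%R with (2 * Cmod z * (i ^ 2 * y ^ 3))%R by ring.
    apply Rle_trans with (2 * Z0 * 1)%R; [apply Rmult_le_compat; lra|lra]. }
  assert (T6 : (Cmod (P * Cconj (e * P) * inv_one_plus_sq Y ^ 2) <= Cmod e * q ^ 2)%R).
  { rewrite !Cmod_mult, Cmod_pow, Cmod_conj, Cmod_mult, mi. apply Req_le. unfold q, p. ring. }
  unfold energy_fn_deriv. fold V.
  eapply Rle_trans; [apply Cmod_triangle|].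
  apply Rle_trans with (Cmod e * (6 + Z0 + v + q + 2 * Z0) + Cmod e * q ^ 2)%R.
  - apply Rplus_le_compat; [|exact T6]. rewrite Cmod_mult. apply Rmult_le_compat_l; [exact he|].
    eapply Rle_trans; [apply Cmod_triangle_sub|]. apply Rplus_le_compat; [|exact T5].
    eapply Rle_trans; [apply Cmod_triangle|]. apply Rplus_le_compat; [|exact T4].
    eapply Rle_trans; [apply Cmod_triangle_sub|]. apply Rplus_le_compat; [|exact T3].
    eapply Rle_trans; [apply Cmod_triangle|]. apply Rplus_le_compat; [exact T1|exact T2].
  (* Inserting the bounds for [q] and [q ^ 2] gives at most [20 + 9 * Z0 + 4 * v]; the constants 25
     and 11 have some slack. *)
  - rewrite <- Rmult_plus_distr_l, Rmult_assoc. apply Rmult_le_compat_l; [exact he|].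
    assert (h : (0 <= Z0 * v)%R) by (apply Rmult_le_pos; lra). lra.
Qed.

(** * Boundedness of the energy up to the boundary *)

(** A supremum argument. The one hypothesis covers the start ([t = 0], where nothing is assumed),
    the limit point [t] itself and an interval to its right. *)
Lemma continuous_induction (P : R -> Prop) (T : R) :
  (forall t, (0 <= t <= T)%R -> (forall s, (0 <= s < t)%R -> P s) ->
     exists d, (0 < d)%R /\ forall s, (t <= s < t + d)%R -> P s) ->
  forall s, (0 <= s <= T)%R -> P s.
Proof.
  intros H s0 Hs0. destruct (classic (P s0)) as [|Hn]; [assumption|exfalso].
  set (E := fun t => (0 <= t <= s0)%R /\ forall s, (0 <= s < t)%R -> P s).
  destruct (completeness E) as [m [Hub Hlub]].
  - exists s0. intros t [Ht _]. lra.
  - exists 0%R. split; [lra|]. intros; lra.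
  - assert (Hm0 : (0 <= m)%R) by (apply Hub; split; [lra|intros; lra]).
    assert (Hms : (m <= s0)%R) by (apply Hlub; intros t [Ht _]; lra).
    assert (Hbelow : forall s, (0 <= s < m)%R -> P s).
    { intros s Hs. destruct (classic (exists t, E t /\ (s < t)%R)) as [(t & [_ Ht] & Hst)|Hno].
      - apply Ht. lra.
      - exfalso. assert (m <= s)%R; [|lra]. apply Hlub. intros t Ht.
        apply Rnot_lt_le. intros h. apply Hno. exists t. split; assumption. }
    destruct (H m ltac:(lra) Hbelow) as (d & Hd & HPd).
    destruct (Rlt_le_dec s0 (m + d)) as [h|h].
    + apply Hn, HPd. lra.
    + assert (m + d <= m)%R; [|lra]. apply Hub. split; [lra|].
      intros s Hs. destruct (Rlt_le_dec s m); [apply Hbelow|apply HPd]; lra.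
Qed.

Lemma disk_open (c : C) (r : R) (w : C) : disk c r w ->
  exists d, (0 < d)%R /\ forall z, (Cmod (z - w) < d)%R -> disk c r z.
Proof.
  unfold disk. intros H. exists (r - Cmod (w - c))%R. split; [lra|]. intros z Hz.
  assert (h := Cmod_sub_triangle z w c). lra.
Qed.

(** A common form for regular points ([n = 0], [h = y]) and poles, which also shows that poles are
    isolated. The disjunction allows a pole to be recognized later by [h w <> 0] with positive
    [n]. *)
Lemma meromorphic_form (D : C -> Prop) (y : C -> C) (w : C) : meromorphic_on D y -> D w ->
  exists (n : nat) (h : C -> C) (d : R), (0 < d)%R /\ holo h w /\
    (holo y w \/ (n <> O /\ h w <> 0)) /\
    (forall z, (Cmod (z - w) < d)%R -> z <> w ->
       holo y z /\ y z * (z - w) ^ n = h z).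
Proof.
  intros Hm Hw. destruct (Hm w Hw) as [Ha|(n & Hn & g & r & Hr & Hg & Hgw & Hf)].
  - apply analytic_at_holo in Ha. destruct (holo_open y w Ha) as (d & Hd & H).
    exists O, y, d. split; [exact Hd|]. split; [exact Ha|]. split; [left; exact Ha|].
    intros z Hz _. split; [apply H, Hz|]. simpl. ring.
  - apply analytic_at_holo in Hg. destruct (holo_open g w Hg) as (d & Hd & H).
    exists n, g, (Rmin d r). split; [apply Rmin_glb_lt; assumption|].
    split; [exact Hg|]. split; [right; split; [lia|exact Hgw]|].
    assert (h1 := Rmin_l d r). assert (h2 := Rmin_r d r).
    intros z Hz Hzw.
    assert (Hne : z - w <> 0).
    { intros h. apply Hzw. replace z with (z - w + w) by ring. rewrite h. ring. }
    split.
    + assert (Hpos : (0 < Cmod (z - w))%R) by (apply Cmod_gt_0, Hne).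
      apply (holo_ext_loc (fun x => g x * / (x - w) ^ n) y z
               (Rmin (Rmin d r - Cmod (z - w)) (Cmod (z - w)))).
      * apply Rmin_glb_lt; lra.
      * intros x Hx. assert (h3 := Rmin_l (Rmin d r - Cmod (z - w)) (Cmod (z - w))).
        assert (h4 := Rmin_r (Rmin d r - Cmod (z - w)) (Cmod (z - w))).
        symmetry. apply Hf.
        -- unfold disk. assert (h5 := Cmod_sub_triangle x z w). lra.
        -- intros ->. rewrite (Cmod_sub_sym w z) in Hx. lra.
      * apply holo_mult; [apply H; lra|].
        apply holo_inv; [apply holo_pow, holo_sub_id|apply Cpow_nz, Hne].
    + rewrite Hf; [field; apply Cpow_nz, Hne|unfold disk; lra|exact Hzw].
Qed.

Lemma solution_cdiff (D : C -> Prop) (y : C -> C) (z : C) :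
  painleve1_solution_on D y -> D z -> holo y z ->
  cdiff y z (C_derive y z) /\ cdiff (C_derive y) z (6 * y z ^ 2 + z).
Proof.
  intros Hs Hz Ha. split.
  - destruct (holo_cdiff y z Ha) as [l Hl]. rewrite (cdiff_C_derive y z l Hl). exact Hl.
  - apply is_derive_cdiff. apply Hs; [exact Hz|]. apply analytic_at_holo, Ha.
Qed.

Lemma exp_le (x y : R) : (x <= y)%R -> (exp x <= exp y)%R.
Proof.
  intros H. destruct (Rle_lt_or_eq_dec _ _ H) as [h|h]; [left; apply exp_increasing, h|].
  rewrite h. lra.
Qed.

(** The quantity estimated by [path_gronwall]; its bounds are multiplicative and thus combine along
    consecutive segments. *)
Definition energy (y : C -> C) (z : C) : R :=
  (1 + Cmod (energy_fn z (y z) (C_derive y z)) ^ 2)%R.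

Lemma energy_pos (y : C -> C) (z : C) : (1 <= energy y z)%R.
Proof. unfold energy. assert (h := pow2_ge_0 (Cmod (energy_fn z (y z) (C_derive y z)))). lra. Qed.

Lemma energy_segment (D : C -> Prop) (y : C -> C) (Z0 : R) (a e : C) :
  painleve1_solution_on D y -> (forall z, D z -> (Cmod z <= Z0)%R) -> (0 <= Z0)%R ->
  (forall t, (0 <= t <= 1)%R -> D (a + RtoC t * e) /\ holo y (a + RtoC t * e)) ->
  (energy y (a + e) <= energy y a * exp (4 * (25 + 11 * Z0) * Cmod e))%R.
Proof.
  intros Hs HZ HZ0 Hseg. unfold energy.
  set (z := fun t : R => a + RtoC t * e).
  assert (he := Cmod_ge_0 e).
  assert (H := path_gronwall (fun t => energy_fn (z t) (y (z t)) (C_derive y (z t)))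
    (fun t => energy_fn_deriv e (z t) (y (z t)) (C_derive y (z t))) (Cmod e * (25 + 11 * Z0))%R).
  cbv beta in H.
  replace (z 1%R) with (a + e) in H by (unfold z; ring).
  replace (z 0%R) with a in H by (unfold z; ring).
  replace (4 * (25 + 11 * Z0) * Cmod e)%R with (4 * (Cmod e * (25 + 11 * Z0)))%R by ring.
  apply H.
  - apply Rmult_le_pos; lra.
  - intros t Ht. destruct (Hseg t Ht) as [HD Ha].
    destruct (solution_cdiff D y _ Hs HD Ha) as [H1 H2].
    apply energy_fn_path.
    + apply pathD_line.
    + exact (pathD_cdiff y a e t _ H1).
    + exact (pathD_cdiff (C_derive y) a e t _ H2).
  - intros t Ht. apply energy_fn_deriv_bound. apply HZ, (Hseg t Ht).
Qed.

(* The path goes from [w - e] over [w + i e] to [w + e] and misses the possible pole [w]. *)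
Lemma energy_detour (D : C -> Prop) (y : C -> C) (Z0 d : R) (w e : C) :
  painleve1_solution_on D y -> (forall z, D z -> (Cmod z <= Z0)%R) -> (0 <= Z0)%R ->
  (forall z, (Cmod (z - w) < d)%R -> z <> w -> D z /\ holo y z) ->
  e <> 0 -> (Cmod e < d)%R ->
  (energy y (w + e) <= energy y (w - e) * exp (4 * (25 + 11 * Z0) * (4 * Cmod e)))%R.
Proof.
  intros Hs HZ HZ0 Hd He Hed.
  assert (Hpt : forall x y' : R, (Rabs x + Rabs y' <= 1)%R -> (x <> 0 \/ y' <> 0)%R ->
    D (w + (RtoC x + RtoC y' * Ci) * e) /\ holo y (w + (RtoC x + RtoC y' * Ci) * e)).
  { intros x y' Hxy Hne. apply Hd.
    - replace (w + (RtoC x + RtoC y' * Ci) * e - w) with ((RtoC x + RtoC y' * Ci) * e) by ring.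
      rewrite Cmod_mult. assert (h := Cmod_triangle (RtoC x) (RtoC y' * Ci)).
      rewrite Cmod_mult, !Cmod_R, Cmod_Ci in h. assert (h' := Cmod_ge_0 e). nra.
    - intros h. assert (h2 : (RtoC x + RtoC y' * Ci) * e = 0).
      { replace ((RtoC x + RtoC y' * Ci) * e) with (w + (RtoC x + RtoC y' * Ci) * e - w) by ring.
        rewrite h. ring. }
      apply Cmult_integral in h2 as [h2|h2]; [|contradiction].
      assert (hr := f_equal Re h2). assert (hi := f_equal Im h2).
      unfold Re, Im in hr, hi. simpl in hr, hi. destruct Hne as [hn|hn]; apply hn; lra. }
  (* Each leg has length [sqrt 2 * Cmod e]; the cruder factor 2 gives the total [4 * Cmod e]. *)
  assert (Hc1 : (Cmod ((1 + Ci) * e) <= 2 * Cmod e)%R).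
  { rewrite Cmod_mult. assert (h := Cmod_triangle 1 Ci). rewrite Cmod_1, Cmod_Ci in h.
    assert (h' := Cmod_ge_0 e). nra. }
  assert (Hc2 : (Cmod ((1 - Ci) * e) <= 2 * Cmod e)%R).
  { rewrite Cmod_mult. assert (h := Cmod_triangle_sub 1 Ci). rewrite Cmod_1, Cmod_Ci in h.
    assert (h' := Cmod_ge_0 e). nra. }
  assert (S1 := energy_segment D y Z0 (w - e) ((1 + Ci) * e) Hs HZ HZ0).
  assert (S2 := energy_segment D y Z0 (w + Ci * e) ((1 - Ci) * e) Hs HZ HZ0).
  replace (w - e + (1 + Ci) * e) with (w + Ci * e) in S1 by ring.
  replace (w + Ci * e + (1 - Ci) * e) with (w + e) in S2 by ring.
  assert (S1' : (energy y (w + Ci * e) <= energy y (w - e) * exp (4 * (25 + 11 * Z0) * Cmod ((1 +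
    Ci) * e)))%R).
  { apply S1. intros t Ht.
    replace (w - e + RtoC t * ((1 + Ci) * e)) with (w + (RtoC (t - 1) + RtoC t * Ci) * e)
      by (rewrite RtoC_minus; ring).
    apply Hpt.
    - rewrite (Rabs_left1 (t - 1)), (Rabs_right t); lra.
    - destruct (Req_dec t 0); [left|right]; lra. }
  assert (S2' : (energy y (w + e) <= energy y (w + Ci * e) * exp (4 * (25 + 11 * Z0) * Cmod ((1 -
    Ci) * e)))%R).
  { apply S2. intros t Ht.
    replace (w + Ci * e + RtoC t * ((1 - Ci) * e)) with (w + (RtoC t + RtoC (1 - t) * Ci) * e)
      by (rewrite RtoC_minus; ring).
    apply Hpt.
    - rewrite (Rabs_right (1 - t)), (Rabs_right t); lra.
    - destruct (Req_dec t 0); [right|left]; lra. }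
  assert (hN := energy_pos y (w - e)).
  set (k := (4 * (25 + 11 * Z0))%R) in *. assert (hk : (0 <= k)%R) by (unfold k; lra).
  assert (Hexp : forall x, (x <= 2 * Cmod e)%R -> (exp (k * x) <= exp (k * (2 * Cmod e)))%R).
  { intros x Hx. apply exp_le, Rmult_le_compat_l; assumption. }
  replace (k * (4 * Cmod e))%R with (k * (2 * Cmod e) + k * (2 * Cmod e))%R by ring.
  rewrite exp_plus, <- Rmult_assoc.
  assert (hp := exp_pos (k * (2 * Cmod e))).
  eapply Rle_trans; [exact S2'|]. apply Rmult_le_compat.
  - assert (h := energy_pos y (w + Ci * e)). lra.
  - left; apply exp_pos.
  - eapply Rle_trans; [exact S1'|]. apply Rmult_le_compat_l; [lra|]. apply Hexp, Hc1.
  - apply Hexp, Hc2.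
Qed.

Lemma energy_bounded (c : C) (r Z0 : R) (y : C -> C) (c0 e : C) :
  meromorphic_on (disk c r) y -> painleve1_solution_on (disk c r) y ->
  (forall z, disk c r z -> (Cmod z <= Z0)%R) -> (0 <= Z0)%R ->
  holo y c0 -> e <> 0 -> (forall t, (0 <= t < 1)%R -> disk c r (c0 + RtoC t * e)) ->
  forall t, (0 <= t < 1)%R -> holo y (c0 + RtoC t * e) ->
    (energy y (c0 + RtoC t * e) <= energy y c0 * exp (3 * (4 * (25 + 11 * Z0) * Cmod e)))%R.
Proof.
  intros Hm Hs HZ HZ0 Hc0 He Hseg.
  set (k := (4 * (25 + 11 * Z0) * Cmod e)%R).
  assert (he : (0 < Cmod e)%R) by (apply Cmod_gt_0, He).
  assert (hk : (0 <= k)%R) by (unfold k; apply Rmult_le_pos; lra).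
  assert (HN0 := energy_pos y c0).
  set (z := fun t : R => c0 + RtoC t * e).
  (* A straight piece costs [k] per unit of [t], while a detour across an interval of length [2 * g]
     costs [4 * k * g]; the rate [3 * k] covers both. Nothing is claimed at poles. *)
  set (P := fun t => holo y (z t) -> (energy y (z t) <= energy y c0 * exp (3 * k * t))%R).
  assert (HP : forall t, (0 <= t < 1)%R -> P t).
  { intros T HT. apply (continuous_induction P T); [|lra].
    intros t Ht Hbelow. assert (Hw := Hseg t ltac:(lra)). fold (z t) in Hw.
    destruct (disk_open _ _ _ Hw) as (d1 & Hd1 & HD1).
    destruct (meromorphic_form _ _ _ Hm Hw) as (n & h & d2 & Hd2 & _ & _ & HD2).
    assert (Hdist : forall s, Cmod (z s - z t) = (Rabs (s - t) * Cmod e)%R).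
    { intros s. unfold z. replace (c0 + RtoC s * e - (c0 + RtoC t * e)) with (RtoC (s - t) * e)
        by (rewrite RtoC_minus; ring). rewrite Cmod_mult, Cmod_R. reflexivity. }
    set (d := Rmin d1 d2). assert (Hd : (0 < d)%R) by (apply Rmin_glb_lt; assumption).
    assert (hd1 : (d <= d1)%R) by apply Rmin_l. assert (hd2 : (d <= d2)%R) by apply Rmin_r.
    assert (Hde : (0 < d / Cmod e)%R) by (apply Rdiv_lt_0_compat; assumption).
    assert (Hlt : forall x, (x < d / Cmod e)%R -> (x * Cmod e < d)%R).
    { intros x Hx. apply (Rmult_lt_compat_r (Cmod e)) in Hx; [|exact he].
      replace (d / Cmod e * Cmod e)%R with d in Hx by (field; lra). exact Hx. }
    destruct (classic (holo y (z t))) as [Hat|Hnat].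
    - exists (d / Cmod e)%R. split; [exact Hde|]. intros s Hst Has.
      assert (Hball : forall x, (Cmod (x - z t) < d)%R -> disk c r x /\ holo y x).
      { intros x Hx. split; [apply HD1; lra|].
        destruct (classic (x = z t)) as [->|hx]; [exact Hat|]. apply HD2; [lra|exact hx]. }
      (* At a regular point the estimate is continued by a straight segment from an earlier
         parameter, or from 0 itself when [t = 0]. *)
      assert (Hprev : exists s', (0 <= s' <= t)%R /\ (t - s' < d / Cmod e)%R /\ P s').
      { destruct (Req_dec t 0) as [h0|h0].
        - exists 0%R. split; [lra|]. split; [lra|]. intros _. unfold z.
          replace (c0 + RtoC 0 * e) with c0 by ring. rewrite Rmult_0_r, exp_0. lra.
        - exists (Rmax 0 (t - d / Cmod e / 2)). assert (h1 := Rmax_l 0 (t - d / Cmod e / 2)).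
          assert (h2 := Rmax_r 0 (t - d / Cmod e / 2)).
          assert (h3 : (Rmax 0 (t - d / Cmod e / 2) < t)%R) by (apply Rmax_lub_lt; lra).
          split; [lra|]. split; [lra|]. apply Hbelow. lra. }
      destruct Hprev as (s' & Hs' & Hts' & HPs').
      assert (Has' : holo y (z s')).
      { apply Hball. rewrite Hdist. apply Hlt. rewrite Rabs_left1; lra. }
      specialize (HPs' Has').
      assert (Sg := energy_segment (disk c r) y Z0 (z s') (RtoC (s - s') * e) Hs HZ HZ0).
      replace (z s' + RtoC (s - s') * e) with (z s) in Sg
        by (unfold z; rewrite RtoC_minus; ring).
      eapply Rle_trans; [apply Sg|].
      + intros u Hu. apply Hball.
        replace (z s' + RtoC u * (RtoC (s - s') * e)) with (z (s' + u * (s - s'))%R)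
          by (unfold z; rewrite RtoC_plus, RtoC_mult, RtoC_minus; ring).
        rewrite Hdist. apply Hlt.
        assert (h1 : (0 <= u * (s - s') <= s - s')%R) by (split; nra).
        apply Rabs_def1; lra.
      + rewrite Cmod_mult, Cmod_R, Rabs_right by lra.
        apply Rle_trans with (energy y c0 * exp (3 * k * s') * exp (k * (s - s')))%R.
        * replace (4 * (25 + 11 * Z0) * ((s - s') * Cmod e))%R with (k * (s - s'))%R
            by (unfold k; ring).
          apply Rmult_le_compat_r; [left; apply exp_pos|exact HPs'].
        * rewrite Rmult_assoc, <- exp_plus. apply Rmult_le_compat_l; [lra|].
          apply exp_le. nra.
    - assert (ht : (0 < t)%R).
      { destruct (Req_dec t 0) as [h0|h0]; [|lra]. exfalso. apply Hnat. unfold z. rewrite h0.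
        replace (c0 + RtoC 0 * e) with c0 by ring. exact Hc0. }
      (* At a pole, [s = t + g] is reached from its mirror image [t - g]; the entry [t] in the
         minimum keeps that parameter nonnegative. *)
      exists (Rmin t (d / Cmod e)). split; [apply Rmin_glb_lt; lra|].
      assert (hm1 := Rmin_l t (d / Cmod e)). assert (hm2 := Rmin_r t (d / Cmod e)).
      intros s Hst Has.
      destruct (Req_dec s t) as [->|hne]; [contradiction|].
      set (g := (s - t)%R).
      assert (hg : (0 < g)%R) by (unfold g; lra).
      assert (hgn : RtoC g * e <> 0).
      { intros h1. apply Cmult_integral in h1 as [h1|h1]; [apply RtoC_inj in h1;
          lra|contradiction]. }
      assert (hgm : Cmod (RtoC g * e) = (g * Cmod e)%R)
        by (rewrite Cmod_mult, Cmod_R, Rabs_right by lra; reflexivity).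
      assert (hgd : (Cmod (RtoC g * e) < d)%R) by (rewrite hgm; apply Hlt; unfold g; lra).
      assert (Hpunct : forall x, (Cmod (x - z t) < d)%R -> x <> z t -> disk c r x /\ holo y x).
      { intros x Hx hx. split; [apply HD1; lra|]. apply HD2; [lra|exact hx]. }
      assert (Dt := energy_detour (disk c r) y Z0 d (z t) (RtoC g * e) Hs HZ HZ0 Hpunct hgn hgd).
      replace (z t + RtoC g * e) with (z s) in Dt by (unfold z, g; rewrite RtoC_minus; ring).
      replace (z t - RtoC g * e) with (z (t - g)%R) in Dt by (unfold z; rewrite RtoC_minus; ring).
      rewrite hgm in Dt.
      assert (HPb : P (t - g)%R) by (apply Hbelow; unfold g in *; lra).
      assert (Hab : holo y (z (t - g)%R)).
      { apply Hpunct.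
        - rewrite Hdist. replace (t - g - t)%R with (- g)%R by ring.
          rewrite Rabs_Ropp, Rabs_right by lra. rewrite <- hgm. exact hgd.
        - intros h1. apply hgn. replace (RtoC g * e) with (z t - z (t - g)%R)
            by (unfold z; rewrite RtoC_minus; ring). rewrite h1. ring. }
      specialize (HPb Hab). eapply Rle_trans; [exact Dt|].
      apply Rle_trans with (energy y c0 * exp (3 * k * (t - g)) * exp (k * (4 * g)))%R.
      + replace (4 * (25 + 11 * Z0) * (4 * (g * Cmod e)))%R with (k * (4 * g))%R
          by (unfold k; ring).
        apply Rmult_le_compat_r; [left; apply exp_pos|exact HPb].
      + rewrite Rmult_assoc, <- exp_plus. apply Rmult_le_compat_l; [lra|].
        apply exp_le. replace s with (t + g)%R by (unfold g; ring). nra. }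
  intros t Ht Ha. eapply Rle_trans; [apply (HP t Ht Ha)|].
  apply Rmult_le_compat_l; [lra|]. apply exp_le. nra.
Qed.

(** * Uniqueness and continuation *)

(** The sum of the squared moduli vanishes at 0 and its derivative is at most [2 * K] times itself,
    so it vanishes at 1. *)
Lemma pair_gronwall (f g df dg : R -> C) (K : R) :
  (forall t, (0 <= t <= 1)%R -> pathD f t (df t)) ->
  (forall t, (0 <= t <= 1)%R -> pathD g t (dg t)) ->
  (forall t, (0 <= t <= 1)%R -> (Cmod (df t) <= K * Cmod (g t))%R) ->
  (forall t, (0 <= t <= 1)%R -> (Cmod (dg t) <= K * Cmod (f t))%R) ->
  (0 <= K)%R -> f 0%R = 0 -> g 0%R = 0 -> f 1%R = 0.
Proof.
  intros Hf Hg Hdf Hdg HK Hf0 Hg0.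
  set (S := fun t => (Cmod (f t) ^ 2 + Cmod (g t) ^ 2)%R).
  assert (HS : forall t, (0 <= t <= 1)%R ->
     exists d, is_derive S t d /\ (d <= 2 * K * S t)%R).
  { intros t Ht. destruct (is_derive_Cmod2 f t _ (Hf t Ht)) as (d1 & H1 & L1).
    destruct (is_derive_Cmod2 g t _ (Hg t Ht)) as (d2 & H2 & L2).
    exists (d1 + d2)%R. split; [exact (is_derive_plus _ _ _ _ _ H1 H2)|].
    specialize (Hdf t Ht). specialize (Hdg t Ht). unfold S.
    assert (ha := Cmod_ge_0 (f t)). assert (hb := Cmod_ge_0 (g t)).
    apply (Rmult_le_compat_l (2 * Cmod (f t))) in Hdf; [|lra].
    apply (Rmult_le_compat_l (2 * Cmod (g t))) in Hdg; [|lra].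
    assert (h := pow2_ge_0 (Cmod (f t) - Cmod (g t))).
    apply (Rmult_le_compat_l K) in h; [|exact HK].
    change (d1 + d2 <= 2 * K * (Cmod (f t) ^ 2 + Cmod (g t) ^ 2))%R.
    change (d1 <= 2 * Cmod (f t) * Cmod (df t))%R in L1.
    change (d2 <= 2 * Cmod (g t) * Cmod (dg t))%R in L2. lra. }
  assert (H := gronwall S (Derive S) (2 * K)).
  assert (H1 : (S 1 <= S 0 * exp (2 * K))%R).
  { apply H.
    - intros t Ht. destruct (HS t Ht) as (d & Hd & _). apply Derive_correct. exists d. exact Hd.
    - intros t Ht. destruct (HS t Ht) as (d & Hd & Hle).
      rewrite (is_derive_unique S t d Hd). exact Hle. }
  unfold S in H1. rewrite Hf0, Hg0, Cmod_0 in H1. simpl in H1.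
  assert (h1 := Cmod_ge_0 (f 1%R)). assert (h2 := Cmod_ge_0 (g 1%R)).
  apply Cmod_eq_0. nra.
Qed.

(** The equation as a first-order system along rays from [z1]. Uniqueness asks for no more, and in
    this form [1 / u^2] can be handled by the rules for [pathD]. *)
Definition line_solution (z1 : C) (d : R) (f f1 : C -> C) : Prop :=
  forall (e : C) (t : R), (Cmod e < d)%R -> (0 <= t <= 1)%R ->
    pathD (fun s => f (z1 + RtoC s * e)) t (e * f1 (z1 + RtoC t * e)) /\
    pathD (fun s => f1 (z1 + RtoC s * e)) t
      (e * (6 * f (z1 + RtoC t * e) ^ 2 + (z1 + RtoC t * e))).

Lemma Cmod_segment (a e : C) (t d : R) : (0 <= t <= 1)%R -> (Cmod e < d)%R ->
  (Cmod (a + RtoC t * e - a) < d)%R.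
Proof.
  intros Ht He. replace (a + RtoC t * e - a) with (RtoC t * e) by ring.
  rewrite Cmod_mult, Cmod_n by lra. assert (h := Cmod_ge_0 e). nra.
Qed.

(** The difference of the nonlinear terms factors as [6 (f + g) (f - g)], so a bound for [f + g]
    turns the differences of the solutions and of their derivatives into a linear system for
    [pair_gronwall]. *)
Lemma local_uniqueness (z1 : C) (d : R) (f f1 g g1 : C -> C) : (0 < d)%R ->
  line_solution z1 d f f1 -> line_solution z1 d g g1 ->
  (exists B, forall z, (Cmod (z - z1) < d)%R -> (Cmod (f z + g z) <= B)%R) ->
  f z1 = g z1 -> f1 z1 = g1 z1 ->
  forall z, (Cmod (z - z1) < d)%R -> f z = g z.
Proof.
  intros Hd Hf Hg [B HB] E0 E1 z Hz. set (e := z - z1).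
  assert (Hpt : forall t, (0 <= t <= 1)%R -> (Cmod (z1 + RtoC t * e - z1) < d)%R).
  { intros t Ht. apply Cmod_segment; assumption. }
  assert (HB0 : (0 <= B)%R).
  { eapply Rle_trans; [apply Cmod_ge_0|apply (HB z Hz)]. }
  assert (he := Cmod_ge_0 e).
  assert (H := pair_gronwall (fun t => f (z1 + RtoC t * e) - g (z1 + RtoC t * e))
     (fun t => f1 (z1 + RtoC t * e) - g1 (z1 + RtoC t * e))
     (fun t => e * (f1 (z1 + RtoC t * e) - g1 (z1 + RtoC t * e)))
     (fun t => e * (6 * ((f (z1 + RtoC t * e) + g (z1 + RtoC t * e)) *
                         (f (z1 + RtoC t * e) - g (z1 + RtoC t * e)))))
     (Cmod e * (1 + 6 * B))%R).
  cbv beta in H. replace (z1 + RtoC 1 * e) with z in H by (unfold e; ring).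
  replace (z1 + RtoC 0 * e) with z1 in H by ring.
  replace (f z) with (f z - g z + g z) by ring. rewrite H; [ring| | | | | | |].
  - intros t Ht. destruct (Hf e t Hz Ht) as [A1 _]. destruct (Hg e t Hz Ht) as [A2 _].
    eapply pathD_eq; [exact (pathD_minus _ _ _ _ _ A1 A2)|ring].
  - intros t Ht. destruct (Hf e t Hz Ht) as [_ A1]. destruct (Hg e t Hz Ht) as [_ A2].
    eapply pathD_eq; [exact (pathD_minus _ _ _ _ _ A1 A2)|ring].
  - intros t Ht. rewrite Cmod_mult.
    assert (h := Cmod_ge_0 (f1 (z1 + RtoC t * e) - g1 (z1 + RtoC t * e))).
    apply Rmult_le_compat_r; [exact h|]. assert (0 <= Cmod e * B)%R by (apply Rmult_le_pos; lra).
    lra.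
  - intros t Ht. rewrite !Cmod_mult, Cmod_n by lra.
    set (x := Cmod (f (z1 + RtoC t * e) - g (z1 + RtoC t * e))).
    assert (hx : (0 <= x)%R) by apply Cmod_ge_0.
    assert (h := HB _ (Hpt t Ht)).
    rewrite Rmult_assoc. apply Rmult_le_compat_l; [exact he|].
    rewrite <- Rmult_assoc. apply Rmult_le_compat_r; [exact hx|]. lra.
  - apply Rmult_le_pos; lra.
  - rewrite E0. ring.
  - rewrite E1. ring.
Qed.

Lemma cdiff_line_solution (z1 : C) (d : R) (f f1 : C -> C) :
  (forall z, (Cmod (z - z1) < d)%R -> cdiff f z (f1 z) /\ cdiff f1 z (6 * f z ^ 2 + z)) ->
  line_solution z1 d f f1.
Proof.
  intros H e t He Ht. destruct (H _ (Cmod_segment z1 e t d Ht He)) as [H1 H2].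
  split; [exact (pathD_cdiff f z1 e t _ H1)|exact (pathD_cdiff f1 z1 e t _ H2)].
Qed.

Lemma disk_segment (c z1 w : C) (r t : R) : (0 <= t <= 1)%R -> disk c r z1 -> disk c r w ->
  disk c r (z1 + RtoC t * (w - z1)).
Proof.
  unfold disk. intros Ht H1 H2.
  replace (z1 + RtoC t * (w - z1) - c) with (RtoC (1 - t) * (z1 - c) + RtoC t * (w - c))
    by (rewrite RtoC_minus; ring).
  eapply Rle_lt_trans; [apply Cmod_triangle|]. rewrite !Cmod_mult, !Cmod_n by lra.
  destruct (Req_dec t 1) as [->|h]; [lra|].
  assert (h1 : ((1 - t) * Cmod (z1 - c) < (1 - t) * r)%R) by (apply Rmult_lt_compat_l; lra).
  assert (h2 : (t * Cmod (w - c) <= t * r)%R) by (apply Rmult_le_compat_l; lra). lra.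
Qed.

(* If [y = h / (z - p)^n] near [p], then [h B - A (z - p)^n] is analytic at [p] even when [y] has a
   pole there, and the identity theorem applies to it. *)
Lemma propagate (c z1 : C) (r rho : R) (y A B : C -> C) :
  meromorphic_on (disk c r) y -> disk c r z1 -> (0 < rho)%R ->
  (forall z, disk z1 rho z -> holo A z /\ holo B z) ->
  (exists d, (0 < d)%R /\ forall z, (Cmod (z - z1) < d)%R -> y z * B z = A z) ->
  forall w, disk c r w -> disk z1 rho w ->
  exists d, (0 < d)%R /\ forall z, (Cmod (z - w) < d)%R -> z <> w -> y z * B z = A z.
Proof.
  intros Hm Hz1 Hrho HAB Hinit w Hw Hwr.
  destruct (classic (w = z1)) as [->|Hne].
  { destruct Hinit as (d & Hd & H). exists d. split; [exact Hd|]. intros; apply H; assumption. }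
  set (e := w - z1).
  assert (he : (0 < Cmod e)%R).
  { apply Cmod_gt_0. intros h. apply Hne. replace w with (e + z1) by (unfold e; ring).
    rewrite h. ring. }
  set (p := fun s : R => z1 + RtoC s * e).
  assert (Hdist : forall s t, Cmod (p s - p t) = (Rabs (s - t) * Cmod e)%R).
  { intros s t. unfold p. replace (z1 + RtoC s * e - (z1 + RtoC t * e)) with (RtoC (s - t) * e)
      by (rewrite RtoC_minus; ring). rewrite Cmod_mult, Cmod_R. reflexivity. }
  (* The center is excluded because [y] has an arbitrary value at a pole. *)
  set (P := fun s => exists d, (0 < d)%R /\
     forall z, (Cmod (z - p s) < d)%R -> z <> p s -> y z * B z = A z).
  assert (HP : P 1%R).
  { apply (continuous_induction P 1); [|lra]. intros t Ht Hbelow.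
    assert (Hpt : disk c r (p t)) by (apply disk_segment; assumption).
    assert (Hpr : disk z1 rho (p t)).
    { apply disk_segment; try assumption. unfold disk. replace (z1 - z1) with (RtoC 0) by ring.
      rewrite Cmod_0. exact Hrho. }
    assert (HG : P t).
    { destruct (Req_dec t 0) as [h0|h0].
      - destruct Hinit as (d & Hd & H). exists d. split; [exact Hd|]. intros z Hz _. apply H.
        replace (p t) with z1 in Hz by (unfold p; rewrite h0; ring). exact Hz.
      - destruct (meromorphic_form _ _ _ Hm Hpt) as (n & h & d & Hd & Hh & _ & Hy).
        destruct (HAB _ Hpr) as [HA HB].
        set (F := fun z => h z * B z + (-(1)) * (A z * (z - p t) ^ n)).
        assert (HF : holo F (p t)).
        { apply holo_plus; [apply holo_mult; assumption|].
          apply holo_mult; [apply holo_const|]. apply holo_mult; [exact HA|].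
          apply holo_pow, holo_sub_id. }
        assert (HFy : forall z, (Cmod (z - p t) < d)%R -> z <> p t ->
            F z = (y z * B z - A z) * (z - p t) ^ n).
        { intros z Hz Hzp. destruct (Hy z Hz Hzp) as [_ E]. unfold F. rewrite <- E. ring. }
        destruct (identity_theorem F (p t) HF) as (d' & Hd' & HF0).
        { intros d' Hd'. set (m := Rmin d d').
          assert (Hmp : (0 < m)%R) by (apply Rmin_glb_lt; assumption).
          assert (hm1 : (m <= d)%R) by apply Rmin_l. assert (hm2 : (m <= d')%R) by apply Rmin_r.
          set (s := Rmax 0 (t - m / Cmod e / 2)).
          assert (hme : (0 < m / Cmod e)%R) by (apply Rdiv_lt_0_compat; assumption).
          assert (hs : (0 <= s < t)%R) by (split; [apply Rmax_l|apply Rmax_lub_lt; lra]).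
          assert (hs2 : (t - s < m / Cmod e)%R).
          { assert (h2 := Rmax_r 0 (t - m / Cmod e / 2)). fold s in h2. lra. }
          destruct (Hbelow s hs) as (ds & Hds & Hs).
          set (q := Cmod (p s - p t)).
          assert (hq : q = ((t - s) * Cmod e)%R).
          { unfold q. rewrite Hdist, Rabs_left1 by lra. ring. }
          assert (hq1 : (0 < q)%R) by (rewrite hq; apply Rmult_lt_0_compat; lra).
          assert (hq2 : (q < m)%R).
          { rewrite hq. apply (Rmult_lt_compat_r (Cmod e)) in hs2; [|exact he].
            replace (m / Cmod e * Cmod e)%R with m in hs2 by (field; lra). exact hs2. }
          (* The identity is known only off [p s], so the zero of [F] is sought at a shifted point:
             [eta < ds] stays where the identity holds, [eta < q] keeps away from [p t], and
             [eta + q < m] stays close to it. *)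
          set (eta := (Rmin ds (Rmin q (m - q)) / 2)%R).
          assert (e1 := Rmin_l ds (Rmin q (m - q))). assert (e2 := Rmin_r ds (Rmin q (m - q))).
          assert (e3 := Rmin_l q (m - q)). assert (e4 := Rmin_r q (m - q)).
          assert (e5 : (0 < Rmin ds (Rmin q (m - q)))%R) by (repeat apply Rmin_glb_lt; lra).
          set (z := p s + RtoC eta).
          assert (hz1 : Cmod (z - p s) = eta).
          { unfold z. replace (p s + RtoC eta - p s) with (RtoC eta) by ring.
            apply Cmod_n. unfold eta. lra. }
          assert (hz2 : (Cmod (z - p t) <= eta + q)%R).
          { assert (h2 := Cmod_sub_triangle z (p s) (p t)). rewrite hz1 in h2. exact h2. }
          assert (hz3 : (q <= eta + Cmod (z - p t))%R).
          { assert (h2 := Cmod_sub_triangle (p s) z (p t)).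
            rewrite (Cmod_sub_sym (p s) z), hz1 in h2. exact h2. }
          exists z. split; [unfold eta in *; lra|].
          rewrite HFy.
          - rewrite Hs; [ring|rewrite hz1; unfold eta; lra|].
            intros h2. rewrite h2 in hz1. replace (p s - p s) with (RtoC 0) in hz1 by ring.
            rewrite Cmod_0 in hz1. unfold eta in hz1. lra.
          - unfold eta in *; lra.
          - intros h2. rewrite h2 in hz3. replace (p t - p t) with (RtoC 0) in hz3 by ring.
            rewrite Cmod_0 in hz3. unfold eta in hz3. lra. }
        exists (Rmin d d'). split; [apply Rmin_glb_lt; assumption|].
        assert (h1 := Rmin_l d d'). assert (h2 := Rmin_r d d').
        intros z Hz Hzp. specialize (HF0 z ltac:(lra)). rewrite HFy in HF0; [|lra|exact Hzp].
        apply Cmult_integral in HF0 as [E|E].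
        + replace (y z * B z) with (y z * B z - A z + A z) by ring. rewrite E. ring.
        + exfalso. revert E. apply Cpow_nz. intros E. apply Hzp.
          replace z with (z - p t + p t) by ring. rewrite E. ring. }
    destruct HG as (d & Hd & H). exists (d / Cmod e)%R.
    split; [apply Rdiv_lt_0_compat; assumption|]. intros s Hs.
    destruct (Req_dec s t) as [->|hst]; [exists d; split; assumption|].
    set (q := Cmod (p s - p t)).
    assert (hq : q = ((s - t) * Cmod e)%R).
    { unfold q. rewrite Hdist, Rabs_right by lra. ring. }
    assert (hq1 : (0 < q)%R) by (rewrite hq; apply Rmult_lt_0_compat; lra).
    assert (hq2 : (q < d)%R).
    { rewrite hq. assert (hs2 : (s - t < d / Cmod e)%R) by lra.
      apply (Rmult_lt_compat_r (Cmod e)) in hs2; [|exact he].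
      replace (d / Cmod e * Cmod e)%R with d in hs2 by (field; lra). exact hs2. }
    (* This disk about [p s] lies in the punctured disk about [p t]. *)
    exists (Rmin (d - q) q). split; [apply Rmin_glb_lt; lra|].
    assert (h1 := Rmin_l (d - q) q). assert (h2 := Rmin_r (d - q) q).
    intros z Hz _. apply H.
    - assert (h3 := Cmod_sub_triangle z (p s) (p t)). fold q in h3. lra.
    - intros ->. rewrite Cmod_sub_sym in Hz. fold q in Hz. lra. }
  unfold P in HP. replace (p 1%R) with w in HP by (unfold p, e; ring). exact HP.
Qed.

Lemma zero_at_center (F : C -> C) (w : C) (d : R) : holo F w -> (0 < d)%R ->
  (forall z, (Cmod (z - w) < d)%R -> z <> w -> F z = 0) -> F w = 0.
Proof.
  intros HF Hd H. destruct (identity_theorem F w HF) as (d' & Hd' & H0).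
  - intros d' Hd'. set (m := (Rmin d d' / 2)%R).
    assert (h1 := Rmin_l d d'). assert (h2 := Rmin_r d d').
    assert (h3 : (0 < Rmin d d')%R) by (apply Rmin_glb_lt; assumption).
    exists (w + RtoC m).
    assert (E : Cmod (w + RtoC m - w) = m).
    { replace (w + RtoC m - w) with (RtoC m) by ring. apply Cmod_n. unfold m; lra. }
    split; [rewrite E; unfold m; lra|]. apply H; [rewrite E; unfold m; lra|].
    intros h. rewrite h in E. replace (w - w) with (RtoC 0) in E by ring. rewrite Cmod_0 in E.
    unfold m in E. lra.
  - apply H0. replace (w - w) with (RtoC 0) by ring. rewrite Cmod_0. exact Hd'.
Qed.

(** If [w] were a pole, [h * B = A * (z - w) ^ n] would extend to [w] and force [h w = 0]. So [y] is
    analytic at [w] and the identity passes to the center. *)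
Lemma quotient_value (c w : C) (r d : R) (y A B : C -> C) :
  meromorphic_on (disk c r) y -> disk c r w -> holo A w -> holo B w -> B w <> 0 -> (0 < d)%R ->
  (forall z, (Cmod (z - w) < d)%R -> z <> w -> y z * B z = A z) ->
  y w = A w / B w.
Proof.
  intros Hm Hw HA HB HBw Hd H.
  destruct (meromorphic_form _ _ _ Hm Hw) as (n & h & d' & Hd' & Hh & [Hy|[Hn Hhw]] & Hform).
  - assert (E : y w * B w + (-(1)) * A w = 0).
    { apply (zero_at_center (fun z => y z * B z + (-(1)) * A z) w d); [|exact Hd|].
      - apply holo_plus; [apply holo_mult; assumption|].
        apply holo_mult; [apply holo_const|exact HA].
      - intros z Hz Hzw. rewrite H by assumption. ring. }
    replace (y w) with ((y w * B w + (-(1)) * A w + A w) / B w) by (field; exact HBw).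
    rewrite E. f_equal. ring.
  - exfalso. apply Hhw.
    assert (E : h w * B w + (-(1)) * (A w * (w - w) ^ n) = 0).
    { apply (zero_at_center (fun z => h z * B z + (-(1)) * (A z * (z - w) ^ n)) w (Rmin d d')).
      - apply holo_plus; [apply holo_mult; assumption|]. apply holo_mult; [apply holo_const|].
        apply holo_mult; [exact HA|apply holo_pow, holo_sub_id].
      - apply Rmin_glb_lt; assumption.
      - intros z Hz Hzw. assert (h1 := Rmin_l d d'). assert (h2 := Rmin_r d d').
        destruct (Hform z ltac:(lra) Hzw) as [_ <-].
        rewrite <- (H z) by (lra || assumption). ring. }
    replace (w - w) with (RtoC 0) in E by ring. destruct n as [|n]; [contradiction|].
    replace (RtoC 0 ^ S n) with (RtoC 0) in E by (simpl; ring).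
    replace (h w) with ((h w * B w + - (1) * (A w * 0)) / B w) by (field; exact HBw).
    rewrite E. field. exact HBw.
Qed.

(** * Coordinates at a pole *)

Lemma complex_sqrt (w : C) : exists u : C, u * u = w.
Proof.
  destruct w as [a b]. set (m := Cmod (a, b)).
  assert (Hm : (m * m = a * a + b * b)%R).
  { assert (h := Cmod2_alt (a, b)). unfold Re, Im in h. simpl in h. unfold m. lra. }
  assert (hm : (0 <= m)%R) by apply Cmod_ge_0.
  assert (h1 : (Rabs a <= m)%R) by apply (re_le_Cmod (a, b)).
  assert (h2 : (- m <= a <= m)%R) by (apply Rabs_le_between; exact h1).
  set (x := sqrt ((m + a) / 2)). set (t := sqrt ((m - a) / 2)).
  assert (hx : (x * x = (m + a) / 2)%R) by (apply sqrt_sqrt; lra).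
  assert (ht : (t * t = (m - a) / 2)%R) by (apply sqrt_sqrt; lra).
  assert (hx0 : (0 <= x)%R) by apply sqrt_pos. assert (ht0 : (0 <= t)%R) by apply sqrt_pos.
  assert (hxt : (x * t = Rabs b / 2)%R).
  { apply Rsqr_inj; [apply Rmult_le_pos; assumption|assert (h := Rabs_pos b); lra|].
    unfold Rsqr. replace (x * t * (x * t))%R with ((x * x) * (t * t))%R by ring.
    rewrite hx, ht. replace (Rabs b / 2 * (Rabs b / 2))%R with (Rabs b * Rabs b / 4)%R by field.
    rewrite <- Rabs_mult, Rabs_right by (apply Rle_ge, Rle_0_sqr). nra. }
  destruct (Rle_dec 0 b) as [hb|hb].
  - rewrite Rabs_right in hxt by lra. exists (x, t). unfold Cmult. simpl. f_equal; lra.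
  - rewrite Rabs_left in hxt by lra. exists (x, (- t)%R). unfold Cmult. simpl. f_equal; lra.
Qed.

(** The first three terms are those that the equation forces at a double pole when [y = 1 / u^2];
    [v] multiplies the first power of [u] whose coefficient stays free. *)
Definition pole_momentum (z u v : C) : C := - (2 / u ^ 3) - z * u / 2 - u ^ 2 / 2 + v * u ^ 3.

(* Painlevé's coordinates at a double pole, [y = 1 / u^2] with [v] in place of [y']. The sign
   of the square root [u] is the one for which [u^3 y'] is close to [- 2] rather than to [2]. *)
Lemma pole_coordinates (M Z0 : R) : exists R1, (1 <= R1)%R /\ forall z Y P : C,
  (Cmod z <= Z0)%R -> (Cmod (energy_fn z Y P) <= M)%R -> (1 < Cmod Y)%R ->
  exists u v : C, u <> 0 /\ Y * (u * u) = 1 /\ (Cmod u <= R1)%R /\ (Cmod v <= R1)%R /\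
    P = pole_momentum z u v.
Proof.
  set (W := (5 + 2 * Z0 + M)%R). set (X0 := (M + W + 1)%R).
  (* The absolute value gives [1 <= R1] at once; that [M] and [Z0] are nonnegative is known only
     after a point is given. *)
  exists (1 + Rabs (X0 + (2 * Z0 + X0) * Z0))%R.
  split; [assert (h := Rabs_pos (X0 + (2 * Z0 + X0) * Z0)); lra|].
  intros z Y P Hz HV HY.
  assert (hz := Cmod_ge_0 z). assert (hV := Cmod_ge_0 (energy_fn z Y P)).
  assert (HY0 : Y <> 0) by (apply Cmod_gt_0; lra).
  destruct (complex_sqrt (/ Y)) as [u0 Hu0].
  (* For the two roots the quantities are [a - 2] and [- (a + 2)]; as [a + 2] and [a - 2] differ by
     4, one of them has modulus at least 2. *)
  assert (Hch : exists u, u * u = / Y /\ (2 <= Cmod (P * u ^ 3 + u ^ 5 / 2 - 2))%R).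
  { destruct (Rle_lt_dec 2 (Cmod (P * u0 ^ 3 + u0 ^ 5 / 2 - 2))) as [h|h].
    - exists u0. split; assumption.
    - exists (- u0). split; [rewrite <- Hu0; ring|].
      set (a := P * u0 ^ 3 + u0 ^ 5 / 2) in *.
      replace (P * (- u0) ^ 3 + (- u0) ^ 5 / 2 - 2) with (- (a + 2)) by (unfold a; field).
      rewrite Cmod_opp. assert (h2 := Cmod_triangle_sub (a + 2) (a - 2)).
      replace (a + 2 - (a - 2)) with (RtoC 4) in h2 by ring. rewrite Cmod_n in h2 by lra. lra. }
  destruct Hch as (u & Hu & HA).
  assert (Hu00 : u <> 0).
  { intros h. rewrite h, Cmult_0_l in Hu. apply (f_equal (fun x => x * Y)) in Hu.
    rewrite Cmult_0_l, Cinv_l in Hu by exact HY0. apply RtoC_inj in Hu. lra. }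
  set (A := P * u ^ 3 + u ^ 5 / 2) in *.
  assert (HA2 : A - 2 <> 0) by (apply Cmod_gt_0; lra).
  set (w := P * u ^ 3). set (V := energy_fn z Y P) in *.
  set (q := inv_one_plus_sq Y).
  set (X := V + w * q / u + u ^ 4 / 4).
  assert (HYu : Y = / (u * u)) by (rewrite Hu; field; exact HY0).
  assert (EV : V * u ^ 6 = w * w + w * u ^ 5 * (1 - q) - 4 - 2 * z * u ^ 4).
  { unfold V, energy_fn. fold q.
    assert (Eq : Cconj Y * q = u * u * (1 - q)).
    { unfold q, inv_one_plus_sq. rewrite Hu. field. split; [apply one_plus_sq_neq|exact HY0]. }
    replace (P * Cconj Y * q) with (P * (Cconj Y * q)) by ring. rewrite Eq, HYu.
    unfold w. field. exact Hu00. }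
  (* The energy relation after completing the square in [w]. Since [A - 2] is bounded away from 0,
     the other factor [A + 2] is of order [u ^ 4]. *)
  assert (EA : (A + 2) * (A - 2) = u ^ 4 * (2 * z + X * u ^ 2)).
  { replace (u ^ 4 * (2 * z + X * u ^ 2)) with
      (2 * z * u ^ 4 + V * u ^ 6 + w * q * u ^ 5 + u ^ 10 / 4) by (unfold X; field; exact Hu00).
    rewrite EV. unfold A. fold w. field. }
  set (v := (w + 2 + z * u ^ 4 / 2 + u ^ 5 / 2) / u ^ 6).
  (* The term [z * u ^ 4 / 2] in [v] cancels the order [u ^ 4] of [A + 2], so that no negative power
     of [u] survives the division by [u ^ 6]. *)
  assert (Hv : v * (A - 2) = X + u ^ 2 * (2 * z + X * u ^ 2) * z / (2 * (A - 2))).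
  { assert (E1 : A + 2 = u ^ 4 * (2 * z + X * u ^ 2) / (A - 2)) by (rewrite <- EA; field; exact
      HA2).
    assert (E2 : v = (A + 2 + z * u ^ 4 / 2) / u ^ 6) by (unfold v, A; fold w; field; exact Hu00).
    assert (E3 : v * (A - 2) = ((A + 2) * (A - 2) + (A + 2) * z * u ^ 4 / 2 - 2 * z * u ^ 4) / u ^
      6)
      by (rewrite E2; field; exact Hu00).
    rewrite E3, EA, E1. field. split; [exact HA2|exact Hu00]. }
  exists u, v.
  assert (hu : (Cmod u * Cmod u < 1)%R).
  { rewrite <- Cmod_mult, Hu, Cmod_inv by exact HY0. rewrite <- Rinv_1.
    apply Rinv_lt_contravar; lra. }
  assert (hu0 := Cmod_ge_0 u). assert (hu1 : (Cmod u <= 1)%R) by nra.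
  assert (hpow : forall n, (0 <= Cmod (u ^ n) <= 1)%R).
  { intros n. split; [apply Cmod_ge_0|]. rewrite Cmod_pow. rewrite <- (pow1 n).
    apply pow_incr. lra. }
  assert (hq1 : (Cmod (1 - q) <= 1)%R).
  { replace (1 - q) with (RtoC (Cmod Y ^ 2) * q).
    - rewrite Cmod_mult, Cmod_n by apply pow2_ge_0. unfold q. rewrite Cmod_inv_one_plus_sq.
      assert (h := pow2_ge_0 (Cmod Y)).
      apply (Rmult_le_reg_r (1 + Cmod Y ^ 2)); [lra|].
      replace (Cmod Y ^ 2 * / (1 + Cmod Y ^ 2) * (1 + Cmod Y ^ 2))%R with (Cmod Y ^ 2)%R
        by (field; lra). lra.
    - rewrite Cmod2_conj. unfold q, inv_one_plus_sq. field. apply one_plus_sq_neq. }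
  assert (hq2 : (Cmod (q / u) <= 1)%R).
  { rewrite Cmod_div by exact Hu00. unfold q. rewrite Cmod_inv_one_plus_sq.
    assert (hup : (0 < Cmod u)%R) by (apply Cmod_gt_0, Hu00).
    assert (hYu : (Cmod Y * (Cmod u * Cmod u) = 1)%R).
    { rewrite <- !Cmod_mult, Hu. replace (Y * / Y) with (RtoC 1) by (field; exact HY0).
      apply Cmod_1. }
    assert (hYu1 : (1 <= Cmod Y * Cmod u)%R) by nra.
    assert (h := pow2_ge_0 (Cmod Y)).
    apply (Rmult_le_reg_r ((1 + Cmod Y ^ 2) * Cmod u)); [apply Rmult_lt_0_compat; lra|].
    replace (/ (1 + Cmod Y ^ 2) / Cmod u * ((1 + Cmod Y ^ 2) * Cmod u))%R with 1%R
      by (field; lra). nra. }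
  (* The energy relation bounds the square of [Cmod w] by a constant plus [Cmod w]. *)
  assert (hw : (Cmod w <= W)%R).
  { assert (hw0 := Cmod_ge_0 w).
    assert (hww : (Cmod w * Cmod w <= M + 4 + 2 * Z0 + Cmod w)%R).
    { rewrite <- Cmod_mult.
      replace (w * w) with (V * u ^ 6 - w * u ^ 5 * (1 - q) + 4 + 2 * z * u ^ 4) by (rewrite EV;
        ring).
      eapply Rle_trans; [apply Cmod_triangle|].
      assert (t1 := Cmod_triangle (V * u ^ 6 - w * u ^ 5 * (1 - q)) 4).
      assert (t2 := Cmod_triangle_sub (V * u ^ 6) (w * u ^ 5 * (1 - q))).
      rewrite Cmod_n in t1 by lra. rewrite !Cmod_mult in t2.
      rewrite !Cmod_mult, (Cmod_n 2) by lra.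
      assert (t3 : (Cmod V * Cmod (u ^ 6) <= M * 1)%R)
        by (apply Rmult_le_compat; try apply hpow; assumption).
      assert (t4 : (Cmod w * Cmod (u ^ 5) * Cmod (1 - q) <= Cmod w * 1 * 1)%R).
      { apply Rmult_le_compat; [apply Rmult_le_pos; [exact hw0|apply hpow]|apply Cmod_ge_0| |exact
          hq1].
        apply Rmult_le_compat_l; [exact hw0|apply hpow]. }
      assert (t5 : (2 * Cmod z * Cmod (u ^ 4) <= 2 * Z0 * 1)%R)
        by (apply Rmult_le_compat; try apply hpow; lra).
      lra. }
    unfold W. nra. }
  assert (hX : (Cmod X <= X0)%R).
  { unfold X, X0. eapply Rle_trans; [apply Cmod_triangle|]. apply Rplus_le_compat.
    - eapply Rle_trans; [apply Cmod_triangle|]. apply Rplus_le_compat; [exact HV|].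
      replace (w * q / u) with (w * (q / u)) by (field; exact Hu00). rewrite Cmod_mult.
      apply Rle_trans with (W * 1)%R; [|lra].
      apply Rmult_le_compat; try apply Cmod_ge_0; assumption.
    - rewrite Cmod_div, Cmod_n by (lra || (apply RtoC_neq; lra)).
      assert (h := hpow 4%nat). lra. }
  assert (hX0 := Cmod_ge_0 X).
  split; [exact Hu00|]. split; [rewrite Hu; field; exact HY0|].
  split; [assert (h := Rabs_pos (X0 + (2 * Z0 + X0) * Z0)); lra|].
  split; [|unfold pole_momentum, v, w; field; exact Hu00].
  assert (hb : (Cmod (v * (A - 2)) <= X0 + (2 * Z0 + X0) * Z0)%R).
  { rewrite Hv. eapply Rle_trans; [apply Cmod_triangle|]. apply Rplus_le_compat; [exact hX|].
    rewrite Cmod_div by (apply Cmult_neq_0; [apply RtoC_neq; lra|exact HA2]).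
    rewrite !Cmod_mult, (Cmod_n 2) by lra.
    assert (h1 : (Cmod (2 * z + X * u ^ 2) <= 2 * Z0 + X0)%R).
    { eapply Rle_trans; [apply Cmod_triangle|]. rewrite !Cmod_mult, Cmod_n by lra.
      apply Rplus_le_compat; [lra|]. apply Rle_trans with (X0 * 1)%R; [|lra].
      apply Rmult_le_compat; try apply hpow; assumption. }
    assert (h0 := Cmod_ge_0 (2 * z + X * u ^ 2)).
    set (N := Cmod (2 * z + X * u ^ 2)) in *.
    assert (h2 : (Cmod (u ^ 2) * N * Cmod z <= 1 * (2 * Z0 + X0) * Z0)%R).
    { apply Rmult_le_compat; [apply Rmult_le_pos; [apply hpow|exact h0]|exact hz| |exact Hz].
      apply Rmult_le_compat; [apply hpow|exact h0|apply hpow|exact h1]. }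
    apply Rle_trans with (Cmod (u ^ 2) * N * Cmod z)%R; [|lra].
    assert (h3 : (0 <= Cmod (u ^ 2) * N * Cmod z)%R)
      by (apply Rmult_le_pos; [apply Rmult_le_pos; [apply hpow|exact h0]|exact hz]).
    unfold Rdiv. rewrite <- (Rmult_1_r (Cmod (u ^ 2) * N * Cmod z)) at 2.
    apply Rmult_le_compat_l; [exact h3|]. rewrite <- Rinv_1. apply Rinv_le_contravar; lra. }
  rewrite Cmod_mult in hb. assert (hv := Cmod_ge_0 v).
  assert (h := Rle_abs (X0 + (2 * Z0 + X0) * Z0)). nra.
Qed.

(* The right-hand sides of the equations [y'' = 6 y^2 + z] and of the system for [(u, v)]; the
   latter is [u' = 1 + u^3 q], [v' = q (z / 2 + u - 3 u^2 v)] with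
   [q = z u / 4 + u^2 / 4 - u^3 v / 2]. *)
Definition regular_rhs : expr := EAdd (EMul (ECst 6) (EMul EU EU)) EZ.

Definition pole_aux : expr :=
  EAdd (EMul (ECst (/ 4)) (EMul EZ EU))
    (EAdd (EMul (ECst (/ 4)) (EMul EU EU))
       (EMul (ECst (- / 2)) (EMul EV (EMul EU (EMul EU EU))))).

Definition pole_rhs_u : expr := EAdd (ECst 1) (EMul (EMul EU (EMul EU EU)) pole_aux).

Definition pole_rhs_v : expr :=
  EMul pole_aux (EAdd (EMul (ECst (/ 2)) EZ)
                   (EAdd EU (EMul (ECst (- (3))) (EMul EV (EMul EU EU))))).

(** The change of coordinates read backwards: wherever [u] does not vanish, the polynomial system
    for [(u, v)] is Painlevé's equation for [1 / u^2]. *)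
Lemma pole_line_solution (z1 : C) (d : R) (u v : C -> C) :
  (forall z, (Cmod (z - z1) < d)%R -> u z <> 0 /\
     cdiff u z (eval z (u z) (v z) pole_rhs_u) /\ cdiff v z (eval z (u z) (v z) pole_rhs_v)) ->
  line_solution z1 d (fun z => / (u z * u z)) (fun z => pole_momentum z (u z) (v z)).
Proof.
  intros H e t He Ht. destruct (H _ (Cmod_segment z1 e t d Ht He)) as (Hu0 & H1 & H2).
  set (zz := fun s : R => z1 + RtoC s * e).
  set (uu := fun s : R => u (zz s)). set (vv := fun s : R => v (zz s)).
  assert (Du : pathD uu t (e * eval (zz t) (uu t) (vv t) pole_rhs_u))
    by exact (pathD_cdiff u z1 e t _ H1).
  assert (Dv : pathD vv t (e * eval (zz t) (uu t) (vv t) pole_rhs_v))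
    by exact (pathD_cdiff v z1 e t _ H2).
  assert (Dz : pathD zz t e) by apply pathD_line.
  change (uu t <> 0) in Hu0.
  change (pathD (fun s => / (uu s * uu s)) t (e * pole_momentum (zz t) (uu t) (vv t)) /\
    pathD (fun s => pole_momentum (zz s) (uu s) (vv s)) t
      (e * (6 * (/ (uu t * uu t)) ^ 2 + zz t))).
  clearbody uu vv zz.
  assert (Duu := pathD_mult _ _ _ _ _ Du Du).
  assert (Huu : uu t * uu t <> 0) by (apply Cmult_neq_0; exact Hu0).
  split.
  - eapply pathD_eq; [exact (pathD_inv _ _ _ Duu Huu)|].
    unfold pole_momentum, pole_rhs_u, pole_aux. cbn [eval]. field. exact Hu0.
  - assert (Du3 := pathD_mult _ _ _ _ _ Du Duu).
    assert (Hu3 : uu t * (uu t * uu t) <> 0) by (apply Cmult_neq_0; assumption).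
    assert (D1 := pathD_mult _ _ _ _ _ (pathD_const (- (2)) t) (pathD_inv _ _ _ Du3 Hu3)).
    assert (D2 := pathD_mult _ _ _ _ _ (pathD_const (/ 2) t) (pathD_mult _ _ _ _ _ Dz Du)).
    assert (D3 := pathD_mult _ _ _ _ _ (pathD_const (/ 2) t) Duu).
    assert (D4 := pathD_mult _ _ _ _ _ Dv Du3).
    assert (D := pathD_plus _ _ _ _ _ (pathD_minus _ _ _ _ _ (pathD_minus _ _ _ _ _ D1 D2) D3) D4).
    replace (fun s : R => pole_momentum (zz s) (uu s) (vv s)) with
      (fun s : R => - (2) * / (uu s * (uu s * uu s)) - / 2 * (zz s * uu s) - / 2 * (uu s * uu s)
         + vv s * (uu s * (uu s * uu s))).
    + eapply pathD_eq; [exact D|].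
      unfold pole_rhs_u, pole_rhs_v, pole_aux. cbn [eval]. field. exact Hu0.
    + apply functional_extensionality. intros s. unfold pole_momentum.
      replace (uu s ^ 3) with (uu s * (uu s * uu s)) by ring. unfold Cdiv. ring.
Qed.

(** * Local continuation with a uniform radius *)

Lemma line_solution_shrink (z1 : C) (d d' : R) (f f1 : C -> C) :
  (d' <= d)%R -> line_solution z1 d f f1 -> line_solution z1 d' f f1.
Proof. intros Hd H e t He Ht. apply H; [lra|exact Ht]. Qed.

(** Continuity at [z1] bounds both solutions on a small disk, which supplies the bound required by
    [local_uniqueness]. *)
Lemma solution_agrees (c z1 : C) (r d : R) (y g g1 : C -> C) :
  painleve1_solution_on (disk c r) y -> disk c r z1 -> holo y z1 ->
  (0 < d)%R -> line_solution z1 d g g1 -> holo g z1 ->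
  g z1 = y z1 -> g1 z1 = C_derive y z1 ->
  exists d', (0 < d')%R /\ forall z, (Cmod (z - z1) < d')%R -> y z = g z.
Proof.
  intros Hs Hz1 Ha Hd Hg Hag E0 E1.
  destruct (disk_open _ _ _ Hz1) as (d1 & Hd1 & HD).
  destruct (holo_open y z1 Ha) as (d2 & Hd2 & HA).
  destruct (holo_continuous y z1 Ha 1 Rlt_0_1) as (d3 & Hd3 & Hc3).
  destruct (holo_continuous g z1 Hag 1 Rlt_0_1) as (d4 & Hd4 & Hc4).
  set (d' := Rmin (Rmin d d1) (Rmin d2 (Rmin d3 d4))).
  assert (Hd' : (0 < d')%R) by (repeat apply Rmin_glb_lt; assumption).
  assert (Hle : (d' <= d /\ d' <= d1 /\ d' <= d2 /\ d' <= d3 /\ d' <= d4)%R).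
  { assert (h1 := Rmin_l (Rmin d d1) (Rmin d2 (Rmin d3 d4))).
    assert (h2 := Rmin_r (Rmin d d1) (Rmin d2 (Rmin d3 d4))).
    assert (h3 := Rmin_l d d1). assert (h4 := Rmin_r d d1).
    assert (h5 := Rmin_l d2 (Rmin d3 d4)). assert (h6 := Rmin_r d2 (Rmin d3 d4)).
    assert (h7 := Rmin_l d3 d4). assert (h8 := Rmin_r d3 d4). unfold d'. lra. }
  exists d'. split; [exact Hd'|].
  apply (local_uniqueness z1 d' y (C_derive y) g g1 Hd').
  - apply cdiff_line_solution. intros z Hz.
    apply (solution_cdiff (disk c r)); [exact Hs|apply HD; lra|apply HA; lra].
  - apply (line_solution_shrink z1 d); [lra|exact Hg].
  - exists (Cmod (y z1) + 1 + (Cmod (g z1) + 1))%R. intros z Hz.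
    specialize (Hc3 z ltac:(lra)). specialize (Hc4 z ltac:(lra)).
    assert (h1 := Cmod_le_sub (y z) (y z1)). assert (h2 := Cmod_le_sub (g z) (g z1)).
    eapply Rle_trans; [apply Cmod_triangle|]. lra.
  - symmetry; exact E0.
  - symmetry; exact E1.
Qed.

(** The radius is fixed before the disk, the solution and the point. In the second alternative the
    relation to [y] is multiplied out because [u] may vanish elsewhere in the large disk. *)
Lemma local_continuation (M Z0 : R) : (0 <= Z0)%R -> exists rho, (0 < rho)%R /\
  forall (c : C) (r : R) (y : C -> C) (z1 : C),
    painleve1_solution_on (disk c r) y -> disk c r z1 -> holo y z1 ->
    (Cmod z1 <= Z0)%R -> (energy y z1 <= M)%R ->
    (exists g, (forall z, disk z1 rho z -> holo g z) /\
       exists d, (0 < d)%R /\ forall z, (Cmod (z - z1) < d)%R -> y z = g z) \/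
    (exists u, (forall z, disk z1 rho z -> holo u z /\ (u z = 0 -> cdiff u z 1)) /\
       exists d, (0 < d)%R /\ forall z, (Cmod (z - z1) < d)%R -> y z * (u z * u z) = 1).
Proof.
  intros HZ0. destruct (pole_coordinates M Z0) as (R1 & HR1 & Hcoord).
  set (M' := Rmax M 0). assert (hM' : (0 <= M')%R) by apply Rmax_r.
  assert (hMM : (M <= M')%R) by apply Rmax_l.
  (* For [Cmod Y <= 1] the momentum bound reads [Cmod P ^ 2 <= M' + Cmod P + 4 + 2 * Z0], which
     implies [Cmod P <= R2]. *)
  set (R2 := (M' + 5 + 2 * Z0)%R).
  destruct (polynomial_ode EV regular_rhs R2) as (rho1 & Hrho1 & Hreg); [unfold R2; lra|].
  destruct (polynomial_ode pole_rhs_u pole_rhs_v (R1 + Z0)) as (rho2 & Hrho2 & Hpole); [lra|].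
  set (rho := Rmin rho1 rho2).
  assert (hr1 : (rho <= rho1)%R) by apply Rmin_l. assert (hr2 : (rho <= rho2)%R) by apply Rmin_r.
  exists rho. split; [apply Rmin_glb_lt; assumption|].
  intros c r y z1 Hs Hz1 Ha HzZ HE.
  set (P := C_derive y z1). set (Y := y z1).
  assert (HV : (Cmod (energy_fn z1 Y P) <= M)%R).
  { unfold energy in HE. fold P Y in HE. set (v := Cmod (energy_fn z1 Y P)) in *.
    assert (h := pow2_ge_0 (v - 1)). assert (h2 := pow2_ge_0 v). lra. }
  assert (h0 : forall rr, (0 < rr)%R -> (Cmod (z1 - z1) < rr)%R).
  { intros rr Hrr. replace (z1 - z1) with (RtoC 0) by ring. rewrite Cmod_0. exact Hrr. }
  destruct (Rle_lt_dec (Cmod Y) 1) as [HY|HY].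
  - left.
    assert (HP : (Cmod P <= R2)%R).
    { assert (h := energy_fn_momentum_bound z1 Y P).
      assert (hY := Cmod_ge_0 Y). assert (hP := Cmod_ge_0 P). assert (hz := Cmod_ge_0 z1).
      assert (hy2 := pow2_ge_0 (Cmod Y)).
      assert (h1 : (Cmod Y * / (1 + Cmod Y ^ 2) <= 1)%R).
      { apply (Rmult_le_reg_r (1 + Cmod Y ^ 2)); [lra|].
        rewrite Rmult_assoc, Rinv_l by lra. nra. }
      assert (h2 : (Cmod P * (Cmod Y * / (1 + Cmod Y ^ 2)) <= Cmod P * 1)%R)
        by (apply Rmult_le_compat_l; assumption).
      assert (h3 : (Cmod Y ^ 3 <= 1)%R).
      { rewrite <- (pow1 3). apply pow_incr. lra. }
      assert (h4 : (2 * Cmod z1 * Cmod Y <= 2 * Z0 * 1)%R) by (apply Rmult_le_compat; lra).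
      assert (h5 : (Cmod P ^ 2 <= M' + Cmod P + 4 + 2 * Z0)%R) by lra.
      unfold R2. simpl in h5. nra. }
    destruct (Hreg z1 Y P) as (g & g1 & Eg & Eg1 & Hg); [unfold R2; lra|unfold R2; lra|exact HP|].
    exists g. split; [intros z Hz; apply Hg; unfold disk in Hz; lra|].
    apply (solution_agrees c z1 r rho1 y g g1); auto.
    + apply cdiff_line_solution. intros z Hz. destruct (Hg z Hz) as (_ & _ & H1 & H2).
      split; [exact H1|]. unfold regular_rhs in H2. cbn [eval] in H2.
      replace (6 * g z ^ 2 + z) with (6 * (g z * g z) + z) by ring. exact H2.
    + apply (Hg z1). apply h0, Hrho1.
  - right. destruct (Hcoord z1 Y P HzZ HV HY) as (u1 & v1 & Hu1 & HYu & Hub & Hvb & HPu).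
    destruct (Hpole z1 u1 v1) as (u & v & Eu & Ev & Huv); [lra|lra|lra|].
    exists u. split.
    { intros z Hz. unfold disk in Hz. destruct (Huv z ltac:(lra)) as (H1 & _ & H2 & _).
      split; [exact H1|]. intros Hu0. rewrite Hu0 in H2.
      replace (eval z 0 (v z) pole_rhs_u) with (RtoC 1) in H2; [exact H2|].
      unfold pole_rhs_u. cbn [eval]. ring. }
    assert (Hu1' : u z1 <> 0) by (rewrite Eu; exact Hu1).
    destruct (Huv z1 (h0 rho2 Hrho2)) as (Hau & _).
    destruct (holo_neq_near u z1 Hau Hu1') as (d & Hd & Hne).
    assert (Hline : line_solution z1 (Rmin d rho2) (fun z => / (u z * u z))
                      (fun z => pole_momentum z (u z) (v z))).
    { apply pole_line_solution. intros z Hz.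
      assert (h1 := Rmin_l d rho2). assert (h2 := Rmin_r d rho2).
      split; [apply Hne; lra|]. destruct (Huv z ltac:(lra)) as (_ & _ & H1 & H2).
      split; assumption. }
    destruct (solution_agrees c z1 r (Rmin d rho2) y (fun z => / (u z * u z))
                (fun z => pole_momentum z (u z) (v z))) as (d' & Hd' & Hag); auto.
    + apply Rmin_glb_lt; assumption.
    + apply (holo_inv (fun z => u z * u z)); [apply holo_mult; assumption|].
      apply Cmult_neq_0; assumption.
    + rewrite Eu. fold Y. replace Y with (Y * (u1 * u1) / (u1 * u1)) by (field; exact Hu1).
      rewrite HYu. field. exact Hu1.
    + rewrite Eu, Ev. symmetry. exact HPu.
    + exists (Rmin d d'). split; [apply Rmin_glb_lt; assumption|]. intros z Hz.
      assert (h1 := Rmin_l d d'). assert (h2 := Rmin_r d d').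
      rewrite Hag by lra. field. apply Hne. lra.
Qed.

(** * The singular point on the boundary circle *)

Lemma boundary_notin (c : C) (r : R) (z : C) : boundary (disk c r) z -> ~ disk c r z.
Proof.
  intros Hb Hz. destruct (disk_open _ _ _ Hz) as (d & Hd & H).
  destruct (Hb d Hd) as [_ (w & Hw & Hn)]. apply Hn, H, Hw.
Qed.

Lemma boundary_radius (c : C) (r : R) (z : C) : boundary (disk c r) z -> (Cmod (z - c) <= r)%R.
Proof.
  intros Hb. apply Rnot_lt_le. intros h.
  destruct (Hb (Cmod (z - c) - r)%R) as [(w & Hw & Hwd) _]; [lra|].
  unfold disk in *. assert (h1 := Cmod_sub_triangle z w c). rewrite (Cmod_sub_sym z w) in h1. lra.
Qed.

(** Poles are isolated, so every ray from a point of the disk contains regular points arbitrarily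
    close to it. *)
Lemma regular_point_near (c : C) (r : R) (y : C -> C) (w v : C) (d : R) :
  meromorphic_on (disk c r) y -> disk c r w -> v <> 0 -> (0 < d)%R ->
  exists t, (0 < t < d)%R /\ disk c r (w + RtoC t * v) /\ holo y (w + RtoC t * v).
Proof.
  intros Hm Hw Hv Hd. destruct (disk_open _ _ _ Hw) as (d1 & Hd1 & HD).
  destruct (meromorphic_form _ _ _ Hm Hw) as (n & h & d2 & Hd2 & _ & _ & Hf).
  assert (hv : (0 < Cmod v)%R) by (apply Cmod_gt_0, Hv).
  set (m := Rmin d1 d2). assert (hm1 : (m <= d1)%R) by apply Rmin_l.
  assert (hm2 : (m <= d2)%R) by apply Rmin_r.
  assert (hm : (0 < m)%R) by (apply Rmin_glb_lt; assumption).
  assert (hmv : (0 < m / Cmod v)%R) by (apply Rdiv_lt_0_compat; assumption).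
  set (t := (Rmin d (m / Cmod v) / 2)%R).
  assert (h1 := Rmin_l d (m / Cmod v)). assert (h2 := Rmin_r d (m / Cmod v)).
  assert (h3 : (0 < Rmin d (m / Cmod v))%R) by (apply Rmin_glb_lt; assumption).
  assert (ht : (0 < t < d)%R) by (unfold t; lra).
  assert (htm : (t < m / Cmod v)%R) by (unfold t; lra).
  assert (E : Cmod (w + RtoC t * v - w) = (t * Cmod v)%R).
  { replace (w + RtoC t * v - w) with (RtoC t * v) by ring. rewrite Cmod_mult, Cmod_n; lra. }
  assert (Hlt : (t * Cmod v < m)%R).
  { apply (Rmult_lt_compat_r (Cmod v)) in htm; [|exact hv].
    replace (m / Cmod v * Cmod v)%R with m in htm by (field; lra). exact htm. }
  exists t. split; [exact ht|]. split; [apply HD; rewrite E; lra|].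
  apply Hf; [rewrite E; lra|]. intros h4. rewrite h4 in E.
  replace (w - w) with (RtoC 0) in E by ring. rewrite Cmod_0 in E.
  assert (0 < t * Cmod v)%R by (apply Rmult_lt_0_compat; lra). lra.
Qed.

Theorem proposition19 :
  forall (y : C -> C) (c : C) (r : R) (zt : C),
    (0 < r)%R ->
    meromorphic_on (disk c r) y ->
    painleve1_solution_on (disk c r) y ->
    singular_point (disk c r) y zt ->
    extends_with_pole_of_order 2 (disk c r) y zt.
Proof.
  intros y c r zt Hr Hm Hs [Hb Hsing].
  assert (Hnin := boundary_notin _ _ _ Hb). assert (Hrad := boundary_radius _ _ _ Hb).
  set (Z0 := (Cmod c + r)%R). assert (hc := Cmod_ge_0 c).
  assert (HZ0 : (0 <= Z0)%R) by (unfold Z0; lra).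
  assert (HZ : forall z, disk c r z -> (Cmod z <= Z0)%R).
  { unfold disk, Z0. intros z Hz. assert (h := Cmod_le_sub z c). lra. }
  assert (Hc : disk c r c).
  { unfold disk. replace (c - c) with (RtoC 0) by ring. rewrite Cmod_0. exact Hr. }
  (* The center may itself be a pole, so the segment starts at a regular point beside it. *)
  destruct (regular_point_near c r y c 1 1 Hm Hc (RtoC_neq 1 R1_neq_R0) Rlt_0_1)
    as (t0 & _ & Hc0 & Ha0).
  set (c0 := c + RtoC t0 * 1) in *. set (e := zt - c0).
  assert (He : e <> 0).
  { intros h. apply Hnin. replace zt with (e + c0) by (unfold e; ring). rewrite h, Cplus_0_l.
    exact Hc0. }
  assert (he : (0 < Cmod e)%R) by (apply Cmod_gt_0, He).
  assert (Hseg : forall t, (0 <= t < 1)%R -> disk c r (c0 + RtoC t * e)).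
  { intros t Ht. unfold disk in *.
    replace (c0 + RtoC t * e - c) with (RtoC (1 - t) * (c0 - c) + RtoC t * (zt - c))
      by (unfold e; rewrite RtoC_minus; ring).
    eapply Rle_lt_trans; [apply Cmod_triangle|]. rewrite !Cmod_mult, !Cmod_n by lra.
    assert (h1 : ((1 - t) * Cmod (c0 - c) < (1 - t) * r)%R) by (apply Rmult_lt_compat_l; lra).
    assert (h2 : (t * Cmod (zt - c) <= t * r)%R) by (apply Rmult_le_compat_l; lra). lra. }
  assert (HE := energy_bounded c r Z0 y c0 e Hm Hs HZ HZ0 Ha0 He Hseg).
  set (M := (energy y c0 * exp (3 * (4 * (25 + 11 * Z0) * Cmod e)))%R) in HE.
  destruct (local_continuation M Z0 HZ0) as (rho & Hrho & Hloc).
  (* From this parameter on, the distance to [zt] is at most [rho / 2]; moving forward to a regular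
     point [z1] keeps it below [rho]. *)
  set (t1 := Rmax 0 (1 - rho / Cmod e / 2)).
  assert (hre : (0 < rho / Cmod e)%R) by (apply Rdiv_lt_0_compat; assumption).
  assert (ht1 : (0 <= t1 < 1)%R) by (split; [apply Rmax_l|apply Rmax_lub_lt; lra]).
  assert (ht1' := Rmax_r 0 (1 - rho / Cmod e / 2)). fold t1 in ht1'.
  destruct (regular_point_near c r y (c0 + RtoC t1 * e) e (1 - t1) Hm (Hseg t1 ht1) He)
    as (s & Hs1 & Hz1 & Ha1); [lra|].
  replace (c0 + RtoC t1 * e + RtoC s * e) with (c0 + RtoC (t1 + s) * e) in *
    by (rewrite RtoC_plus; ring).
  assert (HE1 := HE (t1 + s)%R ltac:(lra) Ha1).
  set (z1 := c0 + RtoC (t1 + s) * e) in *.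
  assert (Hzt : disk z1 rho zt).
  { unfold disk. replace (zt - z1) with (RtoC (1 - (t1 + s)) * e)
      by (unfold z1, e; rewrite RtoC_minus; ring).
    rewrite Cmod_mult, Cmod_n by lra.
    assert (h : (1 - (t1 + s) < rho / Cmod e)%R) by lra.
    apply (Rmult_lt_compat_r (Cmod e)) in h; [|exact he].
    replace (rho / Cmod e * Cmod e)%R with rho in h by (field; lra). exact h. }
  destruct (disk_open _ _ _ Hzt) as (d0 & Hd0 & HD0).
  destruct (Hloc c r y z1 Hs Hz1 Ha1 (HZ z1 Hz1) HE1) as [(g & Hg & Hnear)|(u & Hu & Hnear)].
  (* An analytic [g] about [z1] reaches [zt] and continues [y], against the singularity of [zt]. *)
  - exfalso. apply Hsing. exists d0, g. split; [exact Hd0|]. split.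
    + intros w Hw. apply analytic_at_holo. apply Hg, HD0, Hw.
    + intros w Hwc Hw. assert (Hwr := HD0 w Hw).
      destruct (propagate c z1 r rho y g (fun _ => 1) Hm Hz1 Hrho) with (w := w)
        as (d & Hd & Hyg); auto.
      * intros z Hz. split; [apply Hg, Hz|apply holo_const].
      * destruct Hnear as (d & Hd & H). exists d. split; [exact Hd|]. intros z Hz.
        rewrite H by exact Hz. ring.
      * rewrite (quotient_value c w r d y g (fun _ => 1) Hm Hwc (Hg w Hwr) (holo_const 1 w)
                   (RtoC_neq 1 R1_neq_R0) Hd Hyg). field.
  - assert (Hval : forall w, disk c r w -> disk z1 rho w -> u w <> 0 -> / (u w * u w) = y w).
    { intros w Hwc Hwr Huw.
      assert (Hauu : forall z, disk z1 rho z -> holo (fun z => u z * u z) z)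
        by (intros z Hz; apply holo_mult; apply Hu, Hz).
      destruct (propagate c z1 r rho y (fun _ => 1) (fun z => u z * u z) Hm Hz1 Hrho) with (w := w)
        as (d & Hd & Hyg); auto.
      - intros z Hz. split; [apply holo_const|apply Hauu, Hz].
      - rewrite (quotient_value c w r d y (fun _ => 1) (fun z => u z * u z) Hm Hwc
                   (holo_const 1 w) (Hauu w Hwr) (Cmult_neq_0 _ _ Huw Huw) Hd Hyg).
        field. exact Huw. }
    destruct (Hu zt Hzt) as [Hau Hcd].
    destruct (Ceq_dec (u zt) 0) as [Hu0|Hu0].
    (* The expansion of [u] at [zt] starts with coefficients 0 and 1, so [u = (z - zt) * h] with
       [h zt = 1]; then [1 / u^2] has a pole of order exactly 2. *)
    + specialize (Hcd Hu0). destruct Hau as (a & K1 & K & rr & Hexp).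
      assert (Ea1 : a 1%nat = 1).
      { rewrite <- (cdiff_C_derive u zt _ (expands_cdiff _ _ _ _ _ _ Hexp)).
        apply cdiff_C_derive, Hcd. }
      pose proof (fun z => expands_dom _ _ _ _ _ _ z Hexp) as Hdom.
      destruct Hexp as (HK & Hrr & HKr & Hga & Ef).
      assert (Hzz : zt - zt = RtoC 0) by ring.
      assert (Hc00 : (Cmod (zt - zt) < rr)%R) by (rewrite Hzz, Cmod_0; exact Hrr).
      assert (HPSS := fun z Hz => PS_S K1 K a (z - zt) (Rlt_le _ _ HK) (Hdom z Hz) Hga).
      assert (Ea0 : a O = 0).
      { rewrite <- Hu0, Ef, HPSS by exact Hc00. rewrite Hzz. ring. }
      set (h := fun z => PS (tail_seq 1 a) (z - zt)).
      assert (Huh : forall z, (Cmod (z - zt) < rr)%R -> u z = (z - zt) * h z).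
      { intros z Hz. rewrite Ef, HPSS by exact Hz. rewrite Ea0. unfold h. ring. }
      assert (Hah : holo h zt).
      { exists (tail_seq 1 a), (K1 * K ^ 1)%R, K, rr. repeat split; auto. apply geo_tail_seq, Hga. }
      assert (Hh1 : h zt <> 0).
      { unfold h. rewrite (PS_S _ K _ _ (Rlt_le _ _ HK) (Hdom zt Hc00) (geo_tail_seq K1 K 1 a Hga)).
        rewrite Hzz. unfold tail_seq at 1. simpl. rewrite Ea1, Cmult_0_l, Cplus_0_r.
        apply RtoC_neq, R1_neq_R0. }
      destruct (holo_neq_near h zt Hah Hh1) as (d3 & Hd3 & Hhn).
      set (ee := Rmin d0 (Rmin d3 rr)).
      assert (hee : (0 < ee)%R) by (repeat apply Rmin_glb_lt; assumption).
      assert (hle : (ee <= d0 /\ ee <= d3 /\ ee <= rr)%R).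
      { assert (h1 := Rmin_l d0 (Rmin d3 rr)). assert (h2 := Rmin_r d0 (Rmin d3 rr)).
        assert (h3 := Rmin_l d3 rr). assert (h4 := Rmin_r d3 rr). unfold ee. lra. }
      assert (Hsub : forall z, z <> zt -> z - zt <> 0).
      { intros z Hz E. apply Hz. replace z with (z - zt + zt) by ring. rewrite E. ring. }
      exists ee, (fun z => / (u z * u z)). split; [exact hee|]. split.
      * exists (fun z => / (h z * h z)), ee. split; [exact hee|]. split.
        { apply analytic_at_holo. apply (holo_inv (fun z => h z * h z)).
          - apply holo_mult; exact Hah.
          - apply Cmult_neq_0; exact Hh1. }
        split.
        { intros E. assert (E' : h zt * h zt * / (h zt * h zt) = 1) by (field; exact Hh1).
          rewrite E, Cmult_0_r in E'. apply RtoC_inj in E'. lra. }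
        intros z Hz Hzne. unfold disk in Hz. rewrite Huh by lra.
        assert (Hz' := Hsub z Hzne). assert (Hhz := Hhn z ltac:(lra)). field. split; assumption.
      (* Only points of the open disk are compared, and [zt] is not among them, so [u w] is
         nonzero. *)
      * intros w Hwc Hw. unfold disk in Hw. apply Hval; [exact Hwc|apply HD0; lra|].
        rewrite Huh by lra. apply Cmult_neq_0; [|apply Hhn; lra].
        apply Hsub. intros ->. exact (Hnin Hwc).
    (* If [u] does not vanish at [zt], then [1 / u^2] is an analytic continuation of [y] there. *)
    + exfalso. apply Hsing.
      destruct (holo_neq_near u zt Hau Hu0) as (d3 & Hd3 & Hun).
      assert (h1 := Rmin_l d0 d3). assert (h2 := Rmin_r d0 d3).
      exists (Rmin d0 d3), (fun z => / (u z * u z)).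
      split; [apply Rmin_glb_lt; assumption|]. split.
      * intros w Hw. unfold disk in Hw. apply analytic_at_holo.
        assert (Hauw : holo u w) by (apply Hu, HD0; lra).
        apply (holo_inv (fun z => u z * u z)); [apply holo_mult; exact Hauw|].
        apply Cmult_neq_0; apply Hun; lra.
      * intros w Hwc Hw. unfold disk in Hw. apply Hval; [exact Hwc|apply HD0; lra|apply Hun; lra].
Qed.
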